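(* Let $n \ge 1$ and let $A \in \mathfrak{B}(2n)$, with associated real Bott manifold $M(A)$ of dimension $2n$. The following conditions are equivalent: (1) $M(A)$ is cohomologically symplectic, that is, there exists $\alpha \in H^2(M(A))$ such that $\alpha^n \in H^{2n}(M(A))$ is nonzero. (2) There exist $n$ subsets $\{j_1, j_{n+1}\}, \dots, \{j_n, j_{2n}\}$ of $\{1,2,\dots,2n\}$ such that $\{1,2,\dots,2n\}$ is the disjoint union $\coprod_{k=1}^n \{j_k, j_{k+n}\}$, and $A_{j_1} = A_{j_{n+1}}, \dots, A_{j_n} = A_{j_{2n}}$. (3) There exists a symplectic form on $M(A)$. (4) There exists a Kähler structure on $M(A)$. Moreover, any $\alpha \in H^2(M(A))$ with $\alpha^n \neq 0$ can be represented by a symplectic form on $M(A)$.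
   Context: All cohomology $H^*$ is de Rham cohomology over $\mathbb{R}$. For a positive integer $m$, $\mathfrak{B}(m)$ denotes the set of $m \times m$ upper triangular matrices with entries in $\{0,1\}$ and zero diagonal entries. For $A \in \mathfrak{B}(m)$, $A^i_j$ denotes the $(i,j)$ entry and $A_j$ denotes the $j$-th column of $A$. Entries are regarded as elements of $\mathbb{Z}/2 = \{0,1\}$. Let $S^1$ be the unit circle in $\mathbb{C}$ and $T^m = (S^1)^m$. For $z \in S^1$ and $a \in \mathbb{Z}/2$, put $z(a) := z$ if $a=0$ and $z(a) := \bar z$ if $a=1$. For $A \in \mathfrak{B}(m)$ and $i = 1,\dots,m$, define the involution $a_i$ on $T^m$ by $$a_i(z_1,\dots,z_m) := (z_1,\dots,z_{i-1}, -z_i, z_{i+1}(A^i_{i+1}), \dots, z_m(A^i_m)).$$ Let $G(A)$ be the (finite) transformation group on $T^m$ generated by $a_1,\dots,a_m$. The real Bott manifold associated with $A$ is the quotient smooth manifold $M(A) := T^m/G(A)$ (the action is free). *)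

(* Defs.v *)
From HB Require Import structures.
From mathcomp Require Import all_boot all_order all_algebra all_fingroup.
From mathcomp Require Import generic_quotient complex.
From mathcomp Require Import all_classical all_reals all_analysis.
From mathcomp Require Import ring lra.

Set Implicit Arguments.
Unset Strict Implicit.
Unset Printing Implicit Defensive.

Import Order.TTheory GRing.Theory Num.Theory.
Import numFieldNormedType.Exports.

Local Open Scope ring_scope.
Local Open Scope quotient_scope.

(* A pairing of the columns of [A] into pairs of equal columns: the sets
   [{j k, j' k}], for [k < n], are disjoint and cover all the indices.  The
   indices [j 0, ..., j n.-1, j' 0, ..., j' n.-1] are the j_1, ..., j_2n of the
   mathematical statement. *)
Definition column_pairing (n : nat) (A : 'M['F_2]_(2 * n))
    (j j' : 'I_n -> 'I_(2 * n)) : Prop :=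
  [/\ (\bigcup_(k < n) [set j k; j' k])%SET = [set: 'I_(2 * n)]%SET,
      forall k l, k != l ->
        [disjoint [set j k; j' k]%SET & [set j l; j' l]%SET]
    & forall k, col (j k) A = col (j' k) A].

Local Open Scope classical_set_scope.

Section Smooth.
Context {R : realType} {m : nat}.
Implicit Types (U : set 'rV[R]_m) (f : 'rV[R]_m -> R).

Definition partial (i : 'I_m) f : 'rV[R]_m -> R :=
  fun x => 'D_(delta_mx 0 i) f x.

Definition partials (s : seq 'I_m) f := foldr partial f s.

(* [U] is meant to be open *)
Definition smooth_on U f : Prop :=
  forall s x, U x ->
    {for x, continuous (partials s f)} /\
    forall i, derivable (partials s f) x (delta_mx 0 i).

Definition smooth_map_on (p : nat) U (F : 'rV[R]_m -> 'rV[R]_p) : Prop :=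
  forall j, smooth_on U (fun x => F x 0 j).

End Smooth.

(* Charts are given by their inverses, the parametrizations [chart_param i], which
   are only meaningful on the open set [chart_dom i].  The Hausdorff and
   countability axioms play no role in the notions defined below and are not recorded. *)
Record smooth_atlas (R : realType) (m : nat) := SmoothAtlas {
  carrier :> Type;
  chart : Type;
  chart_dom : chart -> set 'rV[R]_m;
  chart_param : chart -> 'rV[R]_m -> carrier;
  dom_open : forall i, open (chart_dom i);
  param_inj : forall i, {in chart_dom i &, injective (chart_param i)};
  param_cover : forall p, exists i,
    exists2 x, chart_dom i x & chart_param i x = p;
  param_smooth : forall i j x y, chart_dom i x -> chart_dom j y ->
    chart_param i x = chart_param j y ->
    exists W : set 'rV[R]_m, exists t : 'rV[R]_m -> 'rV[R]_m,
      [/\ open W, W x, W `<=` chart_dom i, smooth_map_on W t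
        & forall z, W z ->
            chart_dom j (t z) /\ chart_param j (t z) = chart_param i z] }.

Section Tensors.
Context {R : realType} {m : nat} (M : smooth_atlas R m).
Implicit Types (i j : chart M) (k l n : nat).

(* on [W], [t] is the change of coordinates
   (chart_param j)^-1 \o (chart_param i) *)
Definition transition i j (W : set 'rV[R]_m) (t : 'rV[R]_m -> 'rV[R]_m) : Prop :=
  [/\ open W, W `<=` chart_dom i, smooth_map_on W t
    & forall z, W z ->
        chart_dom j (t z) /\ chart_param j (t z) = chart_param i z].

(* Expressions of a tensor field of type (0,k) in the charts of the atlas; the
   [k] tangent vectors are the rows of a matrix.  Values outside [chart_dom i]
   are irrelevant. *)
Definition tensor k : Type := chart M -> 'rV[R]_m -> 'M[R]_(k, m) -> R.

Definition multilinear k (f : 'M[R]_(k, m) -> R) : Prop :=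
  forall (a : 'I_k) (u v w : 'M[R]_(k, m)) (b c : R),
    row a u = b *: row a v + c *: row a w ->
    row' a v = row' a u -> row' a w = row' a u ->
    f u = b * f v + c * f w.

Definition alternating k (f : 'M[R]_(k, m) -> R) : Prop :=
  forall (v : 'M[R]_(k, m)) (a b : 'I_k), a != b -> row a v = row b v -> f v = 0.

(* differential k-forms; [jacobian] acts on row vectors by right multiplication,
   so the last clause says that [w i] is the pull-back of [w j] along [t] *)
Definition is_form k (w : tensor k) : Prop :=
  [/\ forall i x, chart_dom i x -> multilinear (w i x),
      forall i x, chart_dom i x -> alternating (w i x),
      forall i v, smooth_on (chart_dom i) (fun x => w i x v)
    & forall i j W t, transition i j W t ->
        forall x v, W x -> w i x v = w j (t x) (v *m jacobian t x)].

Definition form_eq k (w h : tensor k) : Prop :=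
  forall i x v, chart_dom i x -> w i x v = h i x v.

Definition form0 {k} : tensor k := fun _ _ _ => 0.

Definition form1 : tensor 0 := fun _ _ _ => 1.

Definition form_sub k (w h : tensor k) : tensor k :=
  fun i x v => w i x v - h i x v.

(* exterior derivative, evaluated on constant vector fields *)
Definition ext_d k (w : tensor k) : tensor k.+1 := fun i x v =>
  \sum_(a < k.+1) (-1) ^+ a * 'D_(row a v) (fun y => w i y (row' a v)) x.

(* normalised so that dx_1 /\ ... /\ dx_k is the determinant *)
Definition wedge k l (w : tensor k) (h : tensor l) : tensor (k + l) :=
  fun i x v =>
  (k`!%:R * l`!%:R)^-1 *
  \sum_(s : 'S_(k + l)) (-1) ^+ s *
    (w i x (usubmx (row_perm s v)) * h i x (dsubmx (row_perm s v))).

Definition closed_form k (w : tensor k) : Prop :=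
  is_form w /\ form_eq (ext_d w) form0.

Definition exact_form k : tensor k -> Prop :=
  match k with
  | 0 => fun w => form_eq w form0
  | k'.+1 => fun w => exists2 b : tensor k', is_form b & form_eq w (ext_d b)
  end.

(* The quotient of closed forms by exact forms: a class is the set of all its
   representatives. *)
Definition coh_class k (w : tensor k) : set (tensor k) :=
  [set h | closed_form h /\ exact_form (form_sub h w)].

Definition deRham k : set (set (tensor k)) :=
  [set c | exists2 w, closed_form w & c = coh_class w].

(* product of classes: the union of the classes of the products of their
   representatives, all of which coincide *)
Definition cup k l (c : set (tensor k)) (d : set (tensor l)) :
    set (tensor (k + l)) :=
  \bigcup_(w in c) \bigcup_(h in d) coh_class (wedge w h).

(* [n.+1 * 2] reduces to [2 + n * 2] *)
Fixpoint cup_exp (c : set (tensor 2)) n : set (tensor (n * 2)) :=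
  match n return set (tensor (n * 2)) with
  | 0 => coh_class form1
  | n'.+1 => cup c (@cup_exp c n')
  end.

Definition cohomologically_symplectic n : Prop :=
  exists2 alpha, @deRham 2 alpha & @cup_exp alpha n <> coh_class form0.

Definition symplectic_form (w : tensor 2) : Prop :=
  closed_form w /\
  forall i x (u : 'rV[R]_m), chart_dom i x ->
    (forall v : 'rV[R]_m, w i x (col_mx u v) = 0) -> u = 0.

(* [g i x] is the Gram matrix of the metric: <u, v> = u *m g i x *m v^T *)
Definition riemannian_metric (g : chart M -> 'rV[R]_m -> 'M[R]_m) : Prop :=
  [/\ forall i a b, smooth_on (chart_dom i) (fun x => g i x a b),
      forall i x, chart_dom i x -> (g i x)^T = g i x,
      forall i x (v : 'rV[R]_m), chart_dom i x -> v != 0 ->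
        0 < (v *m g i x *m v^T) 0 0
    & forall i j W t, transition i j W t -> forall x, W x ->
        g i x = jacobian t x *m g j (t x) *m (jacobian t x)^T].

(* [J i x] acts on (row) tangent vectors by right multiplication *)
Definition almost_complex (J : chart M -> 'rV[R]_m -> 'M[R]_m) : Prop :=
  [/\ forall i a b, smooth_on (chart_dom i) (fun x => J i x a b),
      forall i x, chart_dom i x -> J i x *m J i x = - 1%:M
    & forall i j W t, transition i j W t -> forall x, W x ->
        J i x *m jacobian t x = jacobian t x *m J j (t x)].

(* Local holomorphic coordinates p + i q with values in C^n, where m = 2n: the
   differential of (p, q) is injective, hence invertible, and satisfies the
   Cauchy-Riemann equations dp \o J = - dq and dq \o J = dp.  (By the inverse
   function theorem, (p, q) is a chart near each point of [W].) *)
Definition holomorphic_coordinates n (W : set 'rV[R]_m)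
    (J : 'rV[R]_m -> 'M[R]_m) (p q : 'rV[R]_m -> 'rV[R]_n) : Prop :=
  [/\ smooth_map_on W p, smooth_map_on W q
    & forall x, W x ->
      [/\ forall v : 'rV[R]_m,
            v *m jacobian p x = 0 -> v *m jacobian q x = 0 -> v = 0,
          J x *m jacobian p x = - jacobian q x
        & J x *m jacobian q x = jacobian p x]].

Definition complex_structure n (J : chart M -> 'rV[R]_m -> 'M[R]_m) : Prop :=
  almost_complex J /\
  forall i x, chart_dom i x ->
    exists W : set 'rV[R]_m, exists p, exists q,
      [/\ open W, W x, W `<=` chart_dom i
        & @holomorphic_coordinates n W (J i) p q].

(* (u, v) |-> <J u, v> *)
Definition fundamental_form (g J : chart M -> 'rV[R]_m -> 'M[R]_m) : tensor 2 :=
  fun i x v => (row 0 v *m J i x *m g i x *m (row 1 v)^T) 0 0.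

(* Kaehler structures on a manifold of dimension m = 2n *)
Definition kaehler_structure n (g J : chart M -> 'rV[R]_m -> 'M[R]_m) : Prop :=
  [/\ riemannian_metric g, complex_structure n J,
      forall i x, chart_dom i x -> J i x *m g i x *m (J i x)^T = g i x
    & closed_form (fundamental_form g J)].

End Tensors.

Arguments tensor {R m} M k.
Arguments form0 {R m M k}.
Arguments coh_class {R m M k} w.
Arguments deRham {R m} M k.
Arguments cup_exp {R m M} c n.

Section Torus.
Variable (R : realType).

Definition circle := {z : R[i] | `|z| == 1}.

Definition mk_circle (z : R[i]) (z1 : `|z| == 1) : circle := exist _ z z1.

Lemma circle_opp_subproof (z : circle) : `|- val z| == 1.
Proof. by rewrite normrN (valP z). Qed.

Definition circle_opp (z : circle) : circle :=
  mk_circle (circle_opp_subproof z).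

Lemma circle_conj_subproof (z : circle) : `|((val z)^*)%C| == 1.
Proof. by rewrite normcJ (valP z). Qed.

Definition circle_conj (z : circle) : circle :=
  mk_circle (circle_conj_subproof z).

Lemma circle_exp_subproof (t : R) : `|(cos t +i* sin t)%C| == 1.
Proof. by rewrite normc_def /= cos2Dsin2 sqrtr1. Qed.

Definition circle_exp (t : R) : circle := mk_circle (circle_exp_subproof t).

(* z(a): conjugation of [z] when [a = 1] *)
Definition twist (z : circle) (a : 'F_2) : circle :=
  if a == 0 then z else circle_conj z.

Definition torus (m : nat) : choiceType := {ffun 'I_m -> circle}.

Definition torus_exp (m : nat) (x : 'rV[R]_m) : torus m :=
  [ffun j => circle_exp (x 0 j)].

Definition bott_mx (m : nat) (A : 'M['F_2]_m) : Prop :=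
  forall i j : 'I_m, (j <= i)%N -> A i j = 0.

Definition bott_involution (m : nat) (A : 'M['F_2]_m) (i : 'I_m) (z : torus m) :
    torus m :=
  [ffun j : 'I_m => if (j < i)%N then z j
                    else if j == i then circle_opp (z j)
                    else twist (z j) (A i j)].

Inductive bott_group (m : nat) (A : 'M['F_2]_m) : (torus m -> torus m) -> Prop :=
| bott_group_gen i : bott_group A (bott_involution A i)
| bott_group1 : bott_group A id
| bott_groupM f g : bott_group A f -> bott_group A g -> bott_group A (f \o g)
| bott_groupV f g : bott_group A f -> cancel f g -> cancel g f -> bott_group A g.

Definition same_orbit (m : nat) (A : 'M['F_2]_m) : rel (torus m) :=
  fun z w => `[< exists2 f, bott_group A f & w = f z >].



(* Every element of [bott_group A] is [bott_act A e] for some [e] (bott_groupE):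
   it flips the sign of [z j] when [e j = 1], after conjugating it once for each
   [i] with [e i = A i j = 1]. *)
Definition bott_act (m : nat) (A : 'M['F_2]_m) (e : 'rV['F_2]_m) (z : torus m) :
    torus m :=
  [ffun j => let w := twist (z j) ((e *m A) 0 j) in
             if e 0 j == 0 then w else circle_opp w].

Lemma circle_oppK : involutive circle_opp.
Proof. by move=> z; apply: val_inj; rewrite /= opprK. Qed.

Lemma F2P (a : 'F_2) : a = 0 \/ a = 1.
Proof. by case: a => -[|[|//]] i; [left|right]; exact: val_inj. Qed.

Lemma twist_opp z a : twist (circle_opp z) a = circle_opp (twist z a).
Proof.
by rewrite /twist; case: ifP => // _; apply: val_inj; rewrite /= rmorphN.
Qed.

Lemma twistD z a b : twist z (a + b) = twist (twist z a) b.
Proof.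
have cK : circle_conj (circle_conj z) = z.
  by apply: val_inj; rewrite /= conjcK.
by rewrite /twist; case: (F2P a) => ->; case: (F2P b) => -> //=.
Qed.

Section BottGroup.
Variables (m : nat) (A : 'M['F_2]_m).

Lemma bott_actD e f z : bott_act A e (bott_act A f z) = bott_act A (e + f) z.
Proof.
apply/ffunP => j; rewrite !ffunE /= mulmxDl [(_ + _ : 'rV_m) 0 j]mxE.
rewrite [((e *m A) + (f *m A)) 0 j]mxE [(e *m A) 0 j + _]addrC twistD.
case: (F2P (e 0 j)) => ->; case: (F2P (f 0 j)) => ->; rewrite /= ?twist_opp //.
by rewrite circle_oppK.
Qed.

Lemma bott_act0 z : bott_act A 0 z = z.
Proof. by apply/ffunP => j; rewrite !ffunE mul0mx mxE. Qed.

Lemma bott_actK e : involutive (bott_act A e).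
Proof.
move=> z; rewrite bott_actD.
suff -> : e + e = 0 by exact: bott_act0.
by apply/rowP => j; rewrite !mxE; case: (F2P (e 0 j)) => ->; exact: val_inj.
Qed.

Hypothesis Au : bott_mx A.

Lemma bott_involutionE i : bott_involution A i =1 bott_act A (delta_mx 0 i).
Proof.
move=> z; apply/ffunP => j; rewrite !ffunE -rowE !mxE /=.
case: ltngtP => [ji|ij|/val_inj ->].
- by rewrite Au ?(ltnW ji) // (_ : (j == i) = false) //; exact: ltn_eqF.
- by rewrite (_ : (j == i) = false) //; exact: gtn_eqF.
- by rewrite eqxx Au.
Qed.

Lemma bott_groupE f : bott_group A f -> exists e, f =1 bott_act A e.
Proof.
elim=> [i||f1 f2 _ [e1 h1] _ [e2 h2]|f1 f2 _ [e h] fK gK].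
- by exists (delta_mx 0 i); exact: bott_involutionE.
- by exists 0 => z; rewrite bott_act0.
- by exists (e1 + e2) => z; rewrite /= h1 h2 bott_actD.
- by exists e => z; apply: (can_inj fK); rewrite gK h bott_actK.
Qed.

Lemma bott_group_inv f : bott_group A f ->
  exists2 g, bott_group A g & cancel f g.
Proof.
move=> fG; have [e fE] := bott_groupE fG.
have fK : cancel f f by move=> z; rewrite !fE bott_actK.
by exists f.
Qed.

Lemma same_orbit_refl : reflexive (same_orbit A).
Proof. by move=> z; apply/asboolP; exists id => //; exact: bott_group1. Qed.

Lemma same_orbit_sym : symmetric (same_orbit A).
Proof.
suff H z w : same_orbit A z w -> same_orbit A w z.
  by move=> z w; apply/idP/idP; exact: H.
move=> /asboolP[f fG ->]; apply/asboolP.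
by have [g gG fK] := bott_group_inv fG; exists g.
Qed.

Lemma same_orbit_trans : transitive (same_orbit A).
Proof.
move=> w z u /asboolP[f fG ->] /asboolP[g gG ->]; apply/asboolP.
by exists (g \o f) => //; exact: bott_groupM.
Qed.

Definition same_orbit_equiv :=
  EquivRel (same_orbit A) same_orbit_refl same_orbit_sym same_orbit_trans.

(* T^m / G(A) *)
Definition bott_quotient := {eq_quot same_orbit_equiv}.

(* the composite of the universal covering R^m -> T^m and of the projection
   T^m -> T^m / G(A) *)
Definition bott_cover (x : 'rV[R]_m) : bott_quotient :=
  \pi_bott_quotient (torus_exp x).

Lemma bott_coverP x y : bott_cover x = bott_cover y ->
  exists2 e, bott_group A (bott_act A e) &
    torus_exp y = bott_act A e (torus_exp x).
Proof.
move=> /eqmodP /asboolP[f fG yE].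
have [e fE] := bott_groupE fG; exists e; last by rewrite yE fE.
by have -> : bott_act A e = f by apply/funext => z; rewrite fE.
Qed.

Lemma bott_cover_act x y e : bott_group A (bott_act A e) ->
  torus_exp y = bott_act A e (torus_exp x) -> bott_cover x = bott_cover y.
Proof. by move=> eG yE; apply/eqmodP/asboolP; exists (bott_act A e). Qed.

Lemma circle_exp_inj (s t : R) : `|s - t| < pi ->
  circle_exp s = circle_exp t \/ circle_exp s = circle_opp (circle_exp t) ->
  s = t /\ circle_exp s <> circle_opp (circle_exp t).
Proof.
move=> st H.
have sin0 : sin (s - t) = 0.
  by rewrite sinB; case: H => /(congr1 val) /= [-> ->]; ring.
have sE : s = t.
  apply/eqP; rewrite -subr_eq0; move: st sin0; rewrite ltr_norml.
  set d := s - t; case: (ltgtP d 0) => // d0 /andP[d1 d2] dE.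
    have : 0 < sin (- d) by apply: sin_gt0_pi; rewrite oppr_gt0 d0 ltrNl.
    by rewrite sinN dE oppr0 ltxx.
  have : 0 < sin d by apply: sin_gt0_pi; rewrite d0.
  by rewrite dE ltxx.
split=> //; rewrite sE => /(congr1 val) /= [c0 s0].
have := cos2Dsin2 t.
have c00 : cos t = 0 by lra.
have s00 : sin t = 0 by lra.
by rewrite c00 s00 expr0n addr0 => /eqP; rewrite eq_sym oner_eq0.
Qed.

Lemma torus_exp_inj (x y : 'rV[R]_m) e : (forall j, `|y 0 j - x 0 j| < pi) ->
  torus_exp y = bott_act A e (torus_exp x) -> y = x.
Proof.
move=> xy yE.
have H (j : 'I_m) : (forall i : 'I_m, (i < j)%N -> e 0 i = 0) ->
    e 0 j = 0 /\ y 0 j = x 0 j.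
  move=> ej; move/ffunP: yE => /(_ j); rewrite !ffunE /=.
  have -> : (e *m A) 0 j = 0.
    rewrite mxE big1 // => i _.
    by case: (ltnP i j) => ij; [rewrite ej ?mul0r | rewrite Au ?mulr0].
  rewrite [twist _ 0]/twist eqxx.
  case: ifP => [/eqP ej0|_] E.
    by have [] := circle_exp_inj (xy j) (or_introl E).
  by have [_ []] := circle_exp_inj (xy j) (or_intror E).
have E (j : 'I_m) : e 0 j = 0.
  have [k] := ubnP (val j); elim: k j => // k IH j jk.
  by apply H => i ij; apply: IH; apply: leq_trans ij _.
by apply/rowP => j; apply H.
Qed.

(* the lift of the action to R^m that sends [x] to [y] *)
Definition bott_lift (e : 'rV['F_2]_m) (x y z : 'rV[R]_m) : 'rV[R]_m :=
  \row_j (y 0 j + (if (e *m A) 0 j == 0 then 1 else -1) * (z 0 j - x 0 j)).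

Lemma bott_liftP e x y z : torus_exp y = bott_act A e (torus_exp x) ->
  torus_exp (bott_lift e x y z) = bott_act A e (torus_exp z).
Proof.
move=> /ffunP yE; apply/ffunP => j; move: (yE j).
rewrite !ffunE (_ : bott_lift e x y z 0 j = y 0 j +
  (if (e *m A) 0 j == 0 then 1 else -1) * (z 0 j - x 0 j)) ?[LHS]mxE //=.
pose d := z 0 j - x 0 j; rewrite -/d (_ : z 0 j = x 0 j + d); last first.
  by rewrite /d addrC subrK.
clearbody d.
rewrite /twist; case: ifP => _; case: ifP => _ /(congr1 val) /= [c s];
  apply: val_inj => /=; rewrite ?mul1r ?mulN1r !cosD !sinD c s ?cosN ?sinN /=;
  congr Complex; ring.
Qed.

Lemma smooth_affine U (i : 'I_m) (a b c : R) :
  smooth_on U (fun x : 'rV[R]_m => a + b * (x 0 i - c)).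
Proof.
have coordD (x v : 'rV[R]_m) : is_derive x v (fun z => z 0 i) (v 0 i).
  have dc : differentiable (fun z : 'rV[R]_m => z 0 i) x.
    exact: differentiable_coord.
  apply: DeriveDef; first exact: diff_derivable.
  have cl : linear (fun z : 'rV[R]_m => z 0 i) by move=> k u w; rewrite !mxE.
  pose cM := GRing.isLinear.Build _ _ _ _ _ cl.
  pose cL : {linear 'rV[R]_m -> R} := HB.pack (fun z : 'rV[R]_m => z 0 i) cM.
  rewrite deriveE // (_ : (fun z : 'rV[R]_m => z 0 i) = cL) // diff_lin //.
  exact: coord_continuous.
have affD p q (x v : 'rV[R]_m) :
    is_derive x v (fun z => p + q * (z 0 i - c)) (q * v 0 i).
  rewrite (_ : (fun z => _) =
      cst p + q *: ((fun z : 'rV[R]_m => z 0 i) - cst c)); last first.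
    by apply/funext => z.
  by apply: is_derive_eq; rewrite add0r subr0.
move=> s x _.
have [p [q ->]] : exists p q, partials s (fun z : 'rV[R]_m => a + b * (z 0 i - c))
    = fun z => p + q * (z 0 i - c).
  elim: s => [|k s [p [q IH]]] /=; first by exists a, b.
  exists (q * (delta_mx 0 k : 'rV[R]_m) 0 i), 0; apply/funext => z.
  by rewrite IH /partial derive_val mul0r addr0.
split=> [|k]; last exact: ex_derive.
rewrite (_ : (fun z => _) =
    cst p + q *: ((fun z : 'rV[R]_m => z 0 i) - cst c)); last first.
  by apply/funext => z.
apply: continuousD; first exact: cst_continuous.
apply: continuousZr; apply: continuousB; last exact: cst_continuous.
exact: coord_continuous.
Qed.

Lemma bott_lift_smooth U e x y : smooth_map_on U (bott_lift e x y).
Proof.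
move=> j.
have -> : (fun z => bott_lift e x y z 0 j) = fun z => y 0 j +
    (if (e *m A) 0 j == 0 then 1 else -1) * ((z : 'rV[R]_m) 0 j - x 0 j).
  by apply/funext => z; rewrite [LHS]mxE.
exact: smooth_affine.
Qed.

Lemma rV_ballP (c x : 'rV[R]_m) (r : R) : 0 < r ->
  ball c r x <-> forall j, `|c 0 j - x 0 j| < r.
Proof.
move=> r0; split=> [[_ H] j|H]; first exact: H.
by split=> // i j; rewrite (ord1 i); exact: H.
Qed.

Lemma pihalf_gt0 : 0 < pi / 2 :> R.
Proof. by rewrite divr_gt0 // pi_gt0. Qed.

Lemma bott_param_inj (c : 'rV[R]_m) :
  {in (ball c (pi / 2) : set 'rV[R]_m) &, injective bott_cover}.
Proof.
move=> x y; rewrite !inE => /(rV_ballP _ _ pihalf_gt0) xc.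
move=> /(rV_ballP _ _ pihalf_gt0) yc /bott_coverP[e _ xy].
apply/esym/(torus_exp_inj _ xy) => j; move: (xc j) (yc j).
rewrite !ltr_norml => /andP[? ?] /andP[? ?]; apply/andP; lra.
Qed.

Lemma circle_exp_surj z : exists t, circle_exp t = z.
Proof.
case: z => -[a b] /= H; have := H; rewrite normc_def /= => /eqP[].
move=> /(congr1 (fun r => r ^+ 2)); rewrite sqr_sqrtr ?addr_ge0 ?sqr_ge0 //.
rewrite expr1n => ab.
have a1 : -1 <= a <= 1 by apply/andP; nra.
have sE : 1 - a ^+ 2 = b ^+ 2 by rewrite -ab addrC addKr.
have cE : cos (acos a) = a by apply: acosK; rewrite in_itv.
case: (leP 0 b) => b0; [exists (acos a) | exists (- acos a)]; apply: val_inj => /=;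
  rewrite ?cosN ?sinN cE sin_acos // sE sqrtr_sqr.
  by rewrite ger0_norm.
by rewrite ltr0_norm // opprK.
Qed.

Lemma bott_param_cover p : exists c : 'rV[R]_m,
  exists2 x, ball c (pi / 2) x & bott_cover x = p.
Proof.
have [t tE] := boolp.choice (fun j => circle_exp_surj ((repr p : torus m) j)).
exists (\row_j t j), (\row_j t j); first exact/ballxx/pihalf_gt0.
rewrite /bott_cover -[RHS]reprK; congr \pi.
by apply/ffunP => j; rewrite ffunE mxE.
Qed.

Lemma bott_param_smooth (c d x y : 'rV[R]_m) :
  ball c (pi / 2) x -> ball d (pi / 2) y -> bott_cover x = bott_cover y ->
  exists W : set 'rV[R]_m, exists t : 'rV[R]_m -> 'rV[R]_m,
    [/\ open W, W x, W `<=` ball c (pi / 2), smooth_map_on W t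
      & forall z, W z -> ball d (pi / 2) (t z) /\ bott_cover (t z) = bott_cover z].
Proof.
move=> xc yd /bott_coverP[e eG xy].
pose s (j : 'I_m) : R := if (e *m A) 0 j == 0 then 1 else -1.
pose d' : 'rV[R]_m := \row_j (x 0 j + s j * (d 0 j - y 0 j)).
have dP z : ball d' (pi / 2) z <-> ball d (pi / 2) (bott_lift e x y z).
  have tE j : bott_lift e x y z 0 j = y 0 j + s j * (z 0 j - x 0 j).
    by rewrite [LHS]mxE.
  have d'E j : d' 0 j = x 0 j + s j * (d 0 j - y 0 j) by rewrite [LHS]mxE.
  split=> /(rV_ballP _ _ pihalf_gt0) H; apply/(rV_ballP _ _ pihalf_gt0) => j;
    move: (H j); rewrite tE d'E /s; case: ifP => _; rewrite !ltr_norml;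
    move=> /andP[? ?]; apply/andP; lra.
have xE : bott_lift e x y x = y.
  by apply/rowP => j; rewrite mxE subrr mulr0 addr0.
exists (ball c (pi / 2) `&` ball d' (pi / 2)), (bott_lift e x y); split.
- by apply: openI; exact: ball_open.
- by split=> //; apply/dP; rewrite xE.
- by move=> z [].
- exact: bott_lift_smooth.
- move=> z [_ /dP dz]; split=> //.
  exact/esym/(bott_cover_act eG)/bott_liftP.
Qed.

(* The smooth manifold T^m / G(A): its charts are the inverses of the
   restrictions of [bott_cover] to the cubes of side pi. *)
Definition bott_manifold : smooth_atlas R m :=
  SmoothAtlas (fun c : 'rV[R]_m => ball_open c (pi / 2))
    bott_param_inj bott_param_cover bott_param_smooth.

End BottGroup.
End Torus.

(* Main.v *)
From mathcomp Require Import all_boot all_order all_algebra all_fingroup.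
From mathcomp Require Import all_classical all_reals all_analysis.
From mathcomp Require Import ring lra.
Require Import Defs.

Set Implicit Arguments.
Unset Strict Implicit.
Unset Printing Implicit Defensive.

Import Order.TTheory GRing.Theory Num.Theory.
Import numFieldNormedType.Exports.

Local Open Scope ring_scope.

(* Up to the action of the deck group of R^m -> M(A), a form on M(A) is a form on
   R^m invariant under the translations by 2 pi e_k and the affine maps that lift
   the a_i; their linear parts are diagonal with entries +1 and -1.  Averaging
   over the circles in the directions e_1, ..., e_m replaces a closed 2-form by a
   cohomologous one with constant coefficients, still invariant, whose (i, j)
   coefficient can be nonzero only if A_i = A_j.  By the Leibniz rule, the n-th
   power of the class is then the class of the n-th power of this constant form:
   if it is nonzero, so is the Pfaffian of the coefficients.  Hence the constant
   form is symplectic, and some term of the expansion of the Pfaffian is a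
   perfect matching of equal columns.  Conversely such a matching makes the
   standard complex structure invariant, a Kaehler structure is symplectic, and
   the top power of a symplectic form has no zero, hence a nonzero average, while
   averages of exact forms vanish. *)

(** * Alternating multilinear forms and Pfaffians *)

(** The lifts of the [a_i] may reflect coordinates, so the averages and the primitive that compares
    them with the identity must be compatible with reflections. Integrating over a period centred at
    the point, from -pi to pi, reduces this to the parity of the weight. The linear part of the lift
    of [a_i] multiplies the coordinate p by (-1)^(A i p). A constant coefficient of dx_p dx_q is
    thus multiplied by the product of two such signs for every i, which is why whole columns of [A]
    get compared. Whether M(A) is orientable is not known in advance, so classes of top degree are
    tested on R^m: the coefficient of a form is averaged over all the coordinate circles, and
    periodicity kills the average of an exact form. The delicate point of the linear algebra is a
    sign. The n-th power of a 2-form, evaluated on a basis, is a sum of (2n)! signed products up to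
    a positive factor, and for a nondegenerate form these must not cancel. On a symplectic basis
    each term turns out to be nonnegative, and the identity contributes 1. *)

Section Multilinear.
Context {R : realType}.

Definition set_row k m (a : 'I_k) (r : 'rV[R]_m) (v : 'M[R]_(k, m)) : 'M[R]_(k, m) :=
  \matrix_(i, j) if i == a then r 0 j else v i j.

Lemma row_set_row k m a r (v : 'M[R]_(k, m)) : row a (set_row a r v) = r.
Proof. by apply/rowP => j; rewrite !mxE eqxx. Qed.

Lemma row_set_rowN k m a b r (v : 'M[R]_(k, m)) : b != a ->
  row b (set_row a r v) = row b v.
Proof. by move=> /negPf ba; apply/rowP => j; rewrite !mxE ba. Qed.

Lemma row'_set_row k m a r (v : 'M[R]_(k, m)) : row' a (set_row a r v) = row' a v.
Proof. by apply/matrixP => i j; rewrite !mxE eq_sym (negPf (neq_lift _ _)). Qed.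

Lemma set_row_id k m a (v : 'M[R]_(k, m)) : set_row a (row a v) v = v.
Proof. by apply/matrixP => i j; rewrite !mxE; case: eqP => // ->. Qed.

Lemma set_rowC k m a b r s (v : 'M[R]_(k, m)) : a != b ->
  set_row a r (set_row b s v) = set_row b s (set_row a r v).
Proof.
move=> ab; apply/matrixP => i j; rewrite !mxE.
by case: (i =P a) => // ->; rewrite (negPf ab).
Qed.

Section Expansion.
Context {k m : nat} (f : 'M[R]_(k, m) -> R).
Hypothesis fM : multilinear f.

Lemma multilinear_row a v b c (r s : 'rV[R]_m) :
  f (set_row a (b *: r + c *: s) v) = b * f (set_row a r v) + c * f (set_row a s v).
Proof. by apply: (fM (a := a)); rewrite ?row_set_row ?row'_set_row. Qed.

Lemma multilinear_row0 a v : f (set_row a 0 v) = 0.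
Proof.
have := multilinear_row a v 0 0 0 0.
by rewrite !scale0r addr0 !mul0r addr0.
Qed.

Lemma multilinear_row_sum a v (I : Type) (r : seq I) (c : I -> R)
    (x : I -> 'rV[R]_m) :
  f (set_row a (\sum_(i <- r) c i *: x i) v) =
  \sum_(i <- r) c i * f (set_row a (x i) v).
Proof.
elim: r => [|i r IH]; first by rewrite !big_nil multilinear_row0.
rewrite !big_cons -IH -[X in f (set_row _ (_ + X) _)]scale1r multilinear_row.
by rewrite mul1r.
Qed.

(* The rows are replaced by unit vectors one at a time. *)
Lemma multilinear_eq0 : (forall g : 'I_k -> 'I_m, f (rowsub g 1%:M) = 0) ->
  forall v, f v = 0.
Proof.
move=> f0.
(* The list [s] contains the rows that may still be arbitrary. *)
have H (s : seq 'I_k) v : (forall i, i \notin s ->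
    exists j, row i v = delta_mx 0 j) -> f v = 0.
  elim: s v => [|a s IH] v sP.
    have /boolp.choice[g gP] : forall i, exists j, row i v = delta_mx 0 j.
      by move=> i; apply: sP.
    rewrite (_ : v = rowsub g 1%:M) //; apply/row_matrixP => i.
    rewrite gP; apply/rowP => j; rewrite !mxE eqxx /=.
    by rewrite eq_sym.
  rewrite -(set_row_id a v) (row_sum_delta (row a v)).
  rewrite multilinear_row_sum big1 // => j _; rewrite IH ?mulr0 // => i iS.
  have [->|ia] := eqVneq i a; first by exists j; rewrite row_set_row.
  by rewrite row_set_rowN //; apply: sP; rewrite inE negb_or ia.
by move=> v; apply: (H (enum 'I_k)) => i; rewrite mem_enum.
Qed.

Hypothesis fA : alternating f.

(** Polarisation: expand [f] at a matrix whose rows [a] and [b] both equal [r + s]; the terms with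
    twice the same row vanish. *)
Lemma alternating_swap a b r s v : a != b ->
  f (set_row a s (set_row b r v)) = - f (set_row a r (set_row b s v)).
Proof.
move=> ab; apply/eqP; rewrite -addr_eq0; apply/eqP.
have E x : f (set_row a x (set_row b x v)) = 0.
  apply: (fA (a := a) (b := b)) => //.
  by rewrite row_set_row row_set_rowN 1?eq_sym // row_set_row.
have L x y z : f (set_row a x (set_row b (y + z) v)) =
    f (set_row a x (set_row b y v)) + f (set_row a x (set_row b z v)).
  rewrite !(set_rowC _ _ _ ab) -[y in LHS]scale1r -[z in LHS]scale1r.
  by rewrite multilinear_row !mul1r.
have L' x y z : f (set_row a (y + z) (set_row b x v)) =
    f (set_row a y (set_row b x v)) + f (set_row a z (set_row b x v)).
  by rewrite -[y in LHS]scale1r -[z in LHS]scale1r multilinear_row !mul1r.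
by have := E (r + s); rewrite L !L' !E addr0 add0r addrC.
Qed.

Lemma alternating_perm s v : f (row_perm s v) = (-1) ^+ s * f v.
Proof.
have [ts -> dts] := prod_tpermP s.
elim: ts dts v => [|[a b] ts IH] /= dts v.
  by rewrite big_nil row_perm1 odd_perm1 expr0 mul1r.
move: dts; rewrite /dpair /= => /andP[ab dts].
rewrite big_cons /= row_permM odd_mul_tperm ab signr_addb expr1 mulN1r mulNr.
rewrite -IH //; set w := row_perm _ v.
rewrite (_ : row_perm _ w = set_row a (row b w) (set_row b (row a w) w)).
  by rewrite alternating_swap // !set_row_id.
apply/row_matrixP => i; have [->|ia] := eqVneq i a.
  by rewrite row_set_row; apply/rowP => j; rewrite !mxE tpermL.
rewrite row_set_rowN //; have [->|ib] := eqVneq i b.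
  by rewrite row_set_row; apply/rowP => j; rewrite !mxE tpermR.
by rewrite row_set_rowN //; apply/rowP => j; rewrite !mxE tpermD // eq_sym.
Qed.

End Expansion.

End Multilinear.

Lemma row'P (T : Type) k m (a : 'I_k) (u v : 'M[T]_(k, m)) :
  row' a u = row' a v <-> (forall i j, i != a -> u i j = v i j).
Proof.
split=> [/matrixP uv i j|uv].
  by rewrite eq_sym => /unlift_some[i' -> _]; have := uv i' j; rewrite !mxE.
by apply/matrixP => i j; rewrite !mxE uv // eq_sym neq_lift.
Qed.

(** * Multilinear forms and determinants *)

Section Determinant.
Context {R : realType}.

Lemma multilinear_mulmx k m l (f : 'M[R]_(k, l) -> R) (V : 'M[R]_(m, l)) :
  multilinear f -> multilinear (fun Q => f (Q *m V)).
Proof.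
move=> fM a u v w b c uE vE wE; apply: (fM a).
- by rewrite !row_mul uE mulmxDl -!scalemxAl.
- by rewrite !row'Esub -!mul_rowsub_mx -!row'Esub vE.
- by rewrite !row'Esub -!mul_rowsub_mx -!row'Esub wE.
Qed.

Lemma multilinearD k m (f g : 'M[R]_(k, m) -> R) b c : multilinear f -> multilinear g ->
  multilinear (fun v => b * f v + c * g v).
Proof.
move=> fM gM a u v w x y uE vE wE.
by rewrite (fM _ _ _ _ _ _ uE vE wE) (gM _ _ _ _ _ _ uE vE wE); ring.
Qed.

Context {m : nat}.

Lemma multilinear_sum k (I : Type) (r : seq I) (c : I -> R)
    (f : I -> 'M[R]_(k, m) -> R) :
  (forall i, multilinear (f i)) ->
  multilinear (fun v => \sum_(i <- r) c i * f i v).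
Proof.
move=> fM a u v w x y uE vE wE; rewrite !mulr_sumr -big_split /=.
by apply: eq_bigr => i _; rewrite (fM _ _ _ _ _ _ _ uE vE wE); ring.
Qed.

Lemma multilinear_perm k (f : 'M[R]_(k, m) -> R) (s : 'S_k) :
  multilinear f -> multilinear (fun v => f (row_perm s v)).
Proof.
move=> fM a u v w b c uE vE wE; apply: (fM (s^-1 a)%g).
- by apply/rowP => j; move/rowP: uE => /(_ j); rewrite !mxE permKV.
- move/row'P: vE => vE; apply/row'P => i j ia; rewrite !mxE vE //.
  by apply: contra ia => /eqP <-; rewrite permK.
- move/row'P: wE => wE; apply/row'P => i j ia; rewrite !mxE wE //.
  by apply: contra ia => /eqP <-; rewrite permK.
Qed.

Lemma multilinear_prod k l (f : 'M[R]_(k, m) -> R) (g : 'M[R]_(l, m) -> R) :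
  multilinear f -> multilinear g ->
  multilinear (fun v : 'M[R]_(k + l, m) => f (usubmx v) * g (dsubmx v)).
Proof.
move=> fM gM a u v w b c /rowP uE /row'P vE /row'P wE.
case: (split_ordP a) => a' aE; rewrite {a}aE in uE vE wE.
- have -> : dsubmx v = dsubmx u.
    by apply/matrixP => i j; rewrite !mxE vE // eq_rlshift.
  have -> : dsubmx w = dsubmx u.
    by apply/matrixP => i j; rewrite !mxE wE // eq_rlshift.
  rewrite (fM a' (usubmx u) (usubmx v) (usubmx w) b c); first by ring.
  + by apply/rowP => j; have := uE j; rewrite !mxE.
  + by apply/row'P => i j ia; rewrite !mxE vE // eq_lshift.
  + by apply/row'P => i j ia; rewrite !mxE wE // eq_lshift.
- have -> : usubmx v = usubmx u.
    by apply/matrixP => i j; rewrite !mxE vE // eq_lrshift.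
  have -> : usubmx w = usubmx u.
    by apply/matrixP => i j; rewrite !mxE wE // eq_lrshift.
  rewrite (gM a' (dsubmx u) (dsubmx v) (dsubmx w) b c); first by ring.
  + by apply/rowP => j; have := uE j; rewrite !mxE.
  + by apply/row'P => i j ia; rewrite !mxE vE // eq_rshift.
  + by apply/row'P => i j ia; rewrite !mxE wE // eq_rshift.
Qed.

(** The difference of the two sides is multilinear in [Q], so it is enough to take unit vectors as
    rows of [Q]. Then [Q] is a permutation matrix, or has two equal rows and both sides vanish. *)
Lemma multilinear_alternating_det k (f : 'M[R]_(k, m) -> R) (Q : 'M[R]_k) V :
  multilinear f -> alternating f -> f (Q *m V) = \det Q * f V.
Proof.
move=> fM fA; apply/eqP; rewrite -subr_eq0; apply/eqP.
pose D (Q : 'M[R]_k) := 1 * f (Q *m V) + (- f V) * \det Q.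
suff : D Q = 0 by rewrite /D mul1r mulNr [f V * _]mulrC.
apply: multilinear_eq0 => [|g].
  apply: multilinearD; last by move=> a u v w b c; exact: determinant_multilinear.
  exact: multilinear_mulmx.
rewrite /D mul_rowsub_mx mul1mx.
have [/injectiveP gI|/injectivePn[a [b ab gab]]] := boolP (injectiveb g).
  have gE : g =1 perm gI by move=> i; rewrite permE.
  rewrite !(eq_rowsub _ gE) -row_permEsub -perm_mxEsub det_perm.
  by rewrite alternating_perm // mul1r mulNr [f V * _]mulrC subrr.
rewrite (fA _ a b) // ?(determinant_alternate (i1 := a) (i2 := b)) ?mulr0 ?addr0 //.
  by move=> j; rewrite !mxE gab.
by apply/rowP => j; rewrite !mxE gab.
Qed.

End Determinant.

(** * Wedge products and powers at a point *)

Section Alternation.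
Context {R : realType} {m : nat}.

Definition alternation n (f : 'M[R]_(n, m) -> R) (v : 'M[R]_(n, m)) : R :=
  \sum_(s : 'S_n) (-1) ^+ s * f (row_perm s v).

Lemma signr_perm n (s : 'S_n) : (-1) ^+ s * (-1) ^+ s = 1 :> R.
Proof. by rewrite -signr_addb addbb. Qed.

Lemma alternation_perm n (f : 'M[R]_(n, m) -> R) (t : 'S_n) v :
  alternation f (row_perm t v) = (-1) ^+ t * alternation f v.
Proof.
rewrite /alternation (reindex_inj (mulIg t^-1)%g) mulr_sumr /=.
apply: eq_bigr => s _; rewrite -row_permM mulgKV odd_permM odd_permV.
by rewrite signr_addb mulrCA mulrA.
Qed.

(** Permuting the slots of [f] translates the symmetric group on the other side, again at the cost
    of a sign only. This collapses the redundant inner sums of iterated wedges and of the Leibniz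
    rule. *)
Lemma alternation_comp_perm n (f : 'M[R]_(n, m) -> R) (t : 'S_n) v :
  alternation (fun u => f (row_perm t u)) v = (-1) ^+ t * alternation f v.
Proof.
rewrite /alternation (reindex_inj (mulgI t^-1)%g) mulr_sumr /=.
apply: eq_bigr => s _; rewrite -row_permM mulKVg odd_permM odd_permV.
by rewrite signr_addb mulrA.
Qed.

Lemma alternation_alternating n (f : 'M[R]_(n, m) -> R) : alternating (alternation f).
Proof.
move=> v a b ab vab; have : row_perm (tperm a b) v = v.
  apply/row_matrixP => i; apply/rowP => j; rewrite !mxE; move/rowP: vab => /(_ j).
  by rewrite !mxE; case: tpermP => [->|->|].
move=> /(congr1 (alternation f)); rewrite alternation_perm odd_tperm ab expr1.
by rewrite mulN1r => H; lra.
Qed.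

Lemma alternation_sum n (I : Type) (r : seq I) (c : I -> R)
    (f : I -> 'M[R]_(n, m) -> R) v :
  alternation (fun u => \sum_(i <- r) c i * f i u) v =
  \sum_(i <- r) c i * alternation (f i) v.
Proof.
rewrite /alternation; under eq_bigr do rewrite mulr_sumr.
rewrite exchange_big; apply: eq_bigr => i _; rewrite mulr_sumr.
by apply: eq_bigr => s _; rewrite mulrCA.
Qed.

(** Convertible with [wedge] at a point of a chart, so that the algebra can be done with no manifold
    in sight. *)
Definition wedge_at k l (f : 'M[R]_(k, m) -> R) (g : 'M[R]_(l, m) -> R)
    (v : 'M[R]_(k + l, m)) : R :=
  (k`!%:R * l`!%:R)^-1 * alternation (fun u => f (usubmx u) * g (dsubmx u)) v.

Lemma wedge_at_multilinear k l (f : 'M[R]_(k, m) -> R) (g : 'M[R]_(l, m) -> R) :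
  multilinear f -> multilinear g -> multilinear (wedge_at f g).
Proof.
move=> fM gM a u v w b c uE vE wE; rewrite /wedge_at.
rewrite ((_ : multilinear (alternation _)) a u v w b c) //; first by ring.
apply: multilinear_sum => s.
exact: (multilinear_perm _ (multilinear_prod fM gM)).
Qed.

Lemma wedge_at_alternating k l (f : 'M[R]_(k, m) -> R) (g : 'M[R]_(l, m) -> R) :
  alternating (wedge_at f g).
Proof.
by move=> v a b ab vab; rewrite /wedge_at (alternation_alternating _ ab) ?mulr0.
Qed.

Fixpoint wedge_pow_at (w : 'M[R]_(2, m) -> R) n : 'M[R]_(n * 2, m) -> R :=
  match n return 'M[R]_(n * 2, m) -> R with
  | 0 => fun _ => 1
  | n'.+1 => wedge_at w (@wedge_pow_at w n')
  end.

Lemma wedge_pow_at_alternating w n : alternating (@wedge_pow_at w n).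
Proof.
case: n => [|n]; first by move=> v []. 
exact: wedge_at_alternating.
Qed.

Lemma wedge_pow_at_multilinear w n : multilinear w -> multilinear (@wedge_pow_at w n).
Proof.
move=> wM; elim: n => [|n IH]; first by move=> [].
exact: wedge_at_multilinear.
Qed.

End Alternation.

(** * Powers of a 2-form as signed sums over pairings *)

Section PairProduct.
Context {R : realType} {m : nat}.
Implicit Types (w : 'M[R]_(2, m) -> R) (n : nat).

(** A term of the Pfaffian: consecutive rows are paired. Its alternation is 2^n n! times the
    Pfaffian of the values of [w] on the rows. *)
Fixpoint pair_prod w n : 'M[R]_(n * 2, m) -> R :=
  match n return 'M[R]_(n * 2, m) -> R with
  | 0 => fun _ => 1
  | n'.+1 => fun v : 'M[R]_(2 + n' * 2, m) =>
      w (usubmx v) * pair_prod w (dsubmx v)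
  end.

(** This is 2^-n, left in the form in which the induction of [wedge_pow_atE] produces it. *)
Fixpoint wedge_pow_cst n : R :=
  if n is n'.+1 then
    (2`!%:R * (n' * 2)`!%:R)^-1 * (wedge_pow_cst n' * (n' * 2)`!%:R)
  else 1.

Lemma wedge_pow_cst_gt0 n : 0 < wedge_pow_cst n.
Proof.
elim: n => //= n IH; rewrite !mulr_gt0 ?invr_gt0 ?mulr_gt0 ?ltr0n ?fact_gt0 //.
Qed.

(** The alternation hidden in the smaller power is absorbed by the outer one: [emb t] extends [t] by
    the identity on the first two rows and has the same sign, so the [(n * 2)]! inner permutations
    all contribute equally. *)
Lemma wedge_pow_atE w n v :
  wedge_pow_at w v = wedge_pow_cst n * alternation (pair_prod w (n := n)) v.
Proof.
elim: n v => [|n IH] v.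
  rewrite /alternation (big_pred1 1%g) /= ?odd_perm1 ?expr0 ?mulr1 //.
  by move=> s; apply/esym/eqP/permP => -[].
rewrite [LHS]/= /wedge_at /= -[RHS]mulrA; congr (_ * _).
pose F (u : 'M[R]_(2 + n * 2, m)) := w (usubmx u) * pair_prod w (dsubmx u).
pose emb (t : 'S_(n * 2)) : 'S_(2 + n * 2) :=
  lift_perm ord0 ord0 (lift_perm ord0 ord0 t).
have E (u : 'M[R]_(2 + n * 2, m)) : w (usubmx u) * wedge_pow_at w (dsubmx u) =
    \sum_(t : 'S_(n * 2)) (wedge_pow_cst n * (-1) ^+ t) * F (row_perm (emb t) u).
  rewrite IH /alternation !mulr_sumr; apply: eq_bigr => t _; rewrite /F.
  have embr (i : 'I_(n * 2)) : emb t (rshift 2 i) = rshift 2 (t i).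
    have -> : rshift 2 i = lift ord0 (lift ord0 i) by apply: val_inj.
    by rewrite !lift_perm_lift; apply: val_inj.
  have embl (i : 'I_2) : emb t (lshift (n * 2) i) = lshift _ i.
    case: (unliftP ord0 i) => [i' ->|->]; last first.
      have -> : lshift (n * 2) (ord0 : 'I_2) = (ord0 : 'I_(n * 2).+2) by apply: val_inj.
      exact: lift_perm_id.
    have -> : lshift (n * 2) (lift ord0 i' : 'I_2) =
        (lift ord0 (ord0 : 'I_(n * 2).+1) : 'I_(n * 2).+2).
      by apply: val_inj; rewrite /= ord1.
    by rewrite lift_perm_lift lift_perm_id.
  have -> : usubmx (row_perm (emb t) u) = usubmx u.
    by apply/matrixP => i j; rewrite !mxE embl.
  have -> : dsubmx (row_perm (emb t) u) = row_perm t (dsubmx u).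
    by apply/matrixP => i j; rewrite !mxE embr.
  by rewrite mulrCA -[RHS]mulrA; congr (_ * _); exact: mulrCA.
rewrite (_ : (fun u => _) = fun u => \sum_(t : 'S_(n * 2))
   (wedge_pow_cst n * (-1) ^+ t) * F (row_perm (emb t) u)); last exact/funext.
rewrite alternation_sum.
under eq_bigr => t _.
  rewrite alternation_comp_perm !odd_lift_perm /= mulrA -[X in X * _]mulrA.
  rewrite signr_perm mulr1; over.
by rewrite sumr_const card_Sn -[LHS]mulr_natr mulrAC.
Qed.

Lemma even_ord_subproof n (k : 'I_n) : (k * 2 < n * 2)%N.
Proof. by rewrite ltn_mul2r ltn_ord. Qed.

Lemma odd_ord_subproof n (k : 'I_n) : ((k * 2).+1 < n * 2)%N.
Proof.
by apply: leq_trans (_ : (k.+1 * 2 <= n * 2)%N); rewrite ?leq_mul2r ?ltn_ord // mulSn.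
Qed.

Definition even_ord n (k : 'I_n) : 'I_(n * 2) := Ordinal (even_ord_subproof k).
Definition odd_ord n (k : 'I_n) : 'I_(n * 2) := Ordinal (odd_ord_subproof k).

Lemma even_ord_inj n : injective (@even_ord n).
Proof.
move=> i j /(congr1 val) /eqP /=.
by rewrite eqn_mul2r => /eqP /val_inj.
Qed.

Lemma odd_ord_inj n : injective (@odd_ord n).
Proof.
move=> i j /(congr1 val) /eqP /=.
by rewrite eqSS eqn_mul2r => /eqP /val_inj.
Qed.

Lemma even_odd_neq n (k l : 'I_n) : even_ord k != odd_ord l.
Proof. by apply/eqP => -[] /(congr1 odd); rewrite oddS !muln2 !odd_double. Qed.

Lemma half_ord_subproof n (i : 'I_(n * 2)) : (i./2 < n)%N.
Proof. by rewrite ltn_half_double -muln2. Qed.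

Definition half_ord n (i : 'I_(n * 2)) : 'I_n := Ordinal (half_ord_subproof i).

Lemma half_even_ord n (k : 'I_n) : half_ord (even_ord k) = k.
Proof. by apply: val_inj; rewrite /= muln2 doubleK. Qed.

Lemma half_odd_ord n (k : 'I_n) : half_ord (odd_ord k) = k.
Proof. by apply: val_inj; rewrite /= muln2 uphalf_double. Qed.

Lemma odd_even_ord n (k : 'I_n) : odd (even_ord k) = false.
Proof. by rewrite /= muln2 odd_double. Qed.

Lemma odd_odd_ord n (k : 'I_n) : odd (odd_ord k).
Proof. by rewrite /= muln2 odd_double. Qed.

Lemma half_ordK n (i : 'I_(n * 2)) :
  i = if odd i then odd_ord (half_ord i) else even_ord (half_ord i).
Proof.
have := odd_double_half i; rewrite -muln2.
by case: odd => h; apply: val_inj; exact: esym h.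
Qed.

Lemma pair_prodE w n (v : 'M[R]_(n * 2, m)) : pair_prod w v =
  \prod_k w (col_mx (row (even_ord k) v) (row (odd_ord k) v)).
Proof.
elim: n v => [|n IH] v; first by rewrite big_ord0.
rewrite big_ord_recl /= IH; congr (w _ * _).
  apply/row_matrixP => i; apply/rowP => j; rewrite !mxE.
  by case: split_ordP => k ->; rewrite !mxE !ord1; congr (v _ _); apply: val_inj.
apply: eq_bigr => k _; apply: (congr2 (fun a b : 'rV[R]_m => w (col_mx a b)));
  apply/rowP => j; rewrite !mxE; by congr (v _ _); apply: val_inj.
Qed.

End PairProduct.

(** * Signs of perfect matchings *)

Section MatchingSum.
Context {R : realType}.

Definition standard_symplectic n : 'M[R]_(n + n) := block_mx 0 1%:M (- 1%:M) 0.

(** Subtracting the first block row from the second, then adding the second block column to the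
    first, leaves a block triangular matrix. *)
Lemma det_circulant_block n (X Y : 'M[R]_n) :
  \det (block_mx X Y Y X) = \det (X + Y) * \det (X - Y).
Proof.
have -> : \det (block_mx X Y Y X) =
    \det (block_mx 1%:M 0 (- 1%:M) 1%:M *m block_mx X Y Y X *m
          block_mx 1%:M 0 1%:M (1%:M : 'M[R]_n)).
  by rewrite !det_mulmx !det_lblock !det1 !mul1r !mulr1.
rewrite !mulmx_block !mul1mx !mul0mx !mulmx1 !mulmx0 !mulNmx !mul1mx !add0r !addr0.
rewrite (_ : - X + Y + (- Y + X) = 0) ?det_ublock; last by rewrite addrA addrK addNr.
by rewrite [X in _ * \det X]addrC.
Qed.

(* The permutations with a nonzero term commute with the exchange of the two
   halves, so that their matrix has the form [[X, Y], [Y, X]] with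
   X - Y = diag(eps) (X + Y), where the eps_k are the factors of the product. *)
Lemma standard_matching_term_ge0 n (s : 'S_(n + n)) :
  0 <= (-1) ^+ s *
    \prod_(k < n) standard_symplectic n (s (lshift n k)) (s (rshift n k)) :> R.
Proof.
pose J := standard_symplectic n.
pose eps k := J (s (lshift n k)) (s (rshift n k)).
have [/existsP[k /eqP k0]|] := boolP [exists k, eps k == 0].
  by rewrite (bigD1 k) //= [standard_symplectic _ _ _]k0 mul0r mulr0.
rewrite negb_exists => /forallP eps0.
pose X : 'M[R]_n := \matrix_(k, j) (s (lshift n k) == lshift n j)%:R.
pose Y : 'M[R]_n := \matrix_(k, j) (s (lshift n k) == rshift n j)%:R.
(* A nonzero factor means that [s] sends the pair of index [k] to a pair, in the same order or in
   the reverse one; the value of [eps k] records which. *)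
have sP k : exists a, (s (lshift n k) = lshift n a /\ s (rshift n k) = rshift n a
      /\ eps k = 1) \/ (s (lshift n k) = rshift n a /\ s (rshift n k) = lshift n a
      /\ eps k = -1).
  have := eps0 k; rewrite /eps /J /standard_symplectic.
  case: (split_ordP (s (lshift n k))) => a ->;
  case: (split_ordP (s (rshift n k))) => b ->;
  rewrite ?block_mxEul ?block_mxEur ?block_mxEdl ?block_mxEdr !mxE ?eqxx //.
  - by case: (a =P b) => [->|]; rewrite ?eqxx // => _; exists b; left.
  - by case: (a =P b) => [->|]; rewrite ?oppr0 ?eqxx // => _; exists b; right.
have sM : perm_mx s = block_mx X Y Y X.
  apply/matrixP => i j; rewrite perm_mxEsub [LHS]mxE [LHS]mxE.
  case: (split_ordP i) => k ->; case: (split_ordP j) => l ->;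
    rewrite ?block_mxEul ?block_mxEur ?block_mxEdl ?block_mxEdr !mxE //;
    have [a [[-> [-> _]]|[-> [-> _]]]] := sP k;
    by rewrite ?eq_lshift ?eq_rshift ?eq_lrshift ?eq_rlshift.
have XY : X - Y = diag_mx (\row_k eps k) *m (X + Y).
  apply/matrixP => k j; rewrite mul_diag_mx !mxE.
  by have [a [[-> [_ ->]]|[-> [_ ->]]]] := sP k;
    rewrite ?eq_lshift ?eq_rshift ?eq_lrshift ?eq_rlshift /=; ring.
rewrite -det_perm sM det_circulant_block XY det_mulmx det_diag.
rewrite (eq_bigr eps) => [|k _]; last by rewrite mxE.
(* The sign of [s] is now [d * (p * d)], and its product with [p] is a square. *)
set p := \prod_k _; set d := \det _.
by rewrite (_ : _ * _ = (p * d) ^+ 2) ?sqr_ge0 //; ring.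
Qed.

(** After relabelling, [J] is the standard symplectic matrix. All terms are then nonnegative and the
    identity contributes 1. *)
Lemma matching_sum_gt0 N n (eN : N = (n + n)%N) (ev od : 'I_n -> 'I_N)
    (J : 'I_N -> 'I_N -> R) :
  injective ev -> injective od -> (forall k l, ev k != od l) ->
  (forall k l, J (ev k) (ev l) = 0) -> (forall k l, J (od k) (od l) = 0) ->
  (forall k l, J (ev k) (od l) = (k == l)%:R) ->
  (forall k l, J (od k) (ev l) = - (k == l)%:R) ->
  0 < \sum_(s : 'S_N) (-1) ^+ s * \prod_(k < n) J (s (ev k)) (s (od k)).
Proof.
subst N => evI odI eo Jee Joo Jeo Joe.
pose c0 (i : 'I_(n + n)) := match fintype.split i with inl k => ev k | inr k => od k end.
have c0I : injective c0.
  move=> i j; rewrite /c0; case: split_ordP => k ->; case: split_ordP => l ->.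
  - by move=> /evI ->.
  - by move=> /eqP; rewrite (negPf (eo _ _)).
  - by move=> /eqP; rewrite eq_sym (negPf (eo _ _)).
  - by move=> /odI ->.
pose c := perm c0I.
have cl k : c (lshift n k) = ev k by rewrite permE /c0 (unsplitK (inl k)).
have cr k : c (rshift n k) = od k by rewrite permE /c0 (unsplitK (inr k)).
have JE i j : J (c i) (c j) = standard_symplectic n i j.
  case: (split_ordP i) => k ->; case: (split_ordP j) => l ->; rewrite !(cl, cr)
    /standard_symplectic ?block_mxEul ?block_mxEur ?block_mxEdl ?block_mxEdr ?mxE //.
(* Conjugation by the relabelling [c], unlike translation, leaves the sign of each term
   unchanged. *)
rewrite (reindex (fun s => c^-1 * s * c)%g) /=; last first.
  exists (fun s => c * s * c^-1)%g => s _; rewrite !mulgA ?mulgV ?mulVg ?mul1g.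
    by rewrite mulgK.
  by rewrite mulgKV.
rewrite (eq_bigr (fun s : 'S_(n + n) => (-1) ^+ s *
  \prod_(k < n) standard_symplectic n (s (lshift n k)) (s (rshift n k)))); last first.
  move=> s _; rewrite !odd_permM odd_permV addbC addbA addbb /=; congr (_ * _).
  by apply: eq_bigr => k _; rewrite !permM -cl -cr !permK JE.
rewrite (bigD1 1%g) //= ltr_wpDr ?sumr_ge0 // => [s _|].
  exact: standard_matching_term_ge0.
rewrite odd_perm1 mul1r prodr_gt0 // => k _.
by rewrite !perm1 /standard_symplectic block_mxEur mxE eqxx ltr01.
Qed.

End MatchingSum.

(** * Symplectic linear algebra *)

Section TwoForms.
Context {R : realType} {m : nat}.
Variable w : 'M[R]_(2, m) -> R.
Hypotheses (wM : multilinear w) (wA : alternating w).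
Implicit Types u v : 'rV[R]_m.

Lemma set_row_col_mx0 u u' v :
  set_row (0 : 'I_2) u (col_mx u' v : 'M[R]_(1 + 1, m)) = col_mx u v.
Proof.
apply/matrixP => i j; rewrite !mxE.
by case: split_ordP => k ->; rewrite !ord1 ?mxE.
Qed.

Lemma set_row_col_mx1 u v v' :
  set_row (1 : 'I_2) v (col_mx u v' : 'M[R]_(1 + 1, m)) = col_mx u v.
Proof.
apply/matrixP => i j; rewrite !mxE.
by case: split_ordP => k ->; rewrite !ord1 ?mxE.
Qed.

Lemma two_form_suml (I : Type) (r : seq I) (c : I -> R) (x : I -> 'rV[R]_m) v :
  w (col_mx (\sum_(i <- r) c i *: x i) v) = \sum_(i <- r) c i * w (col_mx (x i) v).
Proof.
rewrite -(set_row_col_mx0 _ 0) multilinear_row_sum //.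
by apply: eq_bigr => i _; rewrite set_row_col_mx0.
Qed.

Lemma two_form_sumr (I : Type) (r : seq I) (c : I -> R) (x : I -> 'rV[R]_m) u :
  w (col_mx u (\sum_(i <- r) c i *: x i)) = \sum_(i <- r) c i * w (col_mx u (x i)).
Proof.
rewrite -(set_row_col_mx1 _ _ 0) multilinear_row_sum //.
by apply: eq_bigr => i _; rewrite set_row_col_mx1.
Qed.

Lemma two_formDZr a b u v v' : w (col_mx u (a *: v + b *: v')) =
  a * w (col_mx u v) + b * w (col_mx u v').
Proof. by rewrite -(set_row_col_mx1 _ _ 0) multilinear_row // !set_row_col_mx1. Qed.

Lemma two_form_swap u v : w (col_mx v u) = - w (col_mx u v).
Proof.
have := alternating_swap wM wA u v (col_mx 0 0 : 'M[R]_(1 + 1, m))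
  (isT : (0 : 'I_2) != 1).
by rewrite !set_row_col_mx1 !set_row_col_mx0.
Qed.

Lemma two_form_diag u : w (col_mx u u) = 0.
Proof.
have /eqP := two_form_swap u u.
by rewrite -addr_eq0 -mulr2n mulrn_eq0 /= => /eqP.
Qed.

Local Notation unit_row i := (delta_mx 0 i : 'rV[R]_m).

Definition gram : 'M[R]_m := \matrix_(i, j) w (col_mx (unit_row i) (unit_row j)).

Lemma two_form_gram u v : w (col_mx u v) =
  (u *m gram *m v^T) 0 0.
Proof.
rewrite {1}(row_sum_delta u) two_form_suml -mulmxA mxE.
apply: eq_bigr => i _; congr (_ * _); rewrite {1}(row_sum_delta v) two_form_sumr mxE.
by apply: eq_bigr => j _; rewrite !mxE mulrC.
Qed.

Definition nondegenerate := forall u, (forall v, w (col_mx u v) = 0) -> u = 0.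

Definition symplectic_family k (U V : 'I_k -> 'rV[R]_m) :=
  [/\ forall i j, w (col_mx (U i) (U j)) = 0, forall i j, w (col_mx (V i) (V j)) = 0
    & forall i j, w (col_mx (U i) (V j)) = (i == j)%:R].

(** Orthogonality to the [x i] is a system of [k] linear equations in [m > k] unknowns, so its
    kernel is not zero. *)
Lemma exists_orthogonal k (x : 'I_k -> 'rV[R]_m) : (k < m)%N ->
  exists2 u : 'rV[R]_m, u != 0 & forall i, w (col_mx u (x i)) = 0.
Proof.
move=> km.
pose B := gram *m
  (\matrix_i x i)^T.
have kB : kermx B != 0.
  by rewrite -mxrank_eq0 mxrank_ker subn_eq0 -ltnNge (leq_ltn_trans (rank_leq_col _)).
exists (nz_row (kermx B)); first by rewrite nz_row_eq0.
move=> i; have /sub_kermxP := nz_row_sub (kermx B).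
rewrite /B mulmxA => /matrixP /(_ 0 i); rewrite [RHS]mxE => H.
rewrite two_form_gram -[RHS]H mxE [RHS]mxE.
by apply: eq_bigr => j _; rewrite !mxE.
Qed.

(** One step of the symplectic Gram-Schmidt process: a vector [u] orthogonal to the family exists by
    counting dimensions, nondegeneracy provides a partner [v'], which is rescaled and then made
    orthogonal to the family. *)
Lemma symplectic_familyS k (U V : 'I_k -> 'rV[R]_m) : nondegenerate ->
  symplectic_family U V -> (k.+1 * 2 <= m)%N ->
  exists U' V' : 'I_k.+1 -> 'rV[R]_m, symplectic_family U' V'.
Proof.
move=> w0 [UU VV UV] km.
have k2 : (k + k < m)%N by rewrite addnn -muln2; apply: leq_trans km; rewrite mulSn.
pose x (i : 'I_(k + k)) := match fintype.split i with inl i => U i | inr i => V i end.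
have [u u0 ux] := exists_orthogonal x k2.
have uU i : w (col_mx u (U i)) = 0.
  by have := ux (lshift k i); rewrite /x (unsplitK (inl i)).
have uV i : w (col_mx u (V i)) = 0.
  by have := ux (rshift k i); rewrite /x (unsplitK (inr i)).
have [v' uv'] : exists v, w (col_mx u v) != 0.
  apply: contrapT => nv; move/eqP: u0; apply; apply: w0 => v.
  by apply/eqP; apply: contra_notT nv => h; exists v.
have VU i j : w (col_mx (V i) (U j)) = - (i == j)%:R by rewrite two_form_swap UV eq_sym.
pose c := (w (col_mx u v'))^-1.
pose v1 : 'rV[R]_m := c *: v' + 0 *: 0.
(* These coefficients remove from [v1] its component in the span of the family; [u] is orthogonal to
   that span, so the pairing of [u] with [v1] does not change. *)
pose y (i : 'I_(k + k)) := match fintype.split i with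
  inl i => w (col_mx (V i) v1) | inr i => - w (col_mx (U i) v1) end.
pose v : 'rV[R]_m := 1 *: v1 + 1 *: \sum_i y i *: x i.
have wv (z : 'rV[R]_m) : w (col_mx z v) = w (col_mx z v1) +
    (\sum_i w (col_mx (V i) v1) * w (col_mx z (U i)) -
     \sum_i w (col_mx (U i) v1) * w (col_mx z (V i))).
  rewrite /v two_formDZr !mul1r two_form_sumr big_split_ord; congr (_ + (_ + _)).
    by apply: eq_bigr => i _; rewrite /y /x (unsplitK (inl i)).
  rewrite -sumrN; apply: eq_bigr => i _.
  by rewrite /y /x (unsplitK (inr i)) mulNr.
have uv : w (col_mx u v) = 1.
  rewrite wv !big1.
  - by rewrite subr0 addr0 /v1 two_formDZr mul0r addr0 mulVf.
  - by move=> i _; rewrite uV mulr0.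
  - by move=> i _; rewrite uU mulr0.
have Uv j : w (col_mx (U j) v) = 0.
  rewrite wv big1 => [|i _]; last by rewrite UU mulr0.
  rewrite (bigD1 j) //= UV eqxx mulr1 big1 => [|i ij].
    by rewrite addr0 sub0r subrr.
  by rewrite UV eq_sym (negPf ij) mulr0.
have Vv j : w (col_mx (V j) v) = 0.
  rewrite wv [X in _ + (_ - X)]big1 => [|i _]; last by rewrite VV mulr0.
  rewrite (bigD1 j) //= VU eqxx mulrN1 big1 => [|i ij].
    by rewrite addr0 subr0 subrr.
  by rewrite VU eq_sym (negPf ij) oppr0 mulr0.
pose ext (z : 'rV[R]_m) (Z : 'I_k -> 'rV[R]_m) (i : 'I_k.+1) :=
  if unlift ord0 i is Some j then Z j else z.
have ext0 z Z : ext z Z ord0 = z by rewrite /ext unlift_none.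
have extS z Z i : ext z Z (lift ord0 i) = Z i by rewrite /ext liftK.
exists (ext u U), (ext v V); split=> i j;
  case: (unliftP ord0 i) => [i' ->|->]; case: (unliftP ord0 j) => [j' ->|->];
  rewrite ?ext0 ?extS ?two_form_diag //.
- by rewrite two_form_swap uU oppr0.
- by rewrite two_form_swap Vv oppr0.
Qed.

Lemma exists_symplectic_family k : nondegenerate -> (k * 2 <= m)%N ->
  exists U V : 'I_k -> 'rV[R]_m, symplectic_family U V.
Proof.
move=> w0; elim: k => [|k IH] km; first by exists (fun=> 0), (fun=> 0); split=> -[].
have [|U [V UV]] := IH; first by apply: leq_trans km; rewrite leq_mul2r leqnSn.
exact: symplectic_familyS UV km.
Qed.

(** The rows of [E] span, so [V = (V *m E') *m E] for a left inverse [E'] of [E], and [f V] is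
    [\det (V *m E')] times [f E]. *)
Lemma multilinear_eq0_basis k (f : 'M[R]_(k, m) -> R) (E : 'M[R]_(k, m)) :
  multilinear f -> alternating f -> row_full E -> f E = 0 -> forall V, f V = 0.
Proof.
move=> fM fA /row_fullP[E' E'E] fE V; rewrite -[V]mulmx1 -E'E mulmxA.
by rewrite multilinear_alternating_det // fE mulr0.
Qed.

Lemma row_full_cast k (e : k = m) : row_full (rowsub (cast_ord e) (1%:M : 'M[R]_m)).
Proof.
apply/row_fullP; exists (rowsub (cast_ord (esym e)) 1%:M).
rewrite mul_rowsub_mx mul1mx; apply/matrixP => i j.
by rewrite !mxE cast_ordKV.
Qed.

(** If the power vanished on one basis it would vanish on a symplectic basis too, where
    [matching_sum_gt0] makes it positive. *)
Lemma wedge_pow_nondegenerate n : m = (n * 2)%N -> nondegenerate ->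
  forall E : 'M[R]_(n * 2, m), row_full E -> wedge_pow_at w E != 0.
Proof.
move=> mE w0 E Ef; apply/eqP => fE.
have [|U [V [UU VV UV]]] := @exists_symplectic_family n w0; first by rewrite mE.
(* The two halves of the symplectic basis are interleaved, since [pair_prod] pairs consecutive
   rows. *)
pose F (i : 'I_(n * 2)) := if odd i then V (half_ord i) else U (half_ord i).
have Fe k : F (even_ord k) = U k by rewrite /F odd_even_ord half_even_ord.
have Fo k : F (odd_ord k) = V k by rewrite /F odd_odd_ord half_odd_ord.
have := multilinear_eq0_basis (wedge_pow_at_multilinear wM)
  (@wedge_pow_at_alternating _ _ w n) Ef fE (\matrix_i F i).
rewrite wedge_pow_atE /alternation.
under eq_bigr => s _.
  rewrite pair_prodE.
  under eq_bigr => k _.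
    rewrite (_ : row _ _ = F (s (even_ord k))); last by apply/rowP => j; rewrite !mxE.
    rewrite (_ : row _ _ = F (s (odd_ord k))); last by apply/rowP => j; rewrite !mxE.
    over.
  over.
apply/eqP; rewrite mulf_neq0 // ?(gt_eqF (wedge_pow_cst_gt0 _)) //.
rewrite gt_eqF //.
apply: (matching_sum_gt0 _ (J := fun i j => w (col_mx (F i) (F j)))).
- by rewrite addnn muln2.
- exact: even_ord_inj.
- exact: odd_ord_inj.
- exact: even_odd_neq.
- by move=> k l; rewrite !Fe.
- by move=> k l; rewrite !Fo.
- by move=> k l; rewrite Fe Fo.
- by move=> k l; rewrite Fe Fo two_form_swap UV eq_sym.
Qed.

(** A nonzero [u] in the radical of [w] can replace a vector of the standard basis. Each term of the
    power then has a factor containing [u], so the power vanishes on a basis, hence everywhere. *)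
Lemma wedge_pow_degenerate n (V : 'M[R]_(n * 2, m)) : m = (n * 2)%N ->
  wedge_pow_at w V != 0 -> nondegenerate.
Proof.
move=> mE V0 u wu; apply/eqP; move: V0; apply: contraNT => u0; apply/eqP.
pose f := @wedge_pow_at _ _ w n.
have fM : multilinear f := wedge_pow_at_multilinear wM.
have fA : alternating f := @wedge_pow_at_alternating _ _ w n.
have wu' v : w (col_mx v u) = 0 by rewrite two_form_swap wu oppr0.
have f0 (v : 'M[R]_(n * 2, m)) i : row i v = u -> f v = 0.
  move=> vi; rewrite /f wedge_pow_atE /alternation big1 ?mulr0 // => s _.
  rewrite pair_prodE (bigD1 (half_ord (s^-1 i)%g)) //=.
  have := half_ordK (s^-1 i)%g; case: odd => <-.
  - rewrite [row (s^-1 i)%g _](_ : _ = u) ?wu' ?mul0r ?mulr0 //.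
    by rewrite -vi; apply/rowP => j; rewrite !mxE permKV.
  - rewrite [row (s^-1 i)%g _](_ : _ = u) ?wu ?mul0r ?mulr0 //.
    by rewrite -vi; apply/rowP => j; rewrite !mxE permKV.
have [j uj] : exists j, u 0 j != 0.
  apply/existsP; apply: contraNT u0; rewrite negb_exists => /forallP h.
  by apply/eqP/rowP => j; rewrite mxE; apply/eqP; have := h j; rewrite negbK.
pose E : 'M[R]_(n * 2, m) := rowsub (cast_ord (esym mE)) 1%:M.
pose i := cast_ord mE j.
have Ei k : row (cast_ord mE k) E = delta_mx 0 k.
  by apply/rowP => l; rewrite !mxE cast_ordK eqxx /= eq_sym.
apply: (multilinear_eq0_basis (E := E)) => //.
  exact: row_full_cast.
(* When the row [u] is expanded in the basis, all the terms but the [j]-th have a repeated row; what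
   remains is [u 0 j] times the value at [E]. *)
have := f0 (set_row i u E) i (row_set_row _ _ _).
rewrite [in set_row _ _ _](row_sum_delta u) multilinear_row_sum //.
rewrite (bigD1 j) //= big1 ?addr0 => [|k kj].
  rewrite -Ei set_row_id => /eqP; rewrite mulf_eq0 (negPf uj) => /eqP; exact.
rewrite (fA _ (cast_ord mE k) i) ?mulr0 //.
by rewrite row_set_row row_set_rowN ?Ei.
Qed.

(** The power does not vanish on the standard basis, so some permutation [s] has a nonzero term; its
    factors pair the images under [s] of the consecutive indices 2k and 2k+1. *)
Lemma wedge_pow_matching n (V : 'M[R]_(n * 2, m)) : m = (n * 2)%N ->
  wedge_pow_at w V != 0 ->
  exists p q : 'I_n -> 'I_m,
  [/\ injective p, injective q, forall k l, p k != q l,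
      forall i, exists k, i = p k \/ i = q k
    & forall k, w (col_mx (unit_row (p k)) (unit_row (q k))) != 0].
Proof.
move=> mE V0.
pose E : 'M[R]_(n * 2, m) := rowsub (cast_ord (esym mE)) 1%:M.
have Ei k : row k E = delta_mx 0 (cast_ord (esym mE) k).
  by apply/rowP => l; rewrite !mxE eqxx /= eq_sym.
have : wedge_pow_at w E != 0.
  apply: contraNN V0 => /eqP E0; apply/eqP.
  by rewrite (multilinear_eq0_basis (wedge_pow_at_multilinear wM)
    (@wedge_pow_at_alternating _ _ w n) (row_full_cast _) E0).
rewrite wedge_pow_atE => H.
have [s sP] : exists s : 'S_(n * 2), pair_prod w (row_perm s E) != 0.
  apply: contrapT => h; move/eqP: H; apply; rewrite /alternation big1 ?mulr0 // => s _.
  apply/eqP; rewrite mulf_eq0; apply/orP; right.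
  by apply: contra_notT h => h; exists s.
move: sP; rewrite pair_prodE => /prodf_neq0 sP.
exists (fun k => cast_ord (esym mE) (s (even_ord k))),
  (fun k => cast_ord (esym mE) (s (odd_ord k))); split.
- by move=> k l /cast_ord_inj /perm_inj /even_ord_inj.
- by move=> k l /cast_ord_inj /perm_inj /odd_ord_inj.
- move=> k l; apply/eqP => /cast_ord_inj /perm_inj /eqP.
  by rewrite (negPf (even_odd_neq _ _)).
- move=> i; exists (half_ord (s^-1 (cast_ord mE i))%g).
  have := half_ordK (s^-1 (cast_ord mE i))%g.
  by case: odd => <-; [right|left]; rewrite permKV cast_ordK.
- have rs i : row i (row_perm s E) = row (s i) E by apply/rowP => j; rewrite !mxE.
  by move=> k; have := sP k isT; rewrite !rs !Ei.
Qed.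

End TwoForms.

Local Open Scope classical_set_scope.

(** * Smooth functions *)

Section DirectionalDerivatives.
Context {R : realType} {V : normedModType R}.
Implicit Types (f g : V -> R) (x u v : V).

Lemma cvg_is_derive f x v (l : R) :
  (fun h : R => h^-1 *: (f (h *: v + x) - f x)) @ 0^' --> l -> is_derive x v f l.
Proof. by move=> fl; split; [exact: cvgP fl|exact: cvg_lim fl]. Qed.

Lemma is_derive_cvg f x v (l : R) : is_derive x v f l ->
  (fun h : R => h^-1 *: (f (h *: v + x) - f x)) @ 0^' --> l.
Proof. by case=> fv <-; exact: fv. Qed.

End DirectionalDerivatives.

Section Lines.
Context {R : realType} {V : normedModType R}.
Implicit Types (f g : V -> R) (x u v : V).

Lemma is_derive_line f x v (t : R) (l : R) : is_derive (t *: v + x) v f l ->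
  is_derive t 1 (fun s : R => f (s *: v + x)) l.
Proof.
move=> /is_derive_cvg fl; apply: cvg_is_derive.
suff <- : (fun h : R => h^-1 *: (f (h *: v + (t *: v + x)) - f (t *: v + x))) =
  (fun h : R => h^-1 *: (f ((h *: (1 : R) + t) *: v + x) - f (t *: v + x))) by [].
by apply/funext => h; rewrite -[h *: (1 : R)]/(h * 1) mulr1 scalerDl addrA.
Qed.

Lemma is_derive_of_line f x v (l : R) :
  is_derive (0 : R) 1 (fun s : R => f (s *: v + x)) l -> is_derive x v f l.
Proof.
move=> /is_derive_cvg fl; apply: cvg_is_derive.
suff -> : (fun h : R => h^-1 *: (f (h *: v + x) - f x)) = (fun h : R => h^-1 *:
   (f ((h *: (1 : R) + 0) *: v + x) - f ((0 : R) *: v + x))) by [].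
by apply/funext => h; rewrite -[h *: (1 : R)]/(h * 1) mulr1 addr0 scale0r add0r.
Qed.

Lemma is_derive_scale f x v (c l : R) :
  is_derive x v f l -> is_derive x (c *: v) f (c * l).
Proof.
move=> fl; apply: is_derive_of_line.
rewrite (_ : (fun s : R => _) = (fun s : R => f (s *: v + x)) \o ( *%R c)); last first.
  by apply/funext => s /=; rewrite scalerA mulrC.
have cd : is_derive (0 : R) 1 ( *%R c) c.
  rewrite (_ : *%R c = c *: (@id R)) //.
  by apply: is_derive_eq; rewrite scaler1.
rewrite mulrC; apply: is_derive1_comp.
by rewrite mulr0; apply: is_derive_line; rewrite scale0r add0r.
Qed.

(* mean value theorem applied between [h *: u + x] and [h *: v + (h *: u + x)] *)
Lemma is_derive_dirD f g x u v (a : R) :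
  (\forall y \near x, is_derive y v f (g y)) -> {for x, continuous g} ->
  is_derive x u f a -> is_derive x (u + v) f (a + g x).
Proof.
move=> fg gx fa; apply: cvg_is_derive.
suff -> : (fun h : R => h^-1 *: (f (h *: (u + v) + x) - f x)) =
  (fun h : R => h^-1 *: (f (h *: u + x) - f x)) \+
  (fun h : R => h^-1 *: (f (h *: v + (h *: u + x)) - f (h *: u + x))); last first.
  apply/funext => h /=; rewrite -scalerDr; congr (_ *: _).
  rewrite (_ : h *: (u + v) + x = h *: v + (h *: u + x)); first by ring.
  by rewrite scalerDr addrA [h *: u + _]addrC.
apply: cvgD; first exact: is_derive_cvg.
apply/cvgrPdist_le => /= e e0.
have /cvgrPdist_le /(_ e e0) ge := gx.
have /nbhs_ballP[d /= d0 dP] : nbhs x ([set y | is_derive y v f (g y)] `&`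
    [set y | `|g x - g y| <= e]) by exact: filterI.
(* For [|h| < d / K] the whole segment from [h *: u + x] to [h *: v + (h *: u + x)] lies in the ball
   of radius [d]. *)
pose K := `|u| + `|v| + 1.
have K0 : 0 < K by rewrite ltr_wpDl // addr_ge0.
have dK : 0 < d / K by rewrite divr_gt0.
near=> h.
have h0 : h != 0 by near: h; exact: nbhs_dnbhs_neq.
have hd : `|h| < d / K by near: h; apply: dnbhs0_lt.
have inb s : 0 <= s <= 1 -> ball x d (s *: (h *: v) + (h *: u + x)).
  move=> /andP[s0 s1]; rewrite -ball_normE /= addrA opprD addrCA subrr addr0 normrN.
  apply: le_lt_trans (ler_normD _ _) _; rewrite !normrZ (ger0_norm s0).
  apply: (@le_lt_trans _ _ (`|h| * K)); last by rewrite -ltr_pdivlMr.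
  have : s * (`|h| * `|v|) <= `|h| * `|v| by rewrite ler_piMl // mulr_ge0.
  have := normr_ge0 h; rewrite /K; lra.
have [||c cP] := @MVT R (fun s => f (s *: (h *: v) + (h *: u + x)))
    (fun s => h * g (s *: (h *: v) + (h *: u + x))) 0 1 ltr01.
- move=> s; rewrite in_itv /= => /andP[s0 s1].
  apply: is_derive_line; apply: is_derive_scale.
  by have [|] := dP (s *: (h *: v) + (h *: u + x)); first by apply: inb; rewrite !ltW.
- apply: continuous_in_subspaceT => s; rewrite inE /= in_itv /= => s01.
  apply: differentiable_continuous; apply/derivable1_diffP.
  have : is_derive s 1 (fun s => f (s *: (h *: v) + (h *: u + x)))
      (h * g (s *: (h *: v) + (h *: u + x))).
    apply: is_derive_line; apply: is_derive_scale.
    by have [|] := dP (s *: (h *: v) + (h *: u + x)); first exact: inb.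
  by case.
rewrite scale1r scale0r add0r subr0 mulr1 => ->.
rewrite /GRing.scale /= mulKf //.
have [|_ ] := dP (c *: (h *: v) + (h *: u + x)); last by [].
by apply: inb; move: cP; rewrite in_itv /= => /andP[? ?]; rewrite !ltW.
Unshelve. all: end_near. Qed.

End Lines.

(** * Calculus of smooth functions on open sets *)

Section SmoothFunctions.
Context {R : realType} {m : nat}.
Implicit Types (U : set 'rV[R]_m) (f g : 'rV[R]_m -> R) (x u v : 'rV[R]_m).

(** [partials] adds derivatives on the outside, whereas inductions on [f] need the derivative that
    is taken first; [rcons] exposes it. *)
Lemma smooth_onP U f : smooth_on U f <->
  (forall x, U x -> {for x, continuous f} /\ forall i, derivable f x (delta_mx 0 i)) /\
  (forall i, smooth_on U (partial i f)).
Proof.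
split=> [fU|[f0 f1] s x Ux].
  split=> [x Ux|i s x Ux]; first exact: (fU [::]).
  by have := fU (rcons s i) x Ux; rewrite /partials foldr_rcons.
by case: (lastP s) => [|s' i]; [exact: f0|rewrite /partials foldr_rcons; exact: f1].
Qed.

Lemma smooth_on_partial U f i : smooth_on U f -> smooth_on U (partial i f).
Proof. by move=> /smooth_onP[]. Qed.

Lemma smooth_on_continuous U f x : smooth_on U f -> U x -> {for x, continuous f}.
Proof. by move=> fU Ux; have [] := fU [::] x Ux. Qed.

Lemma smooth_on_sub U U' f : U' `<=` U -> smooth_on U f -> smooth_on U' f.
Proof. by move=> UU fU s x /UU; exact: fU. Qed.

Lemma smooth_on_partial_is_derive U f x i : smooth_on U f -> U x ->
  is_derive x (delta_mx 0 i) f (partial i f x).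
Proof. by move=> fU Ux; have [_ fD] := fU [::] x Ux; split. Qed.

Lemma near_open U (P : 'rV[R]_m -> Prop) x : open U -> U x ->
  (forall y, U y -> P y) -> \forall y \near x, P y.
Proof. by move=> Uo Ux UP; apply: filterS UP _; exact: open_nbhs_nbhs. Qed.

(** Continuity of the partial derivatives allows the coordinate directions to be added one at a time
    with [is_derive_dirD]. *)
Lemma smooth_on_is_derive U f x u : open U -> smooth_on U f -> U x ->
  is_derive x u f (\sum_i u 0 i * partial i f x).
Proof.
move=> Uo fU Ux; rewrite [X in is_derive _ X](row_sum_delta u).
elim: (index_enum _) => [|i r IH].
  by rewrite !big_nil; split; [exact: derivable0|exact: derive0].
rewrite !big_cons [X in is_derive _ X]addrC [X in is_derive _ _ _ X]addrC.
apply: (is_derive_dirD (g := fun y => u 0 i * partial i f y)) => //.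
- apply: (near_open Uo Ux) => y Uy; apply: is_derive_scale.
  exact: smooth_on_partial_is_derive Uy.
- apply: continuousM; first exact: cst_continuous.
  exact: smooth_on_continuous (smooth_on_partial _ fU) Ux.
Qed.

Lemma smooth_on_derivable U f x u : open U -> smooth_on U f -> U x -> derivable f x u.
Proof. by move=> Uo fU Ux; have [] := smooth_on_is_derive u Uo fU Ux. Qed.

Lemma smooth_on_derive U f x u : open U -> smooth_on U f -> U x ->
  'D_u f x = \sum_i u 0 i * partial i f x.
Proof. by move=> Uo fU Ux; have [] := smooth_on_is_derive u Uo fU Ux. Qed.

Lemma eq_smooth_on U f g : open U -> (forall x, U x -> f x = g x) ->
  smooth_on U f -> smooth_on U g.
Proof.
move=> Uo fg fU s.
have E x : U x -> partials s f x = partials s g x.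
  elim: s x => [|i s IH] x Ux; first exact: fg.
  by apply: near_eq_derive; apply: (near_open Uo Ux).
move=> x Ux; have [fc fd] := fU s x Ux.
have nE : \forall y \near x, partials s f y = partials s g y.
  by apply: (near_open Uo Ux).
split; last by move=> i; apply: near_eq_derivable (fd i).
have gE : partials s g x = partials s f x by rewrite E.
rewrite /prop_for /continuous_at gE.
by move: fc; apply: cvg_trans; exact: (near_eq_cvg (F := nbhs x)).
Qed.

(** A criterion by guessing: [h s] is a candidate for the iterated derivative along [s], and only
    one differentiation at a time has to be checked. *)
Lemma smooth_on_partialsE U f (h : seq 'I_m -> 'rV[R]_m -> R) : open U ->
  (forall x, U x -> h [::] x = f x) ->
  (forall s x, U x -> {for x, continuous (h s)} /\
     forall i, is_derive x (delta_mx 0 i) (h s) (h (i :: s) x)) ->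
  smooth_on U f.
Proof.
move=> Uo h0 hS; apply: (eq_smooth_on Uo h0) => s.
have E x : U x -> partials s (h [::]) x = h s x.
  elim: s x => [//|i s IH] x Ux /=.
  rewrite /partial (near_eq_derive (g := h s)); last exact: (near_open Uo Ux).
  by have [_ /(_ i)[]] := hS s x Ux.
move=> x Ux; have [hc hd] := hS s x Ux.
have nE : \forall y \near x, h s y = partials s (h [::]) y.
  by apply: (near_open Uo Ux) => y Uy; rewrite E.
split=> [|i]; last by apply: (near_eq_derivable nE); have [] := hd i.
rewrite /prop_for /continuous_at E //.
by move: hc; apply: cvg_trans; exact: (near_eq_cvg (F := nbhs x)).
Qed.

Lemma smooth_on_cst U (c : R) : open U -> smooth_on U (fun=> c).
Proof.
move=> Uo; apply: (@smooth_on_partialsE U (fun=> c)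
  (fun (s : seq 'I_m) (_ : 'rV[R]_m) => if s is [::] then c else 0)) => //.
move=> s x _; split; first exact: cst_continuous.
by move=> i; case: s => [|? ?]; exact: is_derive_cst.
Qed.

Lemma smooth_on_lin U f g (a b : R) : open U -> smooth_on U f -> smooth_on U g ->
  smooth_on U (fun x => a * f x + b * g x).
Proof.
move=> Uo fU gU.
apply: (@smooth_on_partialsE U (fun x => a * f x + b * g x)
  (fun s x => a * partials s f x + b * partials s g x)) => //.
move=> s x Ux; have [fc fd] := fU s x Ux; have [gc gd] := gU s x Ux; split.
  by apply: continuousD; apply: continuousM => //; exact: cst_continuous.
move=> i.
have fi : is_derive x (delta_mx 0 i) (partials s f) (partials (i :: s) f x) by split.
have gi : is_derive x (delta_mx 0 i) (partials s g) (partials (i :: s) g x) by split.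
rewrite (_ : (fun x => _) = a *: partials s f + b *: partials s g); last exact/funext.
exact: is_deriveD.
Qed.

Lemma smooth_onZ U f (a : R) : open U -> smooth_on U f -> smooth_on U (fun x => a * f x).
Proof.
move=> Uo fU; apply: eq_smooth_on (smooth_on_lin a 0 Uo fU fU) => // x _.
by rewrite mul0r addr0.
Qed.

Lemma smooth_on_sum U (I : Type) (r : seq I) (f : I -> 'rV[R]_m -> R) : open U ->
  (forall i, smooth_on U (f i)) -> smooth_on U (fun x => \sum_(i <- r) f i x).
Proof.
move=> Uo fU; elim: r => [|i r IH].
  by apply: eq_smooth_on (smooth_on_cst 0 Uo) => // x _; rewrite big_nil.
apply: eq_smooth_on (smooth_on_lin 1 1 Uo (fU i) IH) => // x _.
by rewrite big_cons !mul1r.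
Qed.

(** Finite orders make the product rule inductive: a derivative of a product is a sum of products of
    functions that are still differentiable to the previous order. *)
Fixpoint derivable_upto n U f : Prop :=
  (forall x, U x -> {for x, continuous f} /\ forall i, derivable f x (delta_mx 0 i)) /\
  if n is n'.+1 then forall i, derivable_upto n' U (partial i f) else True.

Lemma smooth_on_upto U f : (forall n, derivable_upto n U f) <-> smooth_on U f.
Proof.
split=> [H s|fU n].
  suff K : forall n f, derivable_upto n U f -> (size s <= n)%N -> forall x, U x ->
      {for x, continuous (partials s f)} /\
      forall i, derivable (partials s f) x (delta_mx 0 i).
    by apply: (K (size s)).
  elim/last_ind: s => [|s i IH] [|n] h; rewrite ?size_rcons //=.
  - by case.
  - by case.
  - by case=> _ hi sn; rewrite /partials foldr_rcons; apply: (IH n).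
elim: n f fU => [|n IH] f /smooth_onP[f0 f1]; first by split.
by split=> // i; apply: IH.
Qed.

Lemma eq_derivable_upto n U f g : open U -> (forall x, U x -> f x = g x) ->
  derivable_upto n U f -> derivable_upto n U g.
Proof.
move=> Uo; elim: n f g => [|n IH] f g fg [f0 f1]; split.
1,3: move=> x Ux; have [fc fd] := f0 x Ux.
1,2: have nE : \forall y \near x, f y = g y by apply: (near_open Uo Ux).
1,2: split; last by move=> i; apply: near_eq_derivable (fd i).
1,2: rewrite /prop_for /continuous_at -fg //; move: fc; apply: cvg_trans.
1,2: exact: (near_eq_cvg (F := nbhs x)).
- by [].
- move=> i; apply: IH (f1 i) => x Ux; apply: near_eq_derive.
  exact: (near_open Uo Ux).
Qed.

Lemma derivable_uptoS n U f : derivable_upto n.+1 U f -> derivable_upto n U f.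
Proof. by elim: n f => [|n IH] f [f0 f1]; split=> // i; apply: IH. Qed.

Lemma derivable_uptoD n U f g : open U -> derivable_upto n U f -> derivable_upto n U g ->
  derivable_upto n U (f \+ g).
Proof.
move=> Uo; elim: n f g => [|n IH] f g [f0 f1] [g0 g1]; split.
1,3: move=> x Ux; have [fc fd] := f0 x Ux; have [gc gd] := g0 x Ux.
1,2: by split=> [|i]; [exact: continuousD|exact: derivableD].
- by [].
- move=> i; apply: eq_derivable_upto (IH _ _ (f1 i) (g1 i)) => // x Ux.
  have [_ fd] := f0 x Ux; have [_ gd] := g0 x Ux.
  by rewrite /partial deriveD.
Qed.

Lemma derivable_uptoM n U f g : open U -> derivable_upto n U f -> derivable_upto n U g ->
  derivable_upto n U (f \* g).
Proof.
move=> Uo; elim: n f g => [|n IH] f g fn gn; have [f0 f1] := fn; have [g0 g1] := gn; split.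
1,3: move=> x Ux; have [fc fd] := f0 x Ux; have [gc gd] := g0 x Ux.
1,2: by split=> [|i]; [exact: continuousM|exact: derivableM].
- by [].
- move=> i; apply: (@eq_derivable_upto _ _ ((f \* partial i g) \+ (g \* partial i f))) => //.
    move=> x Ux; have [_ fd] := f0 x Ux; have [_ gd] := g0 x Ux.
    exact/esym/(deriveM (fd i) (gd i)).
  apply: derivable_uptoD => //; first exact: (IH _ _ (derivable_uptoS fn) (g1 i)).
  exact: (IH _ _ (derivable_uptoS gn) (f1 i)).
Qed.

Lemma smooth_onM U f g : open U -> smooth_on U f -> smooth_on U g ->
  smooth_on U (fun x => f x * g x).
Proof.
move=> Uo /smooth_on_upto fU /smooth_on_upto gU; apply/smooth_on_upto => n.
exact: derivable_uptoM.
Qed.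

Lemma derive_eq0_cst f : (forall x u, is_derive x u f 0) -> forall x, f x = f 0.
Proof.
move=> f0 x.
have fl (s : R) : is_derive s 1 (fun s : R => f (s *: x + 0)) 0 by exact: is_derive_line.
have := is_derive_0_is_cst 1 0 fl.
by rewrite scale1r scale0r !addr0.
Qed.

End SmoothFunctions.

(** * Integrals along segments *)

Section IntegralOverHalfPeriod.
Context {R : realType}.
Implicit Types f g : R -> R.
Local Notation mu := (@lebesgue_measure R).

(** Half a period: the segment from -pi to pi is covered by two such integrals in opposite
    directions, which a reflection exchanges. *)
Definition int0pi f : R := \int[mu]_(s in `[0, pi]) f s.

Lemma continuous_integrable0pi f : continuous f -> mu.-integrable `[0, pi] (EFin \o f).
Proof.
move=> fc; apply: continuous_compact_integrable; first exact: segment_compact.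
exact: continuous_subspaceT.
Qed.

Lemma continuous_lin (a b : R) f g : continuous f -> continuous g ->
  continuous (fun s => a * f s + b * g s).
Proof.
move=> fc gc s; apply: (@cvgD _ R^o); apply: (@cvgM R); try exact: cvg_cst.
  exact: fc.
exact: gc.
Qed.

Lemma int0pi_lin (a b : R) f g : continuous f -> continuous g ->
  int0pi (fun s => a * f s + b * g s) = a * int0pi f + b * int0pi g.
Proof.
move=> fc gc.
have K (c : R) (h : R -> R) : continuous h -> continuous (fun s => c * h s).
  by move=> hc s; apply: (@cvgM R); [exact: cvg_cst|exact: hc].
rewrite /int0pi RintegralD ?RintegralZl //; do ?exact: continuous_integrable0pi.
- by apply: continuous_integrable0pi; exact: K.
- by apply: continuous_integrable0pi; exact: K.
Qed.

Lemma int0pi_cst (c : R) : int0pi (fun=> c) = c * pi.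
Proof.
rewrite /int0pi Rintegral_cst //= lebesgue_measure_itv /= lte_fin pi_gt0 /=.
by rewrite subr0.
Qed.

Lemma le_int0pi f g : continuous f -> continuous g ->
  (forall s, 0 <= s <= pi -> f s <= g s) -> int0pi f <= int0pi g.
Proof.
by move=> fc gc fg; apply: le_Rintegral => //; do ?exact: continuous_integrable0pi.
Qed.

Lemma int0pi_gt0 f : continuous f -> (forall s, 0 < f s) -> 0 < int0pi f.
Proof.
move=> fc f0; have [c _ cP] := EVT_min (ltW (pi_gt0 R)) (continuous_subspaceT fc).
apply: (@lt_le_trans _ _ (f c * pi)); first by rewrite mulr_gt0 // pi_gt0.
by rewrite -int0pi_cst; apply: le_int0pi => //; exact: cst_continuous.
Qed.

(** Uniform convergence on the segment is all that continuity and differentiation under the integral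
    sign will require. *)
Lemma int0pi_cvg (T : Type) (F : set_system T) (FF : ProperFilter F)
    (f : T -> R -> R) g :
  (\forall h \near F, continuous (f h)) -> continuous g ->
  (forall e, 0 < e -> \forall h \near F, forall s, 0 <= s <= pi -> `|g s - f h s| <= e) ->
  int0pi (f h) @[h --> F] --> int0pi g.
Proof.
move=> fc gc fg; apply/cvgrPdist_le => /= e e0.
have e1 : 0 < e / pi by rewrite divr_gt0 // pi_gt0.
near=> h.
have fhc : continuous (f h) by near: h.
have H : forall s, 0 <= s <= pi -> `|g s - f h s| <= e / pi by near: h; exact: fg.
have gfc : continuous (fun s => 1 * g s + (-1) * f h s).
  exact: continuous_lin.
have -> : int0pi g - int0pi (f h) = int0pi (fun s => 1 * g s + (-1) * f h s).
  by rewrite int0pi_lin // mul1r mulN1r.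
have eE : e = e / pi * pi by rewrite divfK // gt_eqF // pi_gt0.
rewrite ler_norml; apply/andP; split.
- rewrite [e in leLHS]eE -mulNr -int0pi_cst; apply: le_int0pi => //.
    exact: cst_continuous.
  by move=> s /H; rewrite ler_norml mul1r mulN1r => /andP[].
- rewrite [leRHS]eE -int0pi_cst; apply: le_int0pi => //.
    exact: cst_continuous.
  by move=> s /H; rewrite ler_norml mul1r mulN1r => /andP[].
Unshelve. all: end_near. Qed.

Lemma int0pi_FTC f g : (forall s : R, is_derive s 1 f (g s)) -> continuous g ->
  int0pi g = f pi - f 0.
Proof.
move=> fg gc.
have fc : continuous f.
  move=> s; apply: differentiable_continuous; apply/derivable1_diffP.
  by have [] := fg s.
rewrite /int0pi /Rintegral (continuous_FTC2 (pi_gt0 R) (continuous_subspaceT gc) (F := f)) //.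
- split.
  + by move=> s _; have [] := fg s.
  + by apply: cvg_at_right_filter; exact: fc.
  + by apply: cvg_at_left_filter; exact: fc.
- by move=> s _; rewrite derive1E; have [_ ->] := fg s.
Qed.

End IntegralOverHalfPeriod.

(** * Functions integrated along coordinate segments *)

Section IntegralAlong.
Context {R : realType} {m : nat}.
Implicit Types (f g : 'rV[R]_m -> R) (x u v : 'rV[R]_m) (phi : R -> R).

Definition int_along phi v f x : R := int0pi (fun s => phi s * f (s *: v + x)).

Lemma continuous_line f v x : continuous f -> continuous (fun s : R => f (s *: v + x)).
Proof.
move=> fc s; apply: (@continuous_comp _ _ _ (fun s : R => s *: v + x)); last exact: fc.
by apply: continuousD; [exact: scalel_continuous|exact: cst_continuous].
Qed.

Lemma continuous_along phi v f x : continuous phi -> continuous f ->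
  continuous (fun s : R => phi s * f (s *: v + x) : R).
Proof.
by move=> pc fc s; apply: continuousM; [exact: pc|exact: continuous_line].
Qed.

Lemma int_along_lin phi v (a b : R) f g x :
  continuous phi -> continuous f -> continuous g ->
  int_along phi v (fun y => a * f y + b * g y) x =
  a * int_along phi v f x + b * int_along phi v g x.
Proof.
move=> pc fc gc; rewrite /int_along -int0pi_lin; try exact: continuous_along.
by congr int0pi; apply/funext => s; ring.
Qed.

Lemma bounded0pi phi : continuous phi ->
  exists2 K, 0 < K & forall s, 0 <= s <= pi -> `|phi s| <= K.
Proof.
move=> pc; have nc : continuous (fun s => `|phi s|).
  by move=> s; apply: continuous_comp; [exact: pc|exact: norm_continuous].
have [c _ cP] := EVT_max (ltW (pi_gt0 R)) (continuous_subspaceT nc).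
exists (`|phi c| + 1); first by rewrite ltr_wpDl.
by move=> s s0; apply: ler_wpDr => //; apply: cP; rewrite in_itv.
Qed.

(** Compactness of the segment makes the neighbourhood of [x] independent of [s]. *)
Lemma near_along f v x : continuous f -> forall e : R, 0 < e ->
  \forall y \near x, forall s, 0 <= s <= pi -> `|f (s *: v + x) - f (s *: v + y)| <= e.
Proof.
move=> fc e e0.
have /compact_near_coveringP C := @segment_compact R 0 pi.
have K := C _ (nbhs x) (fun y s => `|f (s *: v + x) - f (s *: v + y)| <= e) _.
apply: filterS (K _ _) => [y {}K s s0|s _]; first by apply: K; rewrite /= in_itv.
have e2 : 0 < e / 2 by rewrite divr_gt0.
have /cvgrPdist_le /(_ _ e2) H := fc (s *: v + x).
(* Both terms have a moving parameter; each is compared with the value at the fixed point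
   [s *: v + x], at a cost of [e / 2]. *)
have c1 : (fun p : R * 'rV[R]_m => p.1 *: v + x) @ (s, x) --> s *: v + x.
  apply: cvgD; last exact: cvg_cst.
  by apply: cvgZr_tmp; exact: cvg_fst.
have c2 : (fun p : R * 'rV[R]_m => p.1 *: v + p.2) @ (s, x) --> s *: v + x.
  apply: cvgD; last exact: cvg_snd.
  by apply: cvgZr_tmp; exact: cvg_fst.
have H1 : \forall p \near (s, x), `|f (s *: v + x) - f (p.1 *: v + x)| <= e / 2.
  exact: c1 _ H.
have H2 : \forall p \near (s, x), `|f (s *: v + x) - f (p.1 *: v + p.2)| <= e / 2.
  exact: c2 _ H.
apply: filterS2 H1 H2 => -[t y] /= h1 h2.
rewrite -[X in `|X|](subrKA (f (s *: v + x))).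
rewrite [e]splitr (le_trans (ler_normD _ _)) // lerD // distrC //.
Qed.

End IntegralAlong.

Section IntegralAlongCalculus.
Context {R : realType} {m : nat}.
Implicit Types (f g : 'rV[R]_m -> R) (x u v : 'rV[R]_m) (phi : R -> R).

Lemma int_along_continuous phi v f : continuous phi -> continuous f ->
  continuous (int_along phi v f).
Proof.
move=> pc fc x.
apply: (@int0pi_cvg _ _ (nbhs x) _ (fun y s => phi s * f (s *: v + y))
  (fun s => phi s * f (s *: v + x))); [|exact: continuous_along|].
  by apply: nearW => y; exact: continuous_along.
move=> e e0; have [K K0 KP] := bounded0pi pc.
have eK : 0 < e / K by rewrite divr_gt0.
apply: filterS (near_along v x fc eK) => y H s s0.
rewrite -mulrBr normrM (_ : e = K * (e / K)); last by rewrite mulrC divfK ?gt_eqF.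
by apply: ler_pM => //; [exact: KP|exact: H].
Qed.

Lemma mean_value_along f g x u (h : R) : (forall y, is_derive y u f (g y)) ->
  exists2 t, 0 <= t <= 1 & f (h *: u + x) - f x = h * g (t *: (h *: u) + x).
Proof.
move=> fg; have D (s : R) : is_derive s 1 (fun s => f (s *: (h *: u) + x))
    (h * g (s *: (h *: u) + x)).
  by apply: is_derive_line; exact: is_derive_scale.
have C : {within `[0, 1], continuous (fun s : R => f (s *: (h *: u) + x))}.
  apply: continuous_subspaceT => s.
  by apply: differentiable_continuous; apply/derivable1_diffP; case: (D s).
have [c cP] := MVT ltr01 (fun s _ => D s) C.
rewrite scale1r scale0r add0r subr0 mulr1 => E; exists c => //.
by move: cP; rewrite in_itv /= => /andP[? ?]; rewrite !ltW.
Qed.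

(** By the mean value theorem a difference quotient of [f] is a value of [g] at a nearby point, and
    [near_along] makes the convergence uniform in [s]. *)
Lemma int_along_is_derive phi v f g x u : continuous phi -> continuous f ->
  continuous g -> (forall y, is_derive y u f (g y)) ->
  is_derive x u (int_along phi v f) (int_along phi v g x).
Proof.
move=> pc fc gc fg; apply: cvg_is_derive.
suff -> : (fun h : R =>
      h^-1 *: (int_along phi v f (h *: u + x) - int_along phi v f x)) =
    (fun h : R => int0pi (fun s => h^-1 * (phi s * f (s *: v + (h *: u + x))) +
                             (- h^-1) * (phi s * f (s *: v + x)))); last first.
  apply/funext => h; rewrite int0pi_lin; try exact: continuous_along.
  by rewrite mulNr -mulrBr.
apply: (@int0pi_cvg R R (0 : R)^' _
  (fun h s : R => h^-1 * (phi s * f (s *: v + (h *: u + x))) +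
    (- h^-1) * (phi s * f (s *: v + x))) (fun s => phi s * g (s *: v + x)));
  [|exact: continuous_along|].
  by apply: nearW => h; apply: continuous_lin; exact: continuous_along.
move=> e e0; have [K K0 KP] := bounded0pi pc.
have eK : 0 < e / K by rewrite divr_gt0.
have /nbhs_ballP[d /= d0 dP] := near_along v x gc eK.
pose u1 := `|u| + 1.
have u10 : 0 < u1 by rewrite ltr_wpDl.
have du : 0 < d / u1 by rewrite divr_gt0.
near=> h => s s0.
have h0 : h != 0 by near: h; exact: nbhs_dnbhs_neq.
have hd : `|h| < d / u1 by near: h; apply: dnbhs0_lt.
have [t /andP[t0 t1] tE] := mean_value_along (s *: v + x) h fg.
rewrite (_ : s *: v + (h *: u + x) = h *: u + (s *: v + x)); last by rewrite addrCA.
rewrite mulNr -mulrBr -mulrBr mulrCA tE mulKf // -mulrBr normrM.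
rewrite (_ : e = K * (e / K)); last by rewrite mulrC divfK ?gt_eqF.
apply: ler_pM => //; first exact: KP.
rewrite addrCA; apply: dP => //; rewrite -ball_normE /= opprD addrCA subrr addr0 normrN.
rewrite !normrZ (ger0_norm t0) (@le_lt_trans _ _ (`|h| * u1)) // -?ltr_pdivlMr //.
apply: (@le_trans _ _ (`|h| * `|u|)); first by rewrite ler_piMl // mulr_ge0.
by rewrite ler_wpM2l // lerDl.
Unshelve. all: end_near. Qed.

Lemma smooth_continuous f : smooth_on setT f -> continuous f.
Proof. by move=> fs x; exact: smooth_on_continuous fs _. Qed.

Lemma int_along_smooth phi v f : continuous phi -> smooth_on setT f ->
  smooth_on setT (int_along phi v f).
Proof.
move=> pc fs; apply: (@smooth_on_partialsE _ _ _ _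
  (fun s => int_along phi v (partials s f))) => //.
  exact: openT.
have sc s : continuous (partials s f) by move=> x; have [] := fs s x I.
move=> s x _; split; first exact: int_along_continuous.
move=> i; apply: int_along_is_derive => // y.
by have [_ fd] := fs s y I; split.
Qed.

Lemma int_along_derive1 f g x v : continuous g ->
  (forall y, is_derive y v f (g y)) ->
  int_along (fun=> 1) v g x = f (pi *: v + x) - f x.
Proof.
move=> gc fg.
have D (s : R) : is_derive s 1 (fun s => f (s *: v + x)) (1 * g (s *: v + x)).
  by rewrite mul1r; exact: is_derive_line.
rewrite /int_along (int0pi_FTC D) ?scale0r ?add0r //.
by apply: continuous_along => // ?; exact: cvg_cst.
Qed.

Lemma continuous_ramp : continuous (fun s : R => pi - s : R).
Proof. by move=> s; apply: cvgB; [exact: cvg_cst|exact: cvg_id]. Qed.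

(** Integration by parts; the ramp vanishes at [s = pi], so the only boundary term is the one at
    [x]. *)
Lemma int_along_derive_ramp f g x v : continuous f -> continuous g ->
  (forall y, is_derive y v f (g y)) ->
  int_along (fun s => pi - s) v g x = int_along (fun=> 1) v f x - pi * f x.
Proof.
move=> fc gc fg.
have c1 : continuous (fun _ : R => 1 : R) by move=> ?; exact: cvg_cst.
have D (s : R) : is_derive s 1 (fun s => (pi - s) * f (s *: v + x))
    (1 * ((pi - s) * g (s *: v + x)) + (- 1) * (1 * f (s *: v + x))).
  have fd : is_derive s 1 (fun s : R => f (s *: v + x)) (g (s *: v + x)).
    exact: is_derive_line.
  have rd : is_derive s 1 (fun s : R => pi - s) (- 1).
    rewrite (_ : (fun s : R => pi - s) = cst pi - id) //.
    by apply: is_derive_eq; rewrite sub0r.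
  rewrite (_ : (fun s : R => _) =
    (fun s : R => pi - s) * (fun s : R => f (s *: v + x))) //.
  apply: is_derive_eq; rewrite -[(pi - s) *: _]/((pi - s) * _) -[f _ *: _]/(f _ * _).
  by ring.
have rc := continuous_along (v := v) (x := x) continuous_ramp gc.
have fc1 := continuous_along (v := v) (x := x) c1 fc.
have := int0pi_FTC D (continuous_lin (a := 1) (b := -1) rc fc1).
rewrite int0pi_lin // subrr mul0r sub0r subr0 scale0r add0r mul1r mulN1r => H.
by rewrite /int_along -[LHS](subrK (int0pi (fun s => 1 * f (s *: v + x)))) H addrC.
Qed.

End IntegralAlongCalculus.

(** * Exterior derivative and cohomology classes *)

Section ExteriorDerivative.
Context {R : realType} {m : nat}.
Implicit Types (U : set 'rV[R]_m) (x : 'rV[R]_m).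

Lemma is_derive_lin_sum (V : normedModType R) (I : Type) (r : seq I) (c d : I -> R)
    (f : I -> V -> R) (x u : V) :
  (forall i, is_derive x u (f i) (d i)) ->
  is_derive x u (fun y => \sum_(i <- r) c i * f i y) (\sum_(i <- r) c i * d i).
Proof.
move=> fd; elim: r => [|i r IH].
  rewrite big_nil (_ : (fun y => _) = cst 0); first exact: is_derive_cst.
  by apply/funext => y; rewrite big_nil.
rewrite big_cons (_ : (fun y => _) = c i *: f i + (fun y => \sum_(j <- r) c j * f j y)).
  exact: is_deriveD.
by apply/funext => y; rewrite big_cons.
Qed.

(** A permutation is split into its value at [ord0] and a permutation of the remaining indices. In
    the Leibniz rule that value is the row along which one differentiates. *)
Lemma lift_perm_sum n (F : 'S_n.+1 -> R) :
  \sum_s F s = \sum_(a < n.+1) \sum_(t : 'S_n) F (lift_perm ord0 a t).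
Proof.
rewrite pair_bigA /=.
have fI : injective (fun p : 'I_n.+1 * 'S_n => lift_perm ord0 p.1 p.2).
  move=> [a s] [b t] /= /permP E.
  have ab : a = b by have := E ord0; rewrite !lift_perm_id.
  subst b; congr (_, _); apply/permP => k; have := E (lift ord0 k).
  by rewrite !lift_perm_lift => /lift_inj.
rewrite (reindex (fun p : 'I_n.+1 * 'S_n => lift_perm ord0 p.1 p.2)) //.
apply: onW_bij; apply: inj_card_bij => //.
by rewrite card_prod !card_Sn card_ord factS.
Qed.

Lemma row_lift_perm n (a : 'I_n.+1) (t : 'S_n) (v : 'M[R]_(n.+1, m)) :
  row ord0 (row_perm (lift_perm ord0 a t) v) = row a v.
Proof. by apply/rowP => j; rewrite !mxE lift_perm_id. Qed.

Lemma row'_lift_perm n (a : 'I_n.+1) (t : 'S_n) (v : 'M[R]_(n.+1, m)) :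
  row' ord0 (row_perm (lift_perm ord0 a t) v) = row_perm t (row' a v).
Proof. by apply/matrixP => i j; rewrite !mxE lift_perm_lift. Qed.

Lemma sign_lift_perm n (a : 'I_n.+1) (t : 'S_n) :
  (-1) ^+ lift_perm ord0 a t = (-1) ^+ a * (-1) ^+ t :> R.
Proof. by rewrite odd_lift_perm /= signr_addb signr_odd. Qed.

Definition field_d k (W : 'rV[R]_m -> 'M[R]_(k, m) -> R) x (v : 'M[R]_(k.+1, m)) : R :=
  \sum_(a < k.+1) (-1) ^+ a * 'D_(row a v) (fun y => W y (row' a v)) x.

Section Leibniz.
Context {k l : nat} (W : 'rV[R]_m -> 'M[R]_(k, m) -> R)
  (H : 'rV[R]_m -> 'M[R]_(l, m) -> R) (U : set 'rV[R]_m) (x : 'rV[R]_m).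
Hypotheses (Uo : open U) (Ux : U x) (Ws : forall v, smooth_on U (W^~ v))
  (Hs : forall v, smooth_on U (H^~ v)).

(** In [dleft] and [dright] the row [ord0] is the direction of differentiation, and the derivative
    falls on the first or on the second factor. *)
Let dleft (u : 'M[R]_((k + l).+1, m)) : R :=
  'D_(row ord0 u) (fun y => W y (usubmx (row' ord0 u))) x * H x (dsubmx (row' ord0 u)).

Let dright (u : 'M[R]_((k + l).+1, m)) : R :=
  W x (usubmx (row' ord0 u)) * 'D_(row ord0 u) (fun y => H y (dsubmx (row' ord0 u))) x.

(** The sum over directions and the alternation over the other rows merge into one alternation over
    all the rows. *)
Lemma field_d_wedgeE v : field_d (fun y => wedge_at (W y) (H y)) x v =
  (k`!%:R * l`!%:R)^-1 * (alternation dleft v + alternation dright v).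
Proof.
rewrite /alternation -big_split lift_perm_sum mulr_sumr; apply: eq_bigr => a _ /=.
pose c : R := (k`!%:R * l`!%:R)^-1.
have D (t : 'S_(k + l)) : is_derive x (row a v)
    (fun y => W y (usubmx (row_perm t (row' a v))) *
              H y (dsubmx (row_perm t (row' a v))))
    (dleft (row_perm (lift_perm ord0 a t) v) + dright (row_perm (lift_perm ord0 a t) v)).
  rewrite /dleft /dright row_lift_perm row'_lift_perm.
  have WD := derivableP (smooth_on_derivable (u := row a v) Uo
    (Ws (usubmx (row_perm t (row' a v)))) Ux).
  have HD := derivableP (smooth_on_derivable (u := row a v) Uo
    (Hs (dsubmx (row_perm t (row' a v)))) Ux).
  apply: is_derive_eq (is_deriveM WD HD) _.
  by rewrite addrC; congr (_ + _); exact: mulrC.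
have [_ ->] : is_derive x (row a v) (fun y => wedge_at (W y) (H y) (row' a v))
    (\sum_(t : 'S_(k + l)) (c * (-1) ^+ t) *
      (dleft (row_perm (lift_perm ord0 a t) v) + dright (row_perm (lift_perm ord0 a t) v))).
  rewrite (_ : (fun y => _) = (fun y => \sum_(t : 'S_(k + l)) (c * (-1) ^+ t) *
     (W y (usubmx (row_perm t (row' a v))) * H y (dsubmx (row_perm t (row' a v)))))).
    exact: is_derive_lin_sum.
  apply/funext => y; rewrite /wedge_at /alternation mulr_sumr.
  by apply: eq_bigr => t _; rewrite -mulrA.
rewrite !mulr_sumr; apply: eq_bigr => t _.
by rewrite sign_lift_perm -!mulrA -mulrDr -mulrDr mulrCA.
Qed.

(** Moving row [a] to the front costs (-1)^a, which cancels the sign in [field_d]. The k+1 summands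
    become equal and turn the factor 1/(k+1)! into 1/k!. *)
Lemma wedge_field_dl v : wedge_at (field_d W x) (H x) v =
  (k`!%:R * l`!%:R)^-1 * alternation dleft v.
Proof.
rewrite /wedge_at.
rewrite (_ : (fun u : 'M[R]_(k.+1 + l, m) => field_d W x (usubmx u) * H x (dsubmx u)) =
  (fun u : 'M[R]_(k.+1 + l, m) => \sum_(a < k.+1) (-1) ^+ a *
    dleft (row_perm (lift_perm ord0 (lshift l a : 'I_(k + l).+1) 1) u))); last first.
  apply/funext => u; rewrite /field_d mulr_suml; apply: eq_bigr => a _.
  rewrite -mulrA /dleft row_lift_perm row'_lift_perm row_perm1; congr (_ * (_ * _)).
    have -> : row (lshift l a : 'I_(k + l).+1) u = row a (usubmx (u : 'M[R]_(k.+1 + l, m))).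
      by apply/rowP => j; rewrite !mxE; congr (u _ _); apply: val_inj.
    congr ('D_ _ _ _); apply/funext => y; congr (W y _).
    by apply/matrixP => i j; rewrite !mxE; congr (u _ _); apply: val_inj.
  congr (H x _); apply/matrixP => i j; rewrite !mxE; congr (u _ _); apply: val_inj => /=.
  by rewrite /bump (leq_trans (ltn_ord a : a <= k)%N (leq_addr _ _)).
rewrite alternation_sum.
under eq_bigr => a _.
  rewrite alternation_comp_perm sign_lift_perm odd_perm1 mulr1 mulrA -expr2.
  rewrite sqrr_sign mul1r; over.
rewrite sumr_const card_ord -[X in _ * X]mulr_natl mulrA; congr (_ * _).
by rewrite factS natrM -mulrA invfM mulrAC mulVf ?mul1r.
Qed.

Lemma alternation_cast n n' (e : n = n') (f : 'M[R]_(n', m) -> R) v :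
  alternation f (castmx (e, erefl) v) = alternation (fun u => f (castmx (e, erefl) u)) v.
Proof.
subst n'; rewrite /alternation; under [RHS]eq_bigr do rewrite castmx_id.
by rewrite castmx_id.
Qed.

(** Same count as for [wedge_field_dl], but the differentiated row also moves past the [k] rows of
    the first factor, whence (-1)^k. The cast identifies [k + l.+1] with [(k + l).+1]. *)
Lemma wedge_field_dr (v : 'M[R]_(k + l.+1, m)) : wedge_at (W x) (field_d H x) v =
  (k`!%:R * l`!%:R)^-1 * ((-1) ^+ k * alternation dright (castmx (addnS k l, erefl) v)).
Proof.
rewrite /wedge_at; set cst1 := castmx _.
pose a' (a : 'I_l.+1) : 'I_(k + l).+1 := cast_ord (addnS k l) (rshift k a).
rewrite (_ : (fun u : 'M[R]_(k + l.+1, m) => W x (usubmx u) * field_d H x (dsubmx u)) =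
  (fun u : 'M[R]_(k + l.+1, m) => \sum_(a < l.+1) (-1) ^+ a *
    dright (row_perm (lift_perm ord0 (a' a) 1) (cst1 u)))); last first.
  apply/funext => u; rewrite /field_d mulr_sumr; apply: eq_bigr => a _.
  rewrite mulrCA /dright row_lift_perm row'_lift_perm row_perm1; congr (_ * (_ * _)).
    congr (W x _); apply/matrixP => i j; rewrite !mxE castmxE /= cast_ord_id.
    congr (u _ _); apply: val_inj => /=.
    by rewrite /bump leqNgt (leq_trans (ltn_ord i)) //= leq_addr.
  have -> : row (a' a) (cst1 u) = row a (dsubmx u).
    apply/rowP => j; rewrite !mxE castmxE /= cast_ord_id; congr (u _ _); exact: val_inj.
  congr ('D_ _ _ _); apply/funext => y; congr (H y _).
  apply/matrixP => i j; rewrite !mxE castmxE /= cast_ord_id; congr (u _ _).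
  apply: val_inj => /=.
  by rewrite /bump leq_add2l addnCA.
rewrite alternation_sum.
under eq_bigr => a _.
  rewrite -(alternation_cast _ (fun u => dright (row_perm _ u))).
  rewrite alternation_comp_perm sign_lift_perm odd_perm1 mulr1 mulrA /= exprD mulrCA.
  rewrite -expr2 sqrr_sign mulr1; over.
rewrite sumr_const card_ord -[X in _ * X = _]mulr_natl [LHS]mulrA; congr (_ * _).
by rewrite factS natrM mulrCA invfM mulrAC mulVf ?mul1r ?pnatr_eq0.
Qed.

Lemma field_d_wedge v : field_d (fun y => wedge_at (W y) (H y)) x v =
  wedge_at (field_d W x) (H x) v +
  (-1) ^+ k * wedge_at (W x) (field_d H x) (castmx (esym (addnS k l), erefl) v).
Proof.
rewrite field_d_wedgeE wedge_field_dl wedge_field_dr castmxKV mulrDr; congr (_ + _).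
by rewrite mulrCA [(-1) ^+ k * (_ * _)]mulrA -expr2 sqrr_sign mul1r.
Qed.

End Leibniz.
End ExteriorDerivative.

(** * Exact forms, products and cohomology classes *)

Section Classes.
Context {R : realType} {m : nat} {M : smooth_atlas R m}.
Implicit Types (i j : chart M) (x : 'rV[R]_m).

Lemma wedgeE k l (w : tensor M k) (h : tensor M l) i x :
  wedge w h i x = wedge_at (w i x) (h i x).
Proof. by []. Qed.

Lemma is_form_wedge k l (w : tensor M k) (h : tensor M l) :
  is_form w -> is_form h -> is_form (wedge w h).
Proof.
move=> [w1 w2 w3 w4] [h1 h2 h3 h4]; split.
- by move=> i x ix; apply: wedge_at_multilinear; [exact: w1|exact: h1].
- by move=> i x ix; exact: wedge_at_alternating.
- move=> i v; have io := @dom_open _ _ M i.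
  apply: smooth_onZ => //; apply: smooth_on_sum => // s; apply: smooth_onZ => //.
  exact: smooth_onM.
- move=> i j W t ijt x v Wx; congr (_ * _); apply: eq_bigr => s _; congr (_ * _).
  rewrite (w4 i j W t ijt x) // (h4 i j W t ijt x) //; congr (w _ _ _ * h _ _ _);
    by apply/matrixP => a b; rewrite !mxE; apply: eq_bigr => c _; rewrite !mxE.
Qed.

Definition form_lin k (a b : R) (w h : tensor M k) : tensor M k :=
  fun i x v => a * w i x v + b * h i x v.

Lemma is_form_lin k a b (w h : tensor M k) : is_form w -> is_form h ->
  is_form (form_lin a b w h).
Proof.
move=> [w1 w2 w3 w4] [h1 h2 h3 h4]; split.
- by move=> i x ix; apply: multilinearD; [exact: w1|exact: h1].
- move=> i x ix v c d cd vcd.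
  by rewrite /form_lin (w2 i x ix v c d) // (h2 i x ix v c d) // !mulr0 addr0.
- by move=> i v; apply: smooth_on_lin; [exact: dom_open|exact: w3|exact: h3].
- move=> i j W t ijt x v Wx.
  by rewrite /form_lin (w4 i j W t ijt x) // (h4 i j W t ijt x).
Qed.

Lemma ext_d_lin k a b (w h : tensor M k) : is_form w -> is_form h ->
  form_eq (ext_d (form_lin a b w h)) (form_lin a b (ext_d w) (ext_d h)).
Proof.
move=> [_ _ w3 _] [_ _ h3 _] i x v ix; rewrite /ext_d /form_lin !mulr_sumr -big_split /=.
apply: eq_bigr => c _; have io := @dom_open _ _ M i.
have wD := derivableP (smooth_on_derivable (u := row c v) io (w3 i (row' c v)) ix).
have hD := derivableP (smooth_on_derivable (u := row c v) io (h3 i (row' c v)) ix).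
have [_ E] := is_deriveD (is_deriveZ a wD) (is_deriveZ b hD).
by rewrite [X in _ * X = _]E mulrDr; congr (_ + _); exact: mulrCA.
Qed.

Lemma exact_form_lin k a b (w h : tensor M k) : exact_form w -> exact_form h ->
  exact_form (form_lin a b w h).
Proof.
case: k w h => [|k] w h /=.
  by move=> w0 h0 i x v ix; rewrite /form_lin w0 // h0 // !mulr0 addr0.
move=> [c cF wc] [d dF hd]; exists (form_lin a b c d); first exact: is_form_lin.
by move=> i x v ix; rewrite ext_d_lin // /form_lin wc // hd.
Qed.

Lemma exact_form_eq k (w h : tensor M k) : form_eq w h -> exact_form w -> exact_form h.
Proof.
case: k w h => [|k] w h wh /=; first by move=> w0 i x v ix; rewrite -wh // w0.
by move=> [c cF wc]; exists c => // i x v ix; rewrite -wh // wc.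
Qed.

Lemma is_form0 k : is_form (@form0 _ _ M k).
Proof.
split=> [i x _ a u v w b c _ _ _|//|i v|//]; first by rewrite /form0 !mulr0 addr0.
by apply: smooth_on_cst; exact: dom_open.
Qed.

Lemma ext_d_cst k (f : 'M[R]_(k, m) -> R) :
  form_eq (ext_d (fun (_ : chart M) _ v => f v)) form0.
Proof.
move=> i x v ix; rewrite /ext_d big1 // => a _.
by rewrite (_ : (fun y => _) = cst (f (row' a v))) // derive_cst mulr0.
Qed.

Lemma exact_form0 k : exact_form (@form0 _ _ M k).
Proof.
case: k => [//|k] /=; exists form0; first exact: is_form0.
by move=> i x v ix; rewrite (ext_d_cst (fun=> 0)).
Qed.

Lemma exact_subxx k (w : tensor M k) : exact_form (form_sub w w).
Proof.
apply: exact_form_eq (exact_form0 k) => i x v ix.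
by rewrite /form_sub subrr.
Qed.

Lemma exact_sub_sym k (w h : tensor M k) :
  exact_form (form_sub w h) -> exact_form (form_sub h w).
Proof.
move=> e; apply: exact_form_eq (exact_form_lin (-1) 0 e e) => i x v ix.
by rewrite /form_sub /form_lin; ring.
Qed.

Lemma exact_sub_trans k (w h l : tensor M k) :
  exact_form (form_sub w h) -> exact_form (form_sub h l) -> exact_form (form_sub w l).
Proof.
move=> e e'; apply: exact_form_eq (exact_form_lin 1 1 e e') => i x v ix.
by rewrite /form_sub /form_lin; ring.
Qed.

Lemma coh_class_eq k (w h : tensor M k) : exact_form (form_sub w h) ->
  coh_class w = coh_class h.
Proof.
move=> wh; apply/seteqP; split=> l [lc lw]; split=> //.
  exact: exact_sub_trans lw wh.
exact: exact_sub_trans lw (exact_sub_sym wh).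
Qed.

Lemma mem_coh_class k (w : tensor M k) : closed_form w -> coh_class w w.
Proof. by move=> wc; split=> //; exact: exact_subxx. Qed.

Lemma ext_d_wedge k l (w : tensor M k) (h : tensor M l) i x v :
  is_form w -> is_form h -> chart_dom i x ->
  ext_d (wedge w h) i x v = wedge (ext_d w) h i x v +
   (-1) ^+ k * wedge w (ext_d h) i x (castmx (esym (addnS k l), erefl) v).
Proof.
move=> [_ _ w3 _] [_ _ h3 _] ix.
exact: (field_d_wedge (@dom_open _ _ M i) ix (w3 i) (h3 i)).
Qed.

Lemma wedge_eq0l k l (w : tensor M k) (h : tensor M l) i x v :
  w i x = (fun=> 0) -> wedge w h i x v = 0.
Proof.
move=> w0; rewrite wedgeE w0 /wedge_at /alternation big1 ?mulr0 // => s _.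
by rewrite mul0r mulr0.
Qed.

Lemma wedge_eq0r k l (w : tensor M k) (h : tensor M l) i x v :
  h i x = (fun=> 0) -> wedge w h i x v = 0.
Proof.
move=> h0; rewrite wedgeE h0 /wedge_at /alternation big1 ?mulr0 // => s _.
by rewrite !mulr0.
Qed.

Lemma closed_form_at k (w : tensor M k) i x : closed_form w -> chart_dom i x ->
  ext_d w i x = (fun=> 0).
Proof. by move=> [_ w0] ix; apply/funext => v; exact: w0. Qed.

Lemma closed_form_wedge k l (w : tensor M k) (h : tensor M l) :
  closed_form w -> closed_form h -> closed_form (wedge w h).
Proof.
move=> wc hc; have [wF _] := wc; have [hF _] := hc; split; first exact: is_form_wedge.
move=> i x v ix; rewrite ext_d_wedge // wedge_eq0l ?closed_form_at //.
by rewrite wedge_eq0r ?closed_form_at // mulr0 addr0.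
Qed.

Lemma exact_wedgel l (w : tensor M 2) (h : tensor M l) :
  exact_form w -> closed_form h -> exact_form (wedge w h).
Proof.
move=> [b bF wb] hc; have [hF _] := hc.
exists (wedge b h : tensor M (1 + l)); first exact: is_form_wedge.
move=> i x v ix; rewrite ext_d_wedge // [X in _ + _ * X]wedge_eq0r ?closed_form_at //.
rewrite mulr0 addr0 !wedgeE (_ : w i x = ext_d b i x) //.
by apply/funext => u; exact: wb.
Qed.

(** If [h] is the differential of [b], the product is the differential of [wedge w b], without sign
    since [w] has even degree. For [l = 0] exact means zero. *)
Lemma exact_wedger l (w : tensor M 2) (h : tensor M l) :
  closed_form w -> exact_form h -> exact_form (wedge w h).
Proof.
move=> wc; have [wF _] := wc; case: l h => [|l] h /=.
  move=> h0; exists form0; first exact: is_form0.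
  move=> i x v ix; rewrite wedge_eq0r ?(ext_d_cst (fun=> 0)) //.
  by apply/funext => u; exact: h0.
move=> [b bF hb].
exists (wedge w b : tensor M (2 + l)); first exact: (is_form_wedge wF bF).
move=> i x v ix; apply: etrans (esym (@ext_d_wedge 2 l w b i x v wF bF ix)).
rewrite [X in _ = X + _]wedge_eq0l ?closed_form_at // add0r sqrrN expr1n mul1r.
rewrite (_ : castmx _ v = v); last exact: castmx_id.
rewrite !wedgeE (_ : h i x = ext_d b i x) //.
by apply/funext => u; exact: hb.
Qed.

(** Write the difference as (w - w') h + w' (h - h'). *)
Lemma exact_wedge_sub l (w w' : tensor M 2) (h h' : tensor M l) :
  closed_form w -> closed_form w' -> closed_form h -> closed_form h' ->
  exact_form (form_sub w w') -> exact_form (form_sub h h') ->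
  exact_form (form_sub (wedge w h) (wedge w' h')).
Proof.
move=> wc wc' hc hc' ww hh.
have e1 := exact_wedgel ww hc; have e2 := exact_wedger wc' hh.
apply: exact_form_eq (exact_form_lin 1 1 e1 e2) => i x v ix.
rewrite /form_lin /form_sub /wedge !mul1r -mulrDr -mulrBr; congr (_ * _).
rewrite -big_split -sumrB /=; apply: eq_bigr => s _.
by rewrite -mulrDr -mulrBr; congr (_ * _); ring.
Qed.

Fixpoint form_pow (w : tensor M 2) n : tensor M (n * 2) :=
  match n return tensor M (n * 2) with
  | 0 => @form1 R m M
  | n'.+1 => wedge w (@form_pow w n')
  end.

Lemma form_powE w n i x : @form_pow w n i x = @wedge_pow_at _ _ (w i x) n.
Proof. by elim: n => [//|n IH] /=; rewrite wedgeE IH. Qed.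

Lemma closed_form1 : closed_form (@form1 R m M).
Proof.
split; last exact: (ext_d_cst (fun=> 1)).
split=> [i x _ []//|i x _ v []//|i v|//].
by apply: smooth_on_cst; exact: dom_open.
Qed.

Lemma closed_form_pow w n : closed_form w -> closed_form (@form_pow w n).
Proof.
move=> wc; elim: n => [|n IH]; first exact: closed_form1.
exact: (closed_form_wedge wc IH).
Qed.

(** The union in [cup] reduces to one class because a change of representatives alters the product
    by an exact form; [w] and its power show that this class does occur. *)
Lemma cup_expE w n : closed_form w -> cup_exp (coh_class w) n = coh_class (@form_pow w n).
Proof.
move=> wc; elim: n => [//|n IH] /=; rewrite {}IH.
have pc := @closed_form_pow w n wc.
apply/seteqP; split=> l.
  move=> [w' [w'c ww'] [h [hc hh] [lc ll]]]; split=> //.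
  by apply: exact_sub_trans ll _; exact: exact_wedge_sub.
move=> [lc ll]; exists w; first exact: mem_coh_class.
by exists (@form_pow w n); [exact: mem_coh_class|split].
Qed.

End Classes.

(** * Forms on a real Bott manifold *)

Section AffineJacobian.
Context {R : realType} {m p : nat}.

Lemma mulmx_continuous (P : 'M[R]_(m, p)) : continuous (fun z : 'rV[R]_m => z *m P).
Proof.
rewrite (_ : (fun z => _) = (fun z : 'rV[R]_m => \sum_i z 0 i *: row i P)); last first.
  by apply/funext => z; exact: mulmx_sum_row.
move=> x; elim: (index_enum _) => [|i r IH].
  rewrite (_ : (fun z => _) = cst 0); first exact: cst_continuous.
  by apply/funext => z; rewrite big_nil.
rewrite (_ : (fun z => _) = (fun z : 'rV[R]_m => z 0 i *: row i P) \+
    (fun z : 'rV[R]_m => \sum_(j <- r) z 0 j *: row j P)); last first.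
  by apply/funext => z; rewrite big_cons.
apply: continuousD IH.
apply: (@continuous_comp _ _ _ (fun z : 'rV[R]_m => z 0 i) (fun s : R => s *: row i P)).
  exact: coord_continuous.
exact: scalel_continuous.
Qed.

Lemma jacobian_affine (f : 'rV[R]_m -> 'rV[R]_p) (P : 'M[R]_(m, p)) x :
  (\forall z \near x, f z = f x + (z - x) *m P) -> jacobian f x = P.
Proof.
move=> fP.
have dfE : 'd f x = mulmxr P :> ('rV[R]_m -> 'rV[R]_p).
  apply: diff_unique; first exact: mulmx_continuous.
  apply/eqaddoP => e e0; rewrite /=.
  have : \forall h \near (0 : 'rV[R]_m), f (h + x) = f x + h *m P.
    move: fP; rewrite (near_shift 0 x); apply: filterS => h /=.
    by rewrite subr0 addrK.
  apply: filterS => h hE; rewrite /= !fctE /= hE opprD addrACA subrr.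
  by rewrite addrA add0r subrr normr0 mulr_ge0 // ltW.
apply/row_matrixP => i; rewrite /jacobian rowE mul_rV_lin1 dfE /= -rowE //.
Qed.

End AffineJacobian.

Section BottManifold.
Context {R : realType} {m : nat} (A : 'M['F_2]_m) (Au : bott_mx A).
Local Notation M := (bott_manifold R Au).
Implicit Types (x y : 'rV[R]_m) (e : 'rV['F_2]_m).

(** [bott_act] is additive in [e], and the unit vectors give the generators; invariance can
    therefore be stated for all [e]. *)
Lemma bott_group_act e : bott_group A (@bott_act R m A e).
Proof.
rewrite (row_sum_delta e); elim: (index_enum _) => [|j r IH].
  rewrite big_nil (_ : bott_act A 0 = id); first exact: bott_group1.
  by apply/funext => z; rewrite bott_act0.
rewrite big_cons; case: (F2P (e 0 j)) => ->; rewrite ?scale0r ?add0r // scale1r.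
have -> : @bott_act R m A (delta_mx 0 j + \sum_(i <- r) e 0 i *: delta_mx 0 i) =
    bott_involution A j \o bott_act A (\sum_(i <- r) e 0 i *: delta_mx 0 i).
  by apply/funext => z; rewrite /= bott_involutionE // bott_actD.
by apply: bott_groupM => //; exact: bott_group_gen.
Qed.

(** The coordinate [j] is reflected when the number of [i] with [e i = A i j = 1] is odd. *)
Definition holonomy_sign e (j : 'I_m) : R := if (e *m A) 0 j == 0 then 1 else -1.

Definition holonomy_mx e : 'M[R]_m := diag_mx (\row_j holonomy_sign e j).

Lemma holonomy_signP e j : holonomy_sign e j = 1 \/ holonomy_sign e j = -1.
Proof. by rewrite /holonomy_sign; case: ifP; [left|right]. Qed.

Lemma holonomy_sign_sqr e j : holonomy_sign e j * holonomy_sign e j = 1.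
Proof. by rewrite /holonomy_sign; case: ifP => _; rewrite ?mulr1 // mulrN1 opprK. Qed.

Lemma mulmx_holonomy k e (v : 'M[R]_(k, m)) i j :
  (v *m holonomy_mx e) i j = holonomy_sign e j * v i j.
Proof. by rewrite mul_mx_diag !mxE mulrC. Qed.

Lemma holonomy_mx0 : holonomy_mx 0 = 1%:M.
Proof.
apply/matrixP => i j; rewrite !mxE /holonomy_sign mul0mx mxE eqxx.
by case: (i == j).
Qed.

Lemma bott_liftE e x y z : bott_lift A e x y z = y + (z - x) *m holonomy_mx e.
Proof.
apply/rowP => j; rewrite [LHS]mxE [RHS]mxE mulmx_holonomy.
by congr (_ + _ * _); rewrite !mxE.
Qed.

Lemma bott_lift_base e x y : bott_lift A e x y x = y.
Proof. by rewrite bott_liftE subrr mul0mx addr0. Qed.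

Lemma bott_lift_ball e x y z (r : R) : 0 < r ->
  ball x r z -> ball y r (bott_lift A e x y z).
Proof.
move=> r0 /(rV_ballP _ _ r0) xz; apply/(rV_ballP _ _ r0) => j.
rewrite bott_liftE [X in _ - X]mxE mulmx_holonomy opprD addrA subrr sub0r normrN !mxE.
rewrite normrM distrC (_ : `|holonomy_sign e j| = 1) ?mul1r //.
by rewrite /holonomy_sign; case: ifP => _; rewrite ?normrN normr1.
Qed.

Lemma bott_lift_ball_sub e x y (d : chart M) : chart_dom d y ->
  exists2 r : R, 0 < r & forall z, ball x r z -> chart_dom d (bott_lift A e x y z).
Proof.
move=> dy; have /nbhs_ballP[r /= r0 rP] : nbhs y (chart_dom d).
  by apply: open_nbhs_nbhs; split => //; exact: (@dom_open _ _ M d).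
by exists r => // z xz; apply: rP; exact: bott_lift_ball.
Qed.

Lemma bott_lift_transition e x y (c d : chart M) :
  torus_exp y = bott_act A e (torus_exp x) -> chart_dom c x -> chart_dom d y ->
  exists2 W, @transition _ _ M c d W (bott_lift A e x y) & W x.
Proof.
move=> xy cx dy; have [r r0 rP] := bott_lift_ball_sub e x dy.
exists (ball x r `&` chart_dom c); last by split=> //; exact: ballxx.
split; first by apply: openI; [exact: ball_open|exact: (@dom_open _ _ M c)].
- by move=> z [].
- exact: bott_lift_smooth.
- move=> z [xz cz]; split; first exact: rP.
  apply/esym/(bott_cover_act Au (bott_group_act e)).
  exact: bott_liftP.
Qed.

(** Near [x] the transition coincides with an affine lift of a deck transformation: both take values
    in the chart [d] over the same points of the quotient, and the parametrization is injective
    there. *)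
Lemma transition_holonomy (c d : chart M) W t x : transition c d W t -> W x ->
  exists2 e, torus_exp (t x) = bott_act A e (torus_exp x) &
    jacobian t x = holonomy_mx e.
Proof.
move=> [Wo Wc _ tP] Wx; have [dt tx] := tP x Wx.
have [e _ eE] := bott_coverP (esym tx).
exists e => //; apply: jacobian_affine.
have [r r0 rP] := bott_lift_ball_sub e x dt.
have W1 : \forall z \near x, W z by exact: open_nbhs_nbhs.
have W2 : \forall z \near x, ball x r z by exact: nbhsx_ballx.
apply: filterS2 W1 W2 => z Wz xz; rewrite -bott_liftE.
have [dz tz] := tP z Wz.
apply: (bott_param_inj (Au := Au) (c := d)); rewrite ?inE //; first exact: rP.
rewrite [LHS]tz; apply: (bott_cover_act Au (bott_group_act e)).
exact: bott_liftP.
Qed.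

(* [tensor_of] and [lifted] identify the forms on the quotient with the invariant
   forms on R^m: the expression of a form at [x] is the same in all the charts
   (restrictions of [bott_cover]) that are defined at [x], in particular in the
   one centered at [x]. *)
Definition invariant_form k (W : 'rV[R]_m -> 'M[R]_(k, m) -> R) :=
  [/\ forall x, multilinear (W x), forall x, alternating (W x),
      forall v, smooth_on setT (W^~ v)
    & forall e x y v, torus_exp y = bott_act A e (torus_exp x) ->
        W x v = W y (v *m holonomy_mx e)].

Definition tensor_of k (W : 'rV[R]_m -> 'M[R]_(k, m) -> R) : tensor M k :=
  fun _ x v => W x v.

Definition lifted k (w : tensor M k) : 'rV[R]_m -> 'M[R]_(k, m) -> R :=
  fun x v => w x x v.

Lemma chart_dom_center x : @chart_dom _ _ M x x.
Proof. by apply: ballxx; exact: pihalf_gt0. Qed.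

Lemma is_form_invariant k (w : tensor M k) e x y (c d : chart M) v : is_form w ->
  torus_exp y = bott_act A e (torus_exp x) -> chart_dom c x -> chart_dom d y ->
  w c x v = w d y (v *m holonomy_mx e).
Proof.
move=> [_ _ _ wt] xy cx dy; have [W Wt Wx] := bott_lift_transition xy cx dy.
rewrite (wt c d W _ Wt x) // bott_lift_base (@jacobian_affine _ _ _ _ (holonomy_mx e)) //.
by apply: (nearW (F := nbhs x)) => z; rewrite bott_lift_base bott_liftE.
Qed.

Lemma liftedE k (w : tensor M k) (c : chart M) x v : is_form w -> chart_dom c x ->
  w c x v = lifted w x v.
Proof.
move=> wF cx; rewrite (@is_form_invariant _ w 0 x x c x) ?bott_act0 //.
  by rewrite holonomy_mx0 mulmx1.
exact: chart_dom_center.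
Qed.

Lemma lifted_invariant k (w : tensor M k) : is_form w -> invariant_form (lifted w).
Proof.
move=> wF; have [w1 w2 w3 _] := wF; split.
- by move=> x; apply: w1; exact: chart_dom_center.
- by move=> x; apply: w2; exact: chart_dom_center.
(* In [lifted w] the chart moves with the point; near [x] it may be replaced by the fixed chart
   centered at [x]. *)
- move=> v s x _; have xo := @dom_open _ _ M x.
  apply: (eq_smooth_on xo _ (w3 x v) _ (chart_dom_center x)) => y xy.
  exact: liftedE.
- move=> e x y v xy; apply: is_form_invariant => //; exact: chart_dom_center.
Qed.

Lemma is_form_tensor_of k (W : 'rV[R]_m -> 'M[R]_(k, m) -> R) :
  invariant_form W -> is_form (tensor_of W).
Proof.
move=> [W1 W2 W3 W4]; split=> [i x _|i x _|i v|i j U t ijt x v Ux].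
- exact: W1.
- exact: W2.
- by apply: smooth_on_sub (W3 v).
- by have [e xe ->] := transition_holonomy ijt Ux; exact: W4.
Qed.

End BottManifold.

(** * Averages and their homotopy to the identity *)

Section Averages.
Context {R : realType} {m : nat}.
Implicit Types (f g : 'rV[R]_m -> R) (x u : 'rV[R]_m) (phi : R -> R) (sg : R).

(* The same operator, with a weight that is even ([sg = 1]) or odd ([sg = -1]) on
   the interval from [- pi] to [pi], gives the averages and the homotopy between
   them and the identity; the parity makes it equivariant under the reflections
   of the deck group. *)
Definition smear phi sg (k : 'I_m) f x : R :=
  (2 * pi)^-1 * (int_along phi (delta_mx 0 k) f x +
                 sg * int_along phi (- delta_mx 0 k) f x).

Lemma smear_lin phi sg k (a b : R) f g x : continuous phi -> continuous f ->
  continuous g -> smear phi sg k (fun y => a * f y + b * g y) x =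
  a * smear phi sg k f x + b * smear phi sg k g x.
Proof. by move=> pc fc gc; rewrite /smear !int_along_lin //; ring. Qed.

Lemma smear_smooth phi sg k f : continuous phi -> smooth_on setT f ->
  smooth_on setT (smear phi sg k f).
Proof.
move=> pc fs; apply: smooth_onZ; first exact: openT.
have := smooth_on_lin 1 sg openT (int_along_smooth (delta_mx 0 k) pc fs)
  (int_along_smooth (- delta_mx 0 k) pc fs).
by apply: eq_smooth_on => [|x _]; [exact: openT|rewrite mul1r].
Qed.

Lemma smooth_derive u f : smooth_on setT f -> smooth_on setT ('D_u f).
Proof.
move=> fs; have H : smooth_on setT (fun x => \sum_i u 0 i * partial i f x).
  apply: smooth_on_sum => [|i]; first exact: openT.
  by apply: smooth_onZ; [exact: openT|exact: smooth_on_partial].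
apply: eq_smooth_on H => [|x _]; first exact: openT.
by rewrite (smooth_on_derive (U := setT)) //; exact: openT.
Qed.

Lemma smooth_is_derive f x u : smooth_on setT f -> is_derive x u f ('D_u f x).
Proof. by move=> fs; apply: derivableP; exact: smooth_on_derivable openT fs I. Qed.

Lemma smear_derive phi sg k f x u : continuous phi -> smooth_on setT f ->
  'D_u (smear phi sg k f) x = smear phi sg k ('D_u f) x.
Proof.
move=> pc fs.
have fc := smooth_continuous fs; have Dc := smooth_continuous (smooth_derive u fs).
have D v := int_along_is_derive v x pc fc Dc (fun y => smooth_is_derive y u fs).
have [_ E] := is_deriveZ (2 * pi)^-1
  (is_deriveD (D (delta_mx 0 k)) (is_deriveZ sg (D (- delta_mx 0 k)))).
exact: E.
Qed.

Lemma smear_eq0 phi sg k f x : (forall y, f y = 0) -> smear phi sg k f x = 0.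
Proof.
move=> f0; have E v : int_along phi v f x = 0.
  rewrite /int_along (_ : (fun s => _) = (fun=> 0)); first by rewrite int0pi_cst mul0r.
  by apply/funext => s; rewrite f0 mulr0.
by rewrite /smear !E mulr0 addr0 mulr0.
Qed.

Lemma smear_sum phi sg k (I : Type) (r : seq I) (c : I -> R)
    (f : I -> 'rV[R]_m -> R) x :
  continuous phi -> (forall i, smooth_on setT (f i)) ->
  smear phi sg k (fun y => \sum_(i <- r) c i * f i y) x =
  \sum_(i <- r) c i * smear phi sg k (f i) x.
Proof.
move=> pc fs; elim: r => [|i r IH].
  by rewrite big_nil smear_eq0 // => y; rewrite big_nil.
rewrite big_cons -IH -[X in _ + X]mul1r -smear_lin //.
- by congr (smear _ _ _ _ x); apply/funext => y; rewrite big_cons mul1r.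
- exact: smooth_continuous.
- apply/smooth_continuous/smooth_on_sum => [|j]; first exact: openT.
  by apply: smooth_onZ => //; exact: openT.
Qed.

Definition average := smear (fun=> 1) 1.

(** On the segment from -pi to pi the weight is a sawtooth: it has slope -1, vanishes at both ends,
    and jumps by 2 pi at 0. *)
Definition homotopy_primitive := smear (fun s => pi - s) (-1).

Lemma continuous1 : continuous (fun _ : R => 1 : R).
Proof. by move=> ?; exact: cvg_cst. Qed.

Lemma is_derive_opp_dir f x u (l : R) : is_derive x u f l -> is_derive x (- u) f (- l).
Proof. by move=> fl; have := is_derive_scale (-1) fl; rewrite scaleN1r mulN1r. Qed.

(** The two half periods contribute f(x + pi e_k) - f(x) and f(x) - f(x - pi e_k); their sum
    vanishes by periodicity. *)
Lemma average_partial k f x : smooth_on setT f ->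
  (forall y, f (2 * pi *: delta_mx 0 k + y) = f y) -> average k (partial k f) x = 0.
Proof.
move=> fs fp.
have fd y : is_derive y (delta_mx 0 k) f (partial k f y) by exact: smooth_is_derive.
have pc := smooth_continuous (smooth_on_partial k fs).
rewrite /average /smear mul1r (int_along_derive1 x pc fd).
have fd' y : is_derive y (- delta_mx 0 k) (fun y => (-1) * f y) (partial k f y).
  have := is_deriveZ (-1) (is_derive_opp_dir (fd y)).
  by rewrite scaleN1r opprK.
rewrite (int_along_derive1 x pc fd').
rewrite -[in X in _ + X](fp (pi *: - delta_mx 0 k + x)).
rewrite (_ : 2 * pi *: delta_mx 0 k + _ = pi *: delta_mx 0 k + x); first by ring.
by rewrite addrA scalerN -scaleNr -scalerDl; congr (_ *: _ + _); ring.
Qed.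

(** Integration by parts on each half period: the slope of the sawtooth yields the average, its jump
    at 0 yields [- f x]. *)
Lemma homotopy_primitive_partial k f x : smooth_on setT f ->
  homotopy_primitive k (partial k f) x = average k f x - f x.
Proof.
move=> fs.
have fd y : is_derive y (delta_mx 0 k) f (partial k f y) by exact: smooth_is_derive.
have fc := smooth_continuous fs.
have pc := smooth_continuous (smooth_on_partial k fs).
rewrite /homotopy_primitive /average /smear mul1r (int_along_derive_ramp x fc pc fd).
have fd' y : is_derive y (- delta_mx 0 k) (fun y => (-1) * f y) (partial k f y).
  have := is_deriveZ (-1) (is_derive_opp_dir (fd y)).
  by rewrite scaleN1r opprK.
have fc' : continuous (fun y => (-1) * f y).
  exact: smooth_continuous (smooth_onZ (-1) openT fs).
rewrite (int_along_derive_ramp x fc' pc fd').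
have -> : int_along (fun=> 1) (- delta_mx 0 k) (fun y => (-1) * f y) x =
    - int_along (fun=> 1) (- delta_mx 0 k) f x.
  have := @int_along_lin _ _ (fun=> 1) (- delta_mx 0 k) (-1) 0 f f x continuous1 fc fc.
  rewrite mul0r addr0 mulN1r => <-; congr int_along; apply/funext => y.
  by rewrite mul0r addr0.
have : pi != 0 :> R by rewrite gt_eqF // pi_gt0.
by move: pi => p p0; field.
Qed.

Definition averages (r : seq 'I_m) f := foldr average f r.

Lemma averages_smooth r f : smooth_on setT f -> smooth_on setT (averages r f).
Proof.
move=> fs; elim: r => [|k r IH]; first exact: fs.
exact: smear_smooth continuous1 IH.
Qed.

Lemma averages_lin r (a b : R) f g x : smooth_on setT f -> smooth_on setT g ->
  averages r (fun y => a * f y + b * g y) x = a * averages r f x + b * averages r g x.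
Proof.
move=> fs gs; elim: r x => //= k r IH x.
have -> : averages r (fun y => a * f y + b * g y) =
  (fun y => a * averages r f y + b * averages r g y) by apply/funext.
rewrite /average smear_lin //; first exact: continuous1.
  exact/smooth_continuous/averages_smooth.
exact/smooth_continuous/averages_smooth.
Qed.

Lemma averages_eq0 r f x : (forall y, f y = 0) -> averages r f x = 0.
Proof.
by elim: r x => [|k r IH] x f0 /=; [exact: f0|apply: smear_eq0 => y; exact: IH].
Qed.

Lemma averages_sum r (I : Type) (t : seq I) (c : I -> R) (f : I -> 'rV[R]_m -> R) x :
  (forall i, smooth_on setT (f i)) ->
  averages r (fun y => \sum_(i <- t) c i * f i y) x =
  \sum_(i <- t) c i * averages r (f i) x.
Proof.
move=> fs; elim: r x => //= k r IH x.
have -> : averages r (fun y => \sum_(i <- t) c i * f i y) =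
  (fun y => \sum_(i <- t) c i * averages r (f i) y) by apply/funext.
by apply: smear_sum => [|i]; [exact: continuous1|exact: averages_smooth].
Qed.

Lemma averages_derive r f x u : smooth_on setT f ->
  'D_u (averages r f) x = averages r ('D_u f) x.
Proof.
move=> fs; elim: r x => //= k r IH x.
rewrite /average smear_derive; [|exact: continuous1|exact: averages_smooth].
by congr (smear _ _ _ _ x); apply/funext.
Qed.

Lemma average_gt0 k f x : continuous f -> (forall y, 0 < f y) -> 0 < average k f x.
Proof.
move=> fc f0; rewrite /average /smear mul1r mulr_gt0 ?invr_gt0 ?mulr_gt0 ?pi_gt0 //.
by apply: addr_gt0; apply: int0pi_gt0 => [|s]; rewrite ?mul1r //;
  apply: continuous_along => //; exact: continuous1.
Qed.

Lemma averages_gt0 r f x : smooth_on setT f -> (forall y, 0 < f y) -> 0 < averages r f x.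
Proof.
move=> fs f0; elim: r x => //= k r IH x; apply: average_gt0 => //.
exact/smooth_continuous/averages_smooth.
Qed.

Definition periodic f := forall k y, f (2 * pi *: delta_mx 0 k + y) = f y.

Lemma averages_periodic r f : periodic f -> periodic (averages r f).
Proof.
move=> fp; elim: r => //= k r IH l y; rewrite /average /smear /int_along.
have E v : (fun s : R => 1 * averages r f (s *: v + (2 * pi *: delta_mx 0 l + y))) =
   (fun s : R => 1 * averages r f (s *: v + y)).
  by apply/funext => s; rewrite addrCA IH.
by rewrite !E.
Qed.

(** Averages commute with derivatives, so the average in direction [k] meets a derivative in its own
    direction. *)
Lemma averages_partial r f x k : smooth_on setT f -> periodic f -> k \in r ->
  averages r (partial k f) x = 0.
Proof.
move=> fs fp; elim: r x => // l r IH x.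
rewrite inE => /predU1P[->|kr] /=; last by apply: smear_eq0 => y; exact: IH.
rewrite (_ : averages r (partial l f) = partial l (averages r f)).
  by apply: average_partial; [exact: averages_smooth|move=> y; exact: averages_periodic].
by apply/funext => y; rewrite [RHS]averages_derive.
Qed.

Lemma averages_derive_eq0 f x u : smooth_on setT f -> periodic f ->
  averages (enum 'I_m) ('D_u f) x = 0.
Proof.
move=> fs fp; have -> : 'D_u f = (fun y => \sum_i u 0 i * partial i f y).
  by apply/funext => y; rewrite (smooth_on_derive (U := setT)) //; exact: openT.
rewrite averages_sum => [|i]; last exact: smooth_on_partial.
by rewrite big1 // => i _; rewrite averages_partial ?mulr0 // mem_enum.
Qed.

(** Every directional derivative of the full average is the full average of a derivative, which is
    zero. *)
Lemma averages_cst f x : smooth_on setT f -> periodic f ->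
  averages (enum 'I_m) f x = averages (enum 'I_m) f 0.
Proof.
move=> fs fp; apply: derive_eq0_cst => y u.
have := smooth_is_derive y u (averages_smooth (enum 'I_m) fs).
by rewrite averages_derive // averages_derive_eq0.
Qed.

Lemma nonvanishing_sign f : continuous f -> (forall x, f x != 0) ->
  (forall x, 0 < f x) \/ (forall x, f x < 0).
Proof.
move=> fc f0.
have H x : 0 < f x * f 0.
  rewrite lt_def mulf_neq0 //= leNgt; apply/negP => neg.
  have lc : {within `[0, 1], continuous (fun s : R => f (s *: x + 0))}.
    exact/continuous_subspaceT/continuous_line.
  have [|c _] := IVT ler01 lc (v := 0); last by apply/eqP/f0.
  rewrite scale0r scale1r !addr0 ge_min le_max.
  have [p|p|p] := ltgtP (f 0) 0.
  - by have fx : 0 < f x; [move: neg; rewrite nmulr_llt0|rewrite (ltW fx) ?orbT].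
  - by have fx : f x < 0; [move: neg; rewrite pmulr_llt0|rewrite (ltW fx) ?orbT].
  - by move: neg; rewrite p mulr0 ltxx.
have [p|p|/eqP] := ltgtP (f 0) 0; last by rewrite (negPf (f0 0)).
- by right=> x; rewrite -(nmulr_lgt0 _ p).
- by left=> x; rewrite -(pmulr_lgt0 _ p).
Qed.

End Averages.

(** * Equivariance of the averages and the homotopy formula *)

Section Homotopy.
Context {R : realType} {m : nat} (A : 'M['F_2]_m) (Au : bott_mx A).
Local Notation M := (bott_manifold R Au).
Implicit Types (x y : 'rV[R]_m) (e : 'rV['F_2]_m).
Local Notation related e x y := (torus_exp y = bott_act A e (torus_exp x)).
Local Notation holonomy_mx := (@holonomy_mx R m A).
Local Notation holonomy_sign := (@holonomy_sign R m A).

Lemma related_shift e x y z : related e x y -> related e (z + x) (z *m holonomy_mx e + y).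
Proof.
by move=> xy; rewrite -(bott_liftP _ xy) bott_liftE addrK addrC.
Qed.

Lemma related_period k x : related 0 x (2 * pi *: delta_mx 0 k + x).
Proof.
rewrite bott_act0; apply/ffunP => j; rewrite !ffunE !mxE eqxx /=.
apply: val_inj => /=; case: (j == k); last by rewrite mulr0 add0r.
by rewrite mulr1 addrC mulr_natl cosD2pi sinD2pi.
Qed.

Lemma unit_row_holonomy e k : delta_mx 0 k *m holonomy_mx e =
  holonomy_sign e k *: delta_mx 0 k :> 'rV[R]_m.
Proof.
apply/rowP => j; rewrite mulmx_holonomy !mxE eqxx /=.
by case: (j =P k) => [->//|_]; rewrite !mulr0.
Qed.

Lemma int_along_related phi v (f g : 'rV[R]_m -> R) e x y :
  (forall x y, related e x y -> f x = g y) -> related e x y ->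
  int_along phi v f x = int_along phi (v *m holonomy_mx e) g y.
Proof.
move=> fg xy; rewrite /int_along; congr int0pi; apply/funext => s; congr (_ * _).
by apply: fg; rewrite scalemxAl; exact: related_shift.
Qed.

(** A reflection of the coordinate [k] exchanges the two half periods, which multiplies the result
    by the parity [sg] of the weight. *)
Lemma smear_related phi sg k (f g : 'rV[R]_m -> R) e x y : sg * sg = 1 ->
  (forall x y, related e x y -> f x = g y) -> related e x y ->
  smear phi sg k f x = (if holonomy_sign e k == 1 then 1 else sg) * smear phi sg k g y.
Proof.
move=> sg2 fg xy; rewrite /smear.
rewrite (int_along_related _ _ fg xy) (int_along_related _ (- delta_mx 0 k) fg xy).
rewrite mulNmx unit_row_holonomy.
have [->|->] := @holonomy_signP R m A e k; first by rewrite eqxx scale1r mul1r.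
rewrite scaleN1r opprK (_ : (-1 == 1 :> R) = false); last first.
  by apply/eqP => h; have : (0 : R) < 1 by []; lra.
rewrite mulrCA; congr (_ * _); rewrite mulrDr mulrA sg2 mul1r addrC //.
Qed.

Lemma average_related r (f g : 'rV[R]_m -> R) e x y :
  (forall x y, related e x y -> f x = g y) -> related e x y ->
  averages r f x = averages r g y.
Proof.
move=> fg; elim: r x y => [|k r IH] x y xy /=; first exact: fg.
rewrite /average (smear_related _ _ (mulr1 1) IH xy).
by case: ifP; rewrite mul1r.
Qed.

(** The odd weight produces the sign that [delta_mx 0 k] acquires under the holonomy; the two cancel
    in [homotopy_form]. *)
Lemma homotopy_primitive_related k (f g : 'rV[R]_m -> R) e x y :
  (forall x y, related e x y -> f x = g y) -> related e x y ->
  homotopy_primitive k f x = holonomy_sign e k * homotopy_primitive k g y.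
Proof.
move=> fg xy; rewrite /homotopy_primitive (smear_related _ _ _ fg xy);
  last by rewrite mulrNN mulr1.
have [->|->] := @holonomy_signP R m A e k; first by rewrite eqxx.
by rewrite (_ : (-1 == 1 :> R) = false) //; apply/eqP => h; have : (0 : R) < 1 by []; lra.
Qed.

Section Forms.
Context {n : nat}.
Implicit Types W : 'rV[R]_m -> 'M[R]_(n, m) -> R.

Lemma invariant_periodic W v : invariant_form A W -> periodic (W^~ v).
Proof.
move=> [_ _ _ Wi] k y; rewrite (Wi 0 y _ v (related_period k y)).
by rewrite holonomy_mx0 mulmx1.
Qed.

Definition average_form r W : 'rV[R]_m -> 'M[R]_(n, m) -> R :=
  fun x v => averages r (W^~ v) x.

Lemma average_form_invariant r W : invariant_form A W ->
  invariant_form A (average_form r W).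
Proof.
move=> [W1 W2 W3 W4]; split.
- move=> x a u v w b c uE vE wE; rewrite /average_form -averages_lin //.
  by congr (averages r _ x); apply/funext => y; exact: W1 uE vE wE.
- by move=> x v a b ab vab; apply: averages_eq0 => y; exact: W2 ab vab.
- by move=> v; exact: averages_smooth.
- by move=> e x y v xy; apply: average_related xy => x' y'; exact: W4.
Qed.

Lemma average_form_closed r W x v : invariant_form A W ->
  (forall x v, field_d W x v = 0) -> field_d (average_form r W) x v = 0.
Proof.
move=> [_ _ W3 _] W0; rewrite /field_d /average_form.
under eq_bigr => a _ do rewrite averages_derive //.
rewrite -averages_sum => [|a]; last exact: smooth_derive.
by apply: averages_eq0 => y; exact: W0.
Qed.

Lemma average_field_d W x (v : 'M[R]_(n.+1, m)) : invariant_form A W ->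
  averages (enum 'I_m) (fun y => field_d W y v) x = 0.
Proof.
move=> WF; have [_ _ W3 _] := WF; rewrite averages_sum => [|a]; last exact: smooth_derive.
rewrite big1 // => a _; rewrite averages_derive_eq0 ?mulr0 //.
exact: invariant_periodic.
Qed.

End Forms.

Section HomotopyForm.
Context {n : nat}.
Implicit Types W : 'rV[R]_m -> 'M[R]_(n.+1, m) -> R.

(** The interior product with the coordinate field e_k. *)
Definition contract (k : 'I_m) W : 'rV[R]_m -> 'M[R]_(n, m) -> R :=
  fun x v => W x (col_mx (delta_mx 0 k : 'rV[R]_m) v : 'M[R]_(1 + n, m)).

Definition homotopy_form k W : 'rV[R]_m -> 'M[R]_(n, m) -> R :=
  fun x v => homotopy_primitive k (fun y => contract k W y v) x.

Lemma homotopy_form_invariant k W : invariant_form A W ->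
  invariant_form A (homotopy_form k W).
Proof.
move=> [W1 W2 W3 W4]; split.
- move=> x a u v w b c uE /row'P vE /row'P wE.
  rewrite /homotopy_form /homotopy_primitive -smear_lin;
    [|exact: continuous_ramp|exact: smooth_continuous (W3 _)..].
  congr (smear _ _ _ _ x); apply/funext => y.
  apply: (W1 y (rshift 1 a : 'I_(1 + n))).
  + apply/rowP => j; move/rowP: uE => /(_ j); rewrite !mxE.
    by rewrite (unsplitK (inr a)).
  + apply/row'P => i j ia; rewrite !mxE; case: split_ordP => l il //.
    by apply: vE; apply: contra ia => /eqP <-; rewrite il.
  + apply/row'P => i j ia; rewrite !mxE; case: split_ordP => l il //.
    by apply: wE; apply: contra ia => /eqP <-; rewrite il.
- move=> x v a b ab vab; apply: smear_eq0 => y.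
  apply: (W2 y _ (rshift 1 a : 'I_(1 + n)) (rshift 1 b : 'I_(1 + n))).
    by apply: contra ab => /eqP h; apply/eqP; exact: (@rshift_inj 1 n a b h).
  apply/rowP => j; move/rowP: vab => /(_ j); rewrite !mxE.
  by rewrite (unsplitK (inr a)) (unsplitK (inr b)).
- by move=> v; apply: smear_smooth; [exact: continuous_ramp|exact: W3].
- move=> e x y v xy; rewrite /homotopy_form.
  pose v' := v *m holonomy_mx e.
  (* The contraction by the image of e_k under the holonomy, that is, by e_k up to sign. *)
  pose g y := W y (col_mx (delta_mx 0 k *m holonomy_mx e) v' : 'M[R]_(1 + n, m)).
  rewrite (@homotopy_primitive_related k _ g e x y) //; last first.
    move=> x' y' xy'; rewrite /contract (W4 e x' y') // /g; congr (W y' _).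
    exact: (@mul_col_mx R 1 n m m).
  have gE : g = (fun z => holonomy_sign e k * contract k W z v').
    apply/funext => z; rewrite /g unit_row_holonomy /contract.
    set u := col_mx (delta_mx 0 k) _.
    (* A second summand with coefficient 0 gives the equation the shape required by
       [multilinear]. *)
    rewrite -[RHS]addr0 -[X in _ = _ + X](mul0r (W z u)).
    apply: (W1 z (lshift n 0 : 'I_(1 + n))).
    + apply/rowP => j; rewrite !mxE (unsplitK (inl (0 : 'I_1))) !mxE.
      by rewrite mul0r addr0.
    + apply/row'P => i j; rewrite !mxE; case: split_ordP => l -> //.
      by rewrite (ord1 l) eqxx.
    + apply/row'P => i j; rewrite !mxE; case: split_ordP => l -> //.
      by rewrite (ord1 l) eqxx.
  have Wc u : continuous (W^~ u) by exact: smooth_continuous.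
  have := @smear_lin _ _ (fun s => pi - s) (-1) k (holonomy_sign e k) 0
    (fun z => contract k W z v') (fun z => contract k W z v') y
    continuous_ramp (Wc _) (Wc _).
  rewrite mul0r addr0 /homotopy_primitive gE => E.
  rewrite (_ : (fun z => holonomy_sign e k * _) =
    (fun z => holonomy_sign e k * contract k W z v' + 0 * contract k W z v')).
    by rewrite E mulrA holonomy_sign_sqr mul1r.
  by apply/funext => z; rewrite mul0r addr0.
Qed.

(** Cartan's formula: since [W] is closed, the differential of its contraction by e_k is its
    derivative along e_k, and [homotopy_primitive_partial] integrates this derivative. *)
Lemma field_d_homotopy k W x v : invariant_form A W ->
  (forall x v, field_d W x v = 0) ->
  field_d (homotopy_form k W) x v = average_form [:: k] W x v - W x v.
Proof.
move=> [W1 W2 W3 W4] W0; rewrite /field_d /homotopy_form.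
have cs u : smooth_on setT (fun y => contract k W y u) by exact: W3.
have Dh u u' : 'D_u (fun y => homotopy_primitive k (fun z => contract k W z u') y) x =
    homotopy_primitive k ('D_u (fun z => contract k W z u')) x.
  by apply: smear_derive; [exact: continuous_ramp|exact: cs].
under eq_bigr => a _ do rewrite Dh.
rewrite -smear_sum => [||a]; [|exact: continuous_ramp|exact: smooth_derive].
rewrite -homotopy_primitive_partial //; congr (smear _ _ _ _ x); apply/funext => y.
(* Closedness is evaluated on e_k followed by the rows of [v]; the term that differentiates along
   e_k is then isolated. *)
have := W0 y (col_mx (delta_mx 0 k : 'rV[R]_m) v : 'M[R]_(1 + n.+1, m)).
rewrite /field_d big_ord_recl /= expr0 mul1r.
have -> : row ord0 (col_mx (delta_mx 0 k) v : 'M[R]_(1 + n.+1, m)) = delta_mx 0 k.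
  by apply/rowP => j; rewrite !mxE; case: split_ordP => l //; rewrite (ord1 l) mxE => _.
have -> : row' ord0 (col_mx (delta_mx 0 k) v : 'M[R]_(1 + n.+1, m)) = v.
  apply/matrixP => i j; rewrite !mxE; case: split_ordP => l.
    by move=> /(congr1 val) /=; rewrite (ord1 l).
  by move=> /(congr1 val) /= /eqP; rewrite eqSS => /eqP/val_inj ->.
move=> /eqP; rewrite addr_eq0 /partial => /eqP ->.
rewrite -sumrN; apply: eq_bigr => a _.
have rE : row (lift ord0 a) (col_mx (delta_mx 0 k) v : 'M[R]_(1 + n.+1, m)) = row a v.
  apply/rowP => j; rewrite !mxE; case: split_ordP => l.
    by move=> /(congr1 val) /=; rewrite (ord1 l).
  by move=> /(congr1 val) /= /eqP; rewrite eqSS => /eqP/val_inj ->.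
have fE : (fun z =>
      W z (row' (lift ord0 a) (col_mx (delta_mx 0 k) v : 'M[R]_(1 + n.+1, m)))) =
    (fun z => contract k W z (row' a v)).
  apply/funext => z; rewrite /contract; congr (W z _).
  apply/matrixP => i j; rewrite !mxE; case: split_ordP => l /(congr1 val) /=;
    case: split_ordP => l' /(congr1 val) /= lE'; rewrite ?lE' ?(ord1 l) ?(ord1 l') ?mxE //.
  - by rewrite /bump leq0n add1n addnS.
  - rewrite /bump leq0n !add1n ltnS addnS => -[lE]; congr (v _ j).
    exact/val_inj/esym.
by rewrite rE fE (_ : bump 0 a = a.+1) // exprS mulN1r mulNr opprK.
Qed.

End HomotopyForm.
End Homotopy.

(** * The cohomology of a real Bott manifold *)

Section Cohomology.
Context {R : realType} {m : nat} (A : 'M['F_2]_m) (Au : bott_mx A).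
Local Notation M := (bott_manifold R Au).
Implicit Types (x y : 'rV[R]_m) (e : 'rV['F_2]_m).

Lemma ext_d_lifted k (w : tensor M k) x v : is_form w ->
  ext_d w x x v = field_d (lifted w) x v.
Proof.
move=> wF; apply: eq_bigr => a _; congr (_ * _); apply: near_eq_derive.
apply: (near_open (@dom_open _ _ M x) (chart_dom_center Au x)) => y xy.
exact: liftedE.
Qed.

Lemma closed_lifted k (w : tensor M k) x v : closed_form w -> field_d (lifted w) x v = 0.
Proof.
by move=> [wF w0]; rewrite -ext_d_lifted // w0 //; exact: chart_dom_center.
Qed.

(** Telescoping: each further average changes the form by the differential of an invariant form. *)
Lemma average_form_cohomologous n r (W : 'rV[R]_m -> 'M[R]_(n.+1, m) -> R) :
  invariant_form A W -> (forall x v, field_d W x v = 0) ->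
  exact_form (form_sub (@tensor_of R m A Au _ (average_form r W)) (@tensor_of R m A Au _ W)).
Proof.
move=> WF W0; elim: r => [|k r IH].
  exact: exact_subxx.
apply: exact_sub_trans IH.
have rF := average_form_invariant r WF.
exists (@tensor_of R m A Au _ (homotopy_form k (average_form r W))).
  by apply: is_form_tensor_of; exact: homotopy_form_invariant.
move=> c x v cx; rewrite -[RHS]/(field_d (homotopy_form k (average_form r W)) x v).
rewrite (field_d_homotopy (A := A)) // => x' v'.
exact: average_form_closed WF W0.
Qed.

(* the value at [0] of the average, which is constant (average_form_cst) *)
Definition mean_form k (w : tensor M k) : 'M[R]_(k, m) -> R :=
  average_form (enum 'I_m) (lifted w) 0.

Lemma average_form_cst k (w : tensor M k) x : is_form w ->
  average_form (enum 'I_m) (lifted w) x = mean_form w.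
Proof.
move=> wF; have WF := lifted_invariant wF; have [_ _ W3 _] := WF.
apply/funext => v; apply: averages_cst => //; exact: invariant_periodic WF.
Qed.

Lemma mean_form_invariant k (w : tensor M k) : is_form w ->
  invariant_form A (fun=> mean_form w).
Proof.
move=> wF; have := average_form_invariant (enum 'I_m) (lifted_invariant wF).
rewrite (_ : average_form _ _ = fun=> mean_form w) //.
by apply/funext => x; exact: average_form_cst.
Qed.

Lemma mean_form_cohomologous k (w : tensor M k.+1) : closed_form w ->
  exact_form (form_sub w (@tensor_of R m A Au _ (fun=> mean_form w))).
Proof.
move=> wc; have [wF _] := wc; have WF := lifted_invariant wF.
have := average_form_cohomologous (enum 'I_m) WF (fun x v => closed_lifted x v wc).
move=> /exact_sub_sym; apply: exact_form_eq => c x v cx.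
by rewrite /form_sub /tensor_of average_form_cst // (liftedE _ wF cx).
Qed.

Lemma constant_form_closed k (a : 'M[R]_(k, m) -> R) : invariant_form A (fun=> a) ->
  closed_form (@tensor_of R m A Au _ (fun=> a)).
Proof. by move=> aF; split; [exact: is_form_tensor_of|exact: ext_d_cst]. Qed.

Lemma exact_form_mean k (w : tensor M k.+1) v : exact_form w ->
  averages (enum 'I_m) (fun x => w x x v) 0 = 0.
Proof.
move=> [b bF wb].
rewrite (_ : (fun x => w x x v) = (fun x => field_d (lifted b) x v)).
  exact: average_field_d (lifted_invariant bF).
by apply/funext => x; rewrite wb ?ext_d_lifted //; exact: chart_dom_center.
Qed.

Lemma related_exists e x : exists y, torus_exp y = bott_act A e (torus_exp x).
Proof.
have [t tE] := boolp.choice (fun j => circle_exp_surj (bott_act A e (torus_exp x) j)).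
exists (\row_j t j); apply/ffunP => j.
by rewrite ffunE mxE.
Qed.

(** Invariance multiplies this coefficient by the product of the signs of coordinates [p] and [q];
    as it is nonzero, the two signs agree for every [e]. *)
Lemma constant_form_columns (a : 'M[R]_(2, m) -> R) (p q : 'I_m) :
  invariant_form A (fun=> a) ->
  a (col_mx (delta_mx 0 p : 'rV[R]_m) (delta_mx 0 q : 'rV[R]_m)) != 0 ->
  col p A = col q A.
Proof.
move=> [aM _ _ aI]; have {}aM := aM 0.
set up : 'rV[R]_m := delta_mx 0 p; set uq : 'rV[R]_m := delta_mx 0 q => apq.
have aZ (s t : R) : a (col_mx (s *: up + 0 *: 0) (t *: uq + 0 *: 0)) =
    (s * t) * a (col_mx up uq).
  rewrite two_formDZr // mul0r addr0 -(set_row_col_mx0 (s *: up + 0 *: 0) 0).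
  by rewrite multilinear_row // mul0r addr0 set_row_col_mx0; ring.
have sgE e : holonomy_sign A e p * holonomy_sign A e q = 1 :> R.
  have [y xy] := related_exists e 0.
  have := aI e 0 y (col_mx up uq) xy.
  have -> : (col_mx up uq : 'M[R]_(1 + 1, m)) *m holonomy_mx A e =
      col_mx (holonomy_sign A e p *: up + 0 *: 0) (holonomy_sign A e q *: uq + 0 *: 0).
    by rewrite (@mul_col_mx R 1 1 m m) !unit_row_holonomy !scale0r !addr0.
  by rewrite aZ -[LHS]mul1r => /(mulIf apq).
(* For [e] the unit vector of index [i], [e *m A] is row [i] of [A], so the signs of coordinates [p]
   and [q] determine [A i p] and [A i q]. *)
apply/colP => i; rewrite !mxE; have := sgE (delta_mx 0 i).
rewrite /holonomy_sign -rowE !mxE.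
have N1 : (-1 : R) = 1 -> False by move=> h; have : (0 : R) < 1 by []; lra.
case: (F2P (A i p)) => ->; case: (F2P (A i q)) => -> //=.
  by rewrite mul1r => /N1.
by rewrite mulr1 => /N1.
Qed.

Lemma form_pow_not_exact n (w : tensor M 2) : (0 < n)%N -> m = (n * 2)%N ->
  symplectic_form w -> ~ exact_form (@form_pow _ _ M w n).
Proof.
case: n => // n _ mE [wc wn] ex.
pose E : 'M[R]_(n.+1 * 2, m) := rowsub (cast_ord (esym mE)) 1%:M.
pose f x := @form_pow _ _ M w n.+1 x x E.
have [pF _] := @closed_form_pow _ _ M w n.+1 wc.
have [_ _ fs _] := lifted_invariant pF; have {}fs : smooth_on setT f := fs E.
have [[w1 w2 _ _] _] := wc.
have f0 x : f x != 0.
  rewrite /f form_powE; apply: wedge_pow_nondegenerate => //.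
  - by apply: w1; exact: chart_dom_center.
  - by apply: w2; exact: chart_dom_center.
  - by move=> u; apply: wn; exact: chart_dom_center.
  - exact: row_full_cast.
have := exact_form_mean E ex; rewrite -/f.
have [fp|fn] := nonvanishing_sign (smooth_continuous fs) f0.
  by apply/eqP; rewrite gt_eqF // averages_gt0.
(* A negative coefficient is handled by linearity of the average, applied to its opposite. *)
have fs' : smooth_on setT (fun x => -1 * f x) by apply: smooth_onZ => //; exact: openT.
have fp y : 0 < -1 * f y by rewrite mulN1r oppr_gt0.
have := averages_gt0 (enum 'I_m) 0 fs' fp.
have := @averages_lin _ _ (enum 'I_m) (-1) 0 f f 0 fs fs.
rewrite (_ : (fun y => -1 * f y + 0 * f y) = fun y => -1 * f y); last first.
  by apply/funext => y; rewrite mul0r addr0.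
by move=> -> + h; rewrite h !mulr0 addr0 ltxx.
Qed.

Lemma cup_exp_coh_class0 n (w : tensor M 2) : closed_form w ->
  cup_exp (coh_class w) n = coh_class form0 <-> exact_form (@form_pow _ _ M w n).
Proof.
move=> wc; have pc := @closed_form_pow _ _ M w n wc; rewrite cup_expE //.
have s0 : form_eq (form_sub (@form_pow _ _ M w n) form0) (@form_pow _ _ M w n).
  by move=> i x v _; rewrite /form_sub subr0.
split=> [pE|ex].
  have [_] : coh_class form0 (@form_pow _ _ M w n) by rewrite -pE; exact: mem_coh_class.
  exact: exact_form_eq.
apply: coh_class_eq; apply: exact_form_eq ex => i x v ix.
by rewrite s0.
Qed.

Lemma symplectic_cup_exp n (w : tensor M 2) : (0 < n)%N -> m = (n * 2)%N ->
  symplectic_form w -> cup_exp (coh_class w) n <> coh_class form0.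
Proof.
move=> n0 mE ws /cup_exp_coh_class0; have [wc _] := ws.
by move=> /(_ wc); exact: form_pow_not_exact.
Qed.

(** The mean of [w] represents the same class; if its power vanished on all vectors, that power
    would be the zero form and the class would have zero power. *)
Lemma constant_representative n (w : tensor M 2) : closed_form w ->
  cup_exp (coh_class w) n <> coh_class form0 ->
  exists a : 'M[R]_(2, m) -> R,
  [/\ invariant_form A (fun=> a), coh_class w = coh_class (@tensor_of R m A Au _ (fun=> a))
    & exists V, wedge_pow_at a (n := n) V != 0].
Proof.
move=> wc wn; have [wF _] := wc; exists (mean_form w).
have aF := mean_form_invariant wF.
have wa := coh_class_eq (mean_form_cohomologous wc); split=> //.
apply: contrapT => h; apply: wn; rewrite wa.
apply/cup_exp_coh_class0; first exact: constant_form_closed.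
apply: exact_form_eq (exact_form0 _) => i x v ix.
rewrite form_powE /form0; apply/esym/eqP/negPn/negP => v0; apply: h.
by exists v.
Qed.

End Cohomology.

(** * Kaehler structures *)

Lemma row0_col_mx (R : realType) m (u v : 'rV[R]_m) :
  row 0 (col_mx u v : 'M[R]_(1 + 1, m)) = u.
Proof.
apply/rowP => k; rewrite !mxE; case: split_ordP => l; last by move=> /(congr1 val).
by rewrite (ord1 l).
Qed.

Lemma row1_col_mx (R : realType) m (u v : 'rV[R]_m) :
  row 1 (col_mx u v : 'M[R]_(1 + 1, m)) = v.
Proof.
apply/rowP => k; rewrite !mxE; case: split_ordP => l.
  by rewrite (ord1 l) => /(congr1 val).
by rewrite (ord1 l).
Qed.

Definition incidence_mx (R : realType) n m (f : 'I_n -> 'I_m) : 'M[R]_(m, n) :=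
  \matrix_(i, k) (i == f k)%:R.

(** On row vectors it sends the unit vector of index [j k] to that of index [j' k], and the latter
    to minus the former. *)
Definition kaehler_mx (R : realType) n m (j j' : 'I_n -> 'I_m) : 'M[R]_m :=
  incidence_mx R j *m (incidence_mx R j')^T - incidence_mx R j' *m (incidence_mx R j)^T.

Section Kaehler.
Context {R : realType} {n m : nat} (A : 'M['F_2]_m) (Au : bott_mx A).
Local Notation M := (bott_manifold R Au).

(** The form takes on [u] and [u *m J i x] the squared length of [u *m J i x], so a vector of the
    radical is killed by the invertible [J i x]. *)
Lemma kaehler_symplectic (g J : chart M -> 'rV[R]_m -> 'M[R]_m) :
  kaehler_structure n g J -> symplectic_form (fundamental_form g J).
Proof.
move=> [[_ _ gpos _] [[_ JJ _] _] _ wc]; split=> // i x u ix uw.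
have uJ : u *m J i x = 0.
  apply: contrapT => /eqP h; have := gpos i x _ ix h.
  have := uw (u *m J i x); rewrite /fundamental_form.
  rewrite row0_col_mx row1_col_mx.
  by move=> ->; rewrite ltxx.
have := congr1 (mulmx u) (JJ i x ix); rewrite mulmxA uJ mul0mx mulmxN mulmx1.
by move=> /eqP; rewrite eq_sym oppr_eq0 => /eqP.
Qed.

Variables (j j' : 'I_n -> 'I_m).
Hypotheses (jI : injective j) (jI' : injective j') (jj : forall k l, j k != j' l)
  (jC : forall i, exists k, i = j k \/ i = j' k)
  (jA : forall k, col (j k) A = col (j' k) A).

Let P := @incidence_mx R n m j.
Let Q := @incidence_mx R n m j'.
Let J := @kaehler_mx R n m j j'.

Let trP_mul (f h : 'I_n -> 'I_m) :
  (incidence_mx R f)^T *m incidence_mx R h = \matrix_(k, l) (f k == h l)%:R.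
Proof.
apply/matrixP => k l; rewrite !mxE (bigD1 (f k)) //= !mxE eqxx mul1r big1 ?addr0 //.
by move=> i ik; rewrite !mxE (negPf ik) mul0r.
Qed.

Let PTP : P^T *m P = 1%:M.
Proof. by rewrite trP_mul; apply/matrixP => k l; rewrite !mxE (inj_eq jI). Qed.

Let QTQ : Q^T *m Q = 1%:M.
Proof. by rewrite trP_mul; apply/matrixP => k l; rewrite !mxE (inj_eq jI'). Qed.

Let PTQ : P^T *m Q = 0.
Proof. by rewrite trP_mul; apply/matrixP => k l; rewrite !mxE (negPf (jj _ _)). Qed.

Let QTP : Q^T *m P = 0.
Proof. by rewrite -[LHS]trmxK trmx_mul trmxK PTQ trmx0. Qed.

(** The columns of [P] and [Q] together are the standard basis, each vector occurring once. *)
Let PQ1 : P *m P^T + Q *m Q^T = 1%:M.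
Proof.
have inP (f : 'I_n -> 'I_m) i l : injective f ->
    \sum_k (i == f k)%:R * (l == f k)%:R = ((i == l) && [exists k, i == f k])%:R :> R.
  move=> fI; have [/existsP[k /eqP ik]|] := boolP [exists k, i == f k].
    rewrite (bigD1 k) //= ik eqxx mul1r big1 ?addr0 ?andbT 1?eq_sym //.
    by move=> k' k'k; rewrite (inj_eq fI) eq_sym (negPf k'k) mul0r.
  rewrite negb_exists andbF => /forallP h; rewrite big1 // => k _.
  by rewrite (negPf (h k)) mul0r.
apply/matrixP => i l; rewrite !mxE.
under eq_bigr do rewrite !mxE.
under [X in _ + X]eq_bigr do rewrite !mxE.
rewrite !inP //; case: (i =P l) => [_|]; last by rewrite addr0.
have [k [->|->]] := jC i.
- have E1 : [exists l, j k == j l] by apply/existsP; exists k.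
  have E2 : [exists l, j k == j' l] = false by apply/negbTE/existsPn => r; exact: jj.
  by rewrite E1 E2 addr0.
- have E1 : [exists l, j' k == j l] = false.
    by apply/negbTE/existsPn => r; rewrite eq_sym; exact: jj.
  have E2 : [exists l, j' k == j' l] by apply/existsP; exists k.
  by rewrite E1 E2 add0r.
Qed.

Let JP : J *m P = - Q.
Proof. by rewrite /J /kaehler_mx -/P -/Q mulmxBl -!mulmxA QTP PTP mulmx0 mulmx1 sub0r. Qed.

Let JQ : J *m Q = P.
Proof. by rewrite /J /kaehler_mx -/P -/Q mulmxBl -!mulmxA QTQ PTQ mulmx0 mulmx1 subr0. Qed.

Let JJ : J *m J = - 1%:M.
Proof. by rewrite {2}/J /kaehler_mx -/P -/Q mulmxBr !mulmxA JP JQ mulNmx -opprD addrC PQ1. Qed.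

Let JT : J^T = - J.
Proof. by rewrite /J /kaehler_mx -/P -/Q linearB /= !trmx_mul !trmxK opprB. Qed.

Let D := @holonomy_mx R m A.

Let DT e : (D e)^T = D e. Proof. exact: tr_diag_mx. Qed.

Let DD e : D e *m D e = 1%:M.
Proof.
apply/matrixP => i l; rewrite mulmx_holonomy !mxE.
by case: (i =P l) => [->|]; rewrite ?mulr0n ?mulr0 // mulr1n holonomy_sign_sqr.
Qed.

Let sgE e k : holonomy_sign A e (j k) = holonomy_sign A e (j' k) :> R.
Proof.
rewrite /holonomy_sign (_ : (e *m A) 0 (j k) = (e *m A) 0 (j' k)) //.
rewrite !mxE; apply: eq_bigr => i _; congr (_ * _).
by have /colP/(_ i) := jA k; rewrite !mxE.
Qed.

(** The signs carried by the pairs: by [sgE] both members of a pair have the same one, so [D e] acts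
    through [D' e] on [P] and on [Q] alike. *)
Let D' e : 'M[R]_n := diag_mx (\row_k holonomy_sign A e (j k)).

Let DP e : D e *m P = P *m D' e.
Proof.
apply/matrixP => i k; rewrite mul_diag_mx mul_mx_diag !mxE.
by case: (i =P j k) => [->|]; rewrite ?mulr1 ?mul1r // mulr0 mul0r.
Qed.

Let DQ e : D e *m Q = Q *m D' e.
Proof.
apply/matrixP => i k; rewrite mul_diag_mx mul_mx_diag !mxE sgE.
by case: (i =P j' k) => [->|]; rewrite ?mulr1 ?mul1r // mulr0 mul0r.
Qed.

Let D'T e : (D' e)^T = D' e. Proof. exact: tr_diag_mx. Qed.

Let PD e : P^T *m D e = D' e *m P^T.
Proof. by rewrite -[LHS]trmxK trmx_mul trmxK DT DP trmx_mul D'T. Qed.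

Let QD e : Q^T *m D e = D' e *m Q^T.
Proof. by rewrite -[LHS]trmxK trmx_mul trmxK DT DQ trmx_mul D'T. Qed.

Let JD e : J *m D e = D e *m J.
Proof.
by rewrite /J /kaehler_mx -/P -/Q mulmxBl mulmxBr -!mulmxA PD QD !mulmxA DP DQ.
Qed.

Let smooth_cst (i : chart M) (c : R) : smooth_on (chart_dom i) (fun=> c).
Proof. by apply: smooth_on_cst; exact: (@dom_open _ _ M i). Qed.

Let smooth_coordinates (i : chart M) (f : 'I_n -> 'I_m) :
  smooth_map_on (chart_dom i) (fun x => x *m incidence_mx R f).
Proof.
move=> k; apply: eq_smooth_on (@smooth_affine R m (chart_dom i) (f k) 0 1 0) => [|x _].
  exact: (@dom_open _ _ M i).
rewrite add0r mul1r subr0 mxE (bigD1 (f k)) //= mxE eqxx mulr1.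
by rewrite big1 ?addr0 // => l lk; rewrite mxE (negPf lk) mulr0.
Qed.

(** The flat metric and the constant [J] descend because the holonomy matrices are orthogonal and
    commute with [J]. The coordinates [x *m P] and [x *m Q] are the real and imaginary parts of
    holomorphic ones. *)
Lemma pairing_kaehler : kaehler_structure (M := M) n (fun _ _ => 1%:M) (fun _ _ => J).
Proof.
split.
- split=> [i a b|i x _|i x v _ v0|i k W t ikt x Wx].
  + exact: smooth_cst.
  + exact: trmx1.
  + rewrite mulmx1 mxE lt_def sumr_ge0 ?andbT => [|l _]; last by rewrite mxE -expr2 sqr_ge0.
    apply: contra v0; rewrite psumr_eq0 => [/allP h|l _]; last by rewrite mxE -expr2 sqr_ge0.
    apply/eqP/rowP => l; have := h l (mem_index_enum _).
    by rewrite !mxE mulf_eq0 orbb => /eqP.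
  + have [e _ ->] := transition_holonomy ikt Wx.
    by rewrite mulmx1 [X in _ *m X]DT DD.
- split; first split=> [i a b|i x _|i k W t ikt x Wx].
  + exact: smooth_cst.
  + exact: JJ.
  + by have [e _ ->] := transition_holonomy ikt Wx; exact: JD.
  + move=> i x ix; exists (chart_dom i), (fun x => x *m P), (fun x => x *m Q); split=> //.
      exact: (@dom_open _ _ M i).
    split=> [||y _]; [exact: smooth_coordinates..|].
    have jac (S : 'M[R]_(m, n)) : jacobian (fun x : 'rV[R]_m => x *m S) y = S.
      apply: jacobian_affine; apply: (nearW (F := nbhs y)) => z.
      by rewrite -mulmxDl addrC subrK.
    rewrite !jac; split=> // v vP vQ.
    by rewrite -[v]mulmx1 -PQ1 mulmxDr !mulmxA vP vQ !mul0mx addr0.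
- by move=> i x _; rewrite mulmx1 JT mulmxN JJ opprK.
- have bE : @fundamental_form R m M (fun _ _ => 1%:M) (fun _ _ => J) =
      @tensor_of R m A Au 2 (fun _ v => (row 0 v *m J *m (row 1 v)^T) 0 0).
    apply/funext => i; apply/funext => x; apply/funext => v.
    by rewrite /fundamental_form mulmx1.
  rewrite bE; apply: constant_form_closed; split=> [x|x|v|e x y v _].
  + move=> a u v w b c uE vE wE.
    have o1 : (1 : 'I_2) = lift 0 0 by apply: val_inj.
    have o0 : (0 : 'I_2) = lift 1 0 by apply: val_inj.
    have R' (s : 'M[R]_(2, m)) : row' a s = row' a u -> forall b, b != a -> row b s = row b u.
      by move=> /row'P h b' ba; apply/rowP => l; rewrite !mxE h.
    case: (a =P 0) => [a0|/eqP a1].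
      rewrite a0 in uE R' vE wE; rewrite uE (R' v vE 1) // (R' w wE 1) //.
      by rewrite !mulmxDl -!scalemxAl !mxE.
    have {}a1 : a = 1 by apply: val_inj; case: (a) a1 => [[|[|]]].
    rewrite a1 in uE R' vE wE; rewrite uE (R' v vE 0) // (R' w wE 0) //.
    by rewrite [(_ + _)^T]linearD /= ![(_ *: _)^T]linearZ /= mulmxDr -!scalemxAr !mxE.
  + move=> v a b ab vab.
    have v01 : row 0 v = row 1 v.
      by case: (a) (b) ab vab => [[|[|//]] ?] [[|[|//]] ?] // _ vab;
        [|apply: esym]; apply: etrans (etrans vab _); congr (row _ v); apply: val_inj.
    rewrite v01; set u := row 1 v; set q := _ 0 0.
    (* A matrix of size 1 is its own transpose, and [J] is antisymmetric. *)
    have : q = - q.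
      rewrite /q -[in LHS](trmxK (u *m J *m u^T)) mxE !trmx_mul trmxK JT.
      by rewrite mulmxA mulmxN mulNmx mxE.
    by move=> /eqP; rewrite -addr_eq0 -mulr2n mulrn_eq0 /= => /eqP.
  + by apply: smooth_on_cst; exact: openT.
  + have rD a : row a (v *m D e) = row a v *m D e by rewrite row_mul.
    rewrite !rD trmx_mul DT [in RHS]mulmxA -(mulmxA _ J (D e)) JD [in RHS]mulmxA.
    by rewrite -(mulmxA _ (D e) (D e)) DD mulmx1.
Qed.

End Kaehler.

(** * The equivalences, proved as a cycle *)

Theorem theorem3p1 (R : realType) (n : nat) (n_gt0 : (0 < n)%N)
    (A : 'M['F_2]_(2 * n)) (Au : bott_mx A) :
  let M := bott_manifold R Au in
  [/\ cohomologically_symplectic M n <->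
        (exists j j' : 'I_n -> 'I_(2 * n), column_pairing A j j'),
      (exists j j' : 'I_n -> 'I_(2 * n), column_pairing A j j') <->
        (exists w : tensor M 2, symplectic_form w),
      (exists w : tensor M 2, symplectic_form w) <->
        (exists g J : chart M -> 'rV[R]_(2 * n) -> 'M[R]_(2 * n),
           kaehler_structure n g J)
    & forall alpha : set (tensor M 2),
        deRham M 2 alpha -> cup_exp alpha n <> coh_class form0 ->
        exists2 w : tensor M 2, symplectic_form w & alpha = coh_class w].
Proof.
move=> M.
have mE : (2 * n = n * 2)%N by rewrite mulnC.
have coh_pairing : cohomologically_symplectic M n ->
    exists j j' : 'I_n -> 'I_(2 * n), column_pairing A j j'.
  move=> [alpha [w wc ->] wn].
  have [a [aF _ [V aV]]] := constant_representative wc wn.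
  have [aM _ _ _] := aF.
  have [p [q [pI qI pq pC pqa]]] := wedge_pow_matching (aM 0) mE aV.
  exists p, q; split.
  - apply/setP => i; rewrite finset.in_setT; apply/bigcupP.
    have [k ik] := pC i; exists k => //; rewrite finset.in_set2.
    by case: ik => ->; rewrite eqxx ?orbT.
  - move=> k l kl; rewrite -setI_eq0; apply/eqP/setP => i.
    rewrite finset.in_setI !finset.in_set2 finset.in_set0; apply/negbTE.
    rewrite negb_and !negb_or.
    have [->|] := eqVneq i (p k); first by rewrite !(inj_eq pI) kl !pq /= ?orbT.
    have [->|//] := eqVneq i (q k).
    by move=> _; rewrite ![q k == p _]eq_sym !(inj_eq qI) kl !pq ?orbT.
  - by move=> k; apply: constant_form_columns aF (pqa k).
have pairing_kaehler' : (exists j j' : 'I_n -> 'I_(2 * n), column_pairing A j j') ->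
    exists g J : chart M -> 'rV[R]_(2 * n) -> 'M[R]_(2 * n), kaehler_structure n g J.
  move=> [j [j' [jC _ jA]]].
  have cover i : exists k, i = j k \/ i = j' k.
    have : i \in [set: 'I_(2 * n)]%SET by rewrite finset.in_setT.
    rewrite -jC => /bigcupP[k _].
    by rewrite finset.in_set2 => /orP[] /eqP ->; exists k; [left|right].
  pose f (p : 'I_n * bool) := if p.2 then j p.1 else j' p.1.
  (* A surjection from 2n labels onto 2n indices is injective; in particular the two members of a
     pair are distinct. *)
  have fI : injective f.
    have /image_injP H : #|[seq f x | x in predT]| == #|{: 'I_n * bool}|.
      rewrite card_prod card_bool card_ord; apply/eqP/(etrans _ (mulnC 2 n)).
      rewrite -[RHS]card_ord; apply: eq_card => i; rewrite inE.
      apply/fintype.imageP; have [k [->|->]] := cover i.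
        by exists (k, true).
      by exists (k, false).
    by move=> p q; apply: H.
  exists (fun _ _ => 1%:M), (fun _ _ => kaehler_mx R j j').
  apply: pairing_kaehler => // [k l kl|k l kl|k l].
  - by have [] := fI (k, true) (l, true) kl.
  - by have [] := fI (k, false) (l, false) kl.
  - by apply/eqP => kl; have := fI (k, true) (l, false) kl.
have kaehler_sym : (exists g J : chart M -> 'rV[R]_(2 * n) -> 'M[R]_(2 * n),
    kaehler_structure n g J) -> exists w : tensor M 2, symplectic_form w.
  by move=> [g [J gJ]]; exists (fundamental_form g J); exact: kaehler_symplectic gJ.
have sym_coh : (exists w : tensor M 2, symplectic_form w) -> cohomologically_symplectic M n.
  move=> [w ws]; have [wc _] := ws; exists (coh_class w); first by exists w.
  exact: symplectic_cup_exp ws.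
split.
- by split=> [/coh_pairing//|/pairing_kaehler'/kaehler_sym/sym_coh].
- by split=> [/pairing_kaehler'/kaehler_sym|/sym_coh/coh_pairing].
- by split=> [/sym_coh/coh_pairing/pairing_kaehler'|/kaehler_sym].
move=> alpha [w wc ->] wn.
have [a [aF -> [V aV]]] := constant_representative wc wn.
(* The constant representative itself is symplectic: its power is nonzero on some vectors, which
   excludes a radical. *)
exists (tensor_of (fun=> a)) => //; split; first exact: constant_form_closed.
have [aM aA _ _] := aF.
by move=> i x u _; exact: (wedge_pow_degenerate (aM 0) (aA 0) mE aV).
Qed.
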